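(* Let $\lambda',\lambda''\in\mathbb C$. Then the following hold. (1) $\mathcal{S}ol(\Pi\times\Pi,\mathcal M_{\lambda',\lambda'',\mu})\neq\{0\}$ if and only if $\mu$ is of the form $\mu=-\ell(\lambda'+\lambda''+\ell-1)$ for some $\ell\in\mathbb N$. (2) For any $\lambda',\lambda''\in\mathbb C$ and $\ell\in\mathbb N$, $$(\zeta_1-\zeta_2)^\ell(\zeta_1+i)^{-\lambda'-\ell}(\zeta_2+i)^{-\lambda''-\ell}\in\mathcal{S}ol(\Pi\times\Pi,\mathcal M_{\lambda',\lambda'',-\ell(\lambda'+\lambda''+\ell-1)}).$$ (3) If $\mathrm{Re}\,\lambda'>0$, $\mathrm{Re}\,\lambda''>0$ and $\ell\in\mathbb N$, then the integral transform $\Psi$ gives a bijection $$\Psi_{\lambda',\lambda''}^{\lambda'+\lambda''+2\ell}:\mathcal O(\Pi)\xrightarrow{\ \sim\ }\mathcal{S}ol(\Pi\times\Pi,\mathcal M_{\lambda',\lambda'',-\ell(\lambda'+\lambda''+\ell-1)}).$$ The inverse map is proportional to the Rankin--Cohen bidifferential operator, namely, $$\mathcal{RC}_{\lambda',\lambda''}^{\lambda'+\lambda''+2\ell}\circ\Psi_{\lambda',\lambda''}^{\lambda'+\lambda''+2\ell}=c_\ell(\lambda',\lambda'')\,\mathrm{id}\quad\text{on }\mathcal O(\Pi).$$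
   Context: $\mathbb N=\{0,1,2,\dots\}$; $(x)_k=x(x+1)\cdots(x+k-1)$. $\Pi=\{z\in\mathbb C:\mathrm{Im}\,z>0\}$; $\mathcal O(\cdot)$ denotes the space of holomorphic functions. Complex powers $(\zeta+i)^{s}$ for $\zeta\in\Pi$ use the principal branch. $P_{\lambda',\lambda''}$ is the holomorphic differential operator on $\Pi\times\Pi$ $$P_{\lambda',\lambda''}:=(\zeta_1-\zeta_2)^2\frac{\partial^2}{\partial\zeta_1\partial\zeta_2}+(\lambda''\zeta_2+\lambda'-\lambda'')\zeta_1\frac{\partial}{\partial\zeta_1}+(\lambda'\zeta_1-\lambda'+\lambda'')\zeta_2\frac{\partial}{\partial\zeta_2},$$ and for $\mu\in\mathbb C$, $\mathcal{S}ol(\Pi\times\Pi,\mathcal M_{\lambda',\lambda'',\mu}):=\{f\in\mathcal O(\Pi\times\Pi):P_{\lambda',\lambda''}f=\mu f\}$. For $\ell\in\mathbb N$, $\lambda'''=\lambda'+\lambda''+2\ell$ and $\mathrm{Re}(\lambda'+\ell)>0$, $\mathrm{Re}(\lambda''+\ell)>0$, $$(\Psi_{\lambda',\lambda''}^{\lambda'''}g)(\zeta_1,\zeta_2):=\frac{(\zeta_1-\zeta_2)^\ell}{2^{\lambda'+\lambda''+2\ell-1}\,\ell!}\int_{-1}^1 g\Big(\frac{(\zeta_2-\zeta_1)v+(\zeta_1+\zeta_2)}2\Big)(1-v)^{\lambda'+\ell-1}(1+v)^{\lambda''+\ell-1}dv,\quad g\in\mathcal O(\Pi).$$ The Rankin--Cohen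 bidifferential operator $\mathcal{RC}_{\lambda',\lambda''}^{\lambda'''}:\mathcal O(\Pi\times\Pi)\to\mathcal O(\Pi)$ is $$(\mathcal{RC}_{\lambda',\lambda''}^{\lambda'''}f)(\zeta)=\sum_{j=0}^\ell(-1)^j\frac{(\lambda'+\ell-j)_j(\lambda''+j)_{\ell-j}}{j!(\ell-j)!}\frac{\partial^\ell f}{\partial\zeta_1^{\ell-j}\partial\zeta_2^j}\Big|_{\zeta_1=\zeta_2=\zeta}.$$ The constant is $$c_\ell(\lambda',\lambda'')=\dfrac{\Gamma(\lambda'+\ell)\Gamma(\lambda''+\ell)}{(\lambda'+\lambda''+2\ell-1)\Gamma(\lambda'+\lambda''+\ell-1)\,\ell!}$$ (as a meromorphic function of $(\lambda',\lambda'')$, removable singularities being filled in by continuity).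
   Formalization: The operator P is taken to be (ζ1−ζ2)²∂1∂2 − (ζ1−ζ2)(λ''∂1 − λ'∂2); with the first-order terms as printed, part (2) fails, e.g. for λ'=λ''=1, ℓ=0. *)

(* Defs.v *)
From mathcomp Require Import all_boot all_order all_algebra.
From mathcomp Require Import complex.
From mathcomp Require Import all_classical all_reals all_analysis.
Import numFieldNormedType.Exports.

Set Implicit Arguments.
Unset Strict Implicit.
Unset Printing Implicit Defensive.

Import Order.TTheory GRing.Theory Num.Theory.
Local Open Scope classical_set_scope.
Local Open Scope ring_scope.
Local Open Scope complex_scope.

(* The regular module [R[i]^o] carries the topology and the complex normed
   module structure, so that [differentiable] and [derive1] below are complex
   differentiability and complex differentiation. *)
Notation cplx R := (R[i]^o)%type.

Definition iC {R : realType} : cplx R := 'i%C.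

Definition ofR {R : realType} (x : R) : cplx R := x%:C%C.

Definition reC {R : realType} (z : cplx R) : R := complex.Re z.

Definition imC {R : realType} (z : cplx R) : R := complex.Im z.

Definition normC {R : realType} (z : cplx R) : R :=
  Num.sqrt (reC z ^+ 2 + imC z ^+ 2).

Definition expC {R : realType} (z : cplx R) : cplx R :=
  ofR (expR (reC z)) * (ofR (cos (imC z)) + iC * ofR (sin (imC z))).

(* Principal argument, in ]-pi, pi]. *)
Definition argC {R : realType} (z : cplx R) : R :=
  let t := acos (reC z / normC z) in if 0 <= imC z then t else - t.

Definition logC {R : realType} (z : cplx R) : cplx R :=
  ofR (ln (normC z)) + iC * ofR (argC z).

(* Meaningful for [z != 0] only. *)
Definition powC {R : realType} (z s : cplx R) : cplx R := expC (s * logC z).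

Definition integralC {R : realType} (D : set R) (f : R -> cplx R) : cplx R :=
  ofR (\int[lebesgue_measure]_(x in D) reC (f x)) +
  iC * ofR (\int[lebesgue_measure]_(x in D) imC (f x)).

Definition pochhammer {R : realType} (x : cplx R) (k : nat) : cplx R :=
  \prod_(i < k) (x + i%:R).

(* Euler's limit formula
   Gamma z = lim n! n^z / (z (z + 1) ... (z + n)),
   valid for every z that is not a pole. *)
Definition GammaC {R : realType} (z : cplx R) : cplx R :=
  limn (fun n : nat => n`!%:R * powC n%:R z / pochhammer z n.+1).

Definition Gamma_pole {R : realType} (z : cplx R) : Prop :=
  exists n : nat, z = - n%:R.

Definition halfplane {R : realType} : set (cplx R) := [set z | 0 < imC z].

Definition halfplane2 {R : realType} : set (cplx R * cplx R) :=
  halfplane `*` halfplane.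

Definition extend0 {R : realType} {T : Type} (D : set T) (f : T -> cplx R) :
  T -> cplx R := patch (fun=> 0) D f.

(* A function on the open set [D] is represented by its extension by 0 to the
   whole space, so that Leibniz equality of representatives is equality on
   [D]. *)
Definition holomorphic {R : realType} {V : normedModType R[i]} (D : set V) :
  set (V -> cplx R) :=
  [set f | (forall p, D p -> differentiable f p) /\
           (forall p, ~ D p -> f p = 0)].

Definition partial1 {R : realType} (f : cplx R * cplx R -> cplx R) :
  cplx R * cplx R -> cplx R :=
  fun p => derive1 (fun z : cplx R => f (z, p.2)) p.1.

Definition partial2 {R : realType} (f : cplx R * cplx R -> cplx R) :
  cplx R * cplx R -> cplx R :=
  fun p => derive1 (fun z : cplx R => f (p.1, z)) p.2.

(* (z1 - z2)^2 d1 d2 - (z1 - z2) (l2 d1 - l1 d2).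
   Given the principal part, and (l1, l2) != (0, 0), these are the only
   continuous first-order coefficients for which
   (z1 - z2)^l (z1 + i)^(- l1 - l) (z2 + i)^(- l2 - l) is an eigenfunction with
   eigenvalue - l (l1 + l2 + l - 1) for l = 0 and l = 1. *)
Definition opP {R : realType} (l1 l2 : cplx R)
    (f : cplx R * cplx R -> cplx R) : cplx R * cplx R -> cplx R :=
  fun p => (p.1 - p.2) ^+ 2 * partial1 (partial2 f) p
           - (p.1 - p.2) * (l2 * partial1 f p - l1 * partial2 f p).

Definition Sol {R : realType} (l1 l2 mu : cplx R) :
  set (cplx R * cplx R -> cplx R) :=
  [set f | holomorphic halfplane2 f /\
           forall p, halfplane2 p -> opP l1 l2 f p = mu * f p].

(* The parameter [l] stands for the third weight l1 + l2 + 2 l. *)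
Definition Psi {R : realType} (l1 l2 : cplx R) (l : nat)
    (g : cplx R -> cplx R) : cplx R * cplx R -> cplx R :=
  extend0 halfplane2 (fun p =>
    (p.1 - p.2) ^+ l / (powC 2 (l1 + l2 + 2 * l%:R - 1) * l`!%:R) *
    integralC `]-1, 1[ (fun v : R =>
      g (((p.2 - p.1) * ofR v + (p.1 + p.2)) / 2) *
      powC (ofR (1 - v)) (l1 + l%:R - 1) *
      powC (ofR (1 + v)) (l2 + l%:R - 1))).

Definition RankinCohen {R : realType} (l1 l2 : cplx R) (l : nat)
    (f : cplx R * cplx R -> cplx R) : cplx R -> cplx R :=
  extend0 halfplane (fun z =>
    \sum_(j < l.+1)
      (-1) ^+ j *
      (pochhammer (l1 + l%:R - j%:R) j * pochhammer (l2 + j%:R) (l - j)) /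
      (j`!%:R * (l - j)`!%:R) *
      iter (l - j) partial1 (iter j partial2 f) (z, z)).

Definition c_formula {R : realType} (l : nat) (p : cplx R * cplx R) : cplx R :=
  GammaC (p.1 + l%:R) * GammaC (p.2 + l%:R) /
  ((p.1 + p.2 + 2 * l%:R - 1) * GammaC (p.1 + p.2 + l%:R - 1) * l`!%:R).

Definition c_regular {R : realType} (l : nat) : set (cplx R * cplx R) :=
  [set p | [/\ ~ Gamma_pole (p.1 + l%:R), ~ Gamma_pole (p.2 + l%:R),
               p.1 + p.2 + 2 * l%:R - 1 != 0 &
               ~ Gamma_pole (p.1 + p.2 + l%:R - 1)]].

(* Where the formula is not defined, the value of the meromorphic function is
   its limit along the points where the formula is defined. *)
Definition c_const {R : realType} (l : nat) (l1 l2 : cplx R) : cplx R :=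
  if `[< c_regular l (l1, l2) >] then c_formula l (l1, l2)
  else lim (c_formula l @ within (c_regular l) (nbhs (l1, l2))).

(* Main.v *)
From HB Require Import structures.
Require Import Defs.
From mathcomp Require Import all_boot all_order all_algebra.
From mathcomp Require Import complex ring lra.
From mathcomp Require Import all_classical all_reals all_analysis measurable_realfun.
Import numFieldNormedType.Exports.

Set Implicit Arguments.
Unset Strict Implicit.
Unset Printing Implicit Defensive.

Import Order.TTheory GRing.Theory Num.Theory.
Local Open Scope classical_set_scope.
Local Open Scope ring_scope.

(* Write x = z1 - z2, a = l1 + l, b = l2 + l.  If V is holomorphic and satisfies
   the Euler-Poisson-Darboux equation x d1 d2 V = b d1 V - a d2 V, then x^l V is
   an eigenfunction for mu = - l (l1 + l2 + l - 1).  This equation holds for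
   V = (z1 + i)^(-a) (z2 + i)^(-b), and for
   V = int g(segment from z1 to z2) (1 - v)^(a-1) (1 + v)^(b-1) dv, where it is
   an integration by parts.

   Conversely, let f be a nonzero eigenfunction and k the least order of a
   normal derivative d1^k f that does not vanish identically on the diagonal;
   k exists by the identity theorem in one variable.  Differentiating the
   equation k times in z1 and restricting to the diagonal, where d1 + d2 kills
   what vanishes there, forces mu = - k (l1 + l2 + k - 1).  For
   Re l1, Re l2 > 0 these eigenvalues are distinct, so an element of Sol is
   determined by d1^l f on the diagonal: this gives injectivity and surjectivity
   of Psi.  On functions that vanish to order l on the diagonal, the
   Rankin-Cohen operator is a multiple of d1^l, by the Vandermonde convolution;
   the constant is then the Beta integral, expressed by Gamma values. *)

(** Everything rests on Cauchy's estimates in one variable. A function of two variables is only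
    known to be differentiable over R[i]; restricted to the complex lines s -> p + s h, it inherits
    from one variable bounds on its differential and on its second-order remainder that depend only
    on a local bound of the function. Locally uniform limits, parameter integrals and the symmetry
    of second derivatives all follow from these bounds.

    The equation degenerates on the diagonal, because x divides the operator. The leading normal
    derivative therefore satisfies an indicial equation, whose unknown is the order of vanishing.

    Gamma is given by Euler's limit, so its relation with the Beta integral does not come from a
    double integral: the recursion of B(a, b) in b reduces it to a comparison of B(a, n + 1) with
    B(a, b + n + 1) for large n. The same relation shows that the Beta integral does not vanish for
    complex parameters, which the inversion of Psi requires. *)

Section ComplexNorm.
Context {R : realType}.
Implicit Types (V W : normedModType R[i]) (z w : cplx R).

(* The norm of an R[i]-module takes its values in R[i]; [nrm] is that norm read
   in R. *)
Definition nrm {V : normedModType R[i]} (v : V) : R := complex.Re `|v|.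

Lemma normr_nrm V (v : V) : `|v| = ofR (nrm v).
Proof. by rewrite /ofR /nrm RRe_real// normr_real. Qed.

Lemma ofR_le (x y : R) : (ofR x <= ofR y :> R[i]) = (x <= y).
Proof. exact: lecR. Qed.

Lemma ofR_lt (x y : R) : (ofR x < ofR y :> R[i]) = (x < y).
Proof. exact: ltcR. Qed.

Lemma ofRD (x y : R) : ofR (x + y) = ofR x + ofR y. Proof. exact: rmorphD. Qed.
Lemma ofRB (x y : R) : ofR (x - y) = ofR x - ofR y. Proof. exact: rmorphB. Qed.
Lemma ofRM (x y : R) : ofR (x * y) = ofR x * ofR y. Proof. exact: rmorphM. Qed.
Lemma ofRN (x : R) : ofR (- x) = - ofR x. Proof. exact: rmorphN. Qed.
Lemma ofRV (x : R) : ofR x^-1 = (ofR x)^-1. Proof. exact: fmorphV. Qed.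
Lemma ofRX (x : R) n : ofR (x ^+ n) = ofR x ^+ n. Proof. exact: rmorphXn. Qed.
Lemma ofR0 : ofR 0 = 0 :> cplx R. Proof. by []. Qed.
Lemma ofR1 : ofR 1 = 1 :> cplx R. Proof. by []. Qed.
Lemma ofR_nat n : ofR n%:R = n%:R :> cplx R. Proof. exact: rmorph_nat. Qed.
Lemma ofR_inj : injective (@ofR R). Proof. exact: complexI. Qed.
Lemma ofR_eq0 (x : R) : (ofR x == 0) = (x == 0).
Proof. exact: fmorph_eq0. Qed.

Lemma pos_ofR (e : R[i]) : 0 < e -> exists2 d : R, 0 < d & e = ofR d.
Proof.
move=> e0; exists (complex.Re e); last by rewrite /ofR RRe_real// gtr0_real.
by rewrite -ofR_lt /ofR RRe_real// gtr0_real.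
Qed.

Lemma nrm_ge0 V (v : V) : 0 <= nrm v.
Proof. by rewrite -ofR_le -normr_nrm normr_ge0. Qed.

Lemma nrm0 V : nrm (0 : V) = 0.
Proof. by apply: ofR_inj; rewrite -normr_nrm normr0. Qed.

Lemma nrm_eq0 V (v : V) : (nrm v == 0) = (v == 0).
Proof. by rewrite -ofR_eq0 -normr_nrm normr_eq0. Qed.

Lemma nrm_gt0 V (v : V) : (0 < nrm v) = (v != 0).
Proof. by rewrite lt_def nrm_ge0 andbT nrm_eq0. Qed.

Lemma nrmN V (v : V) : nrm (- v) = nrm v.
Proof. by rewrite /nrm normrN. Qed.

Lemma nrmC V (v w : V) : nrm (v - w) = nrm (w - v).
Proof. by rewrite -nrmN opprB. Qed.

Lemma nrmD V (v w : V) : nrm (v + w) <= nrm v + nrm w.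
Proof. by rewrite -ofR_le ofRD -!normr_nrm ler_normD. Qed.

Lemma nrmB V (v w : V) : nrm (v - w) <= nrm v + nrm w.
Proof. by rewrite -(nrmN w) nrmD. Qed.

Lemma nrmB_ge V (v w : V) : nrm v - nrm w <= nrm (v - w).
Proof. by rewrite lerBlDr -{1}(subrK w v) nrmD. Qed.

Lemma nrm_dist V (u v w : V) : nrm (v - w) <= nrm (v - u) + nrm (u - w).
Proof. by rewrite -{1}(subrK u v) -addrA nrmD. Qed.

Lemma nrmZ V (k : cplx R) (v : V) : nrm (k *: v) = nrm k * nrm v.
Proof. by apply: ofR_inj; rewrite -normr_nrm normrZ ofRM -normr_nrm -normr_nrm. Qed.

Lemma nrmM z w : nrm (z * w) = nrm z * nrm w.
Proof. by apply: ofR_inj; rewrite -normr_nrm normrM ofRM -normr_nrm -normr_nrm. Qed.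

Lemma nrmX z n : nrm (z ^+ n) = nrm z ^+ n.
Proof. by apply: ofR_inj; rewrite -normr_nrm normrX ofRX -normr_nrm. Qed.

Lemma nrmV z : nrm z^-1 = (nrm z)^-1.
Proof. by apply: ofR_inj; rewrite -normr_nrm normfV ofRV -normr_nrm. Qed.

Lemma nrm_ofR (x : R) : nrm (ofR x) = `|x|.
Proof. by rewrite /nrm normc_def /= expr0n/= addr0 sqrtr_sqr. Qed.

Lemma nrm1 : nrm (1 : cplx R) = 1.
Proof. by rewrite -ofR1 nrm_ofR normr1. Qed.

Lemma nrm_nat n : nrm (n%:R : cplx R) = n%:R.
Proof. by rewrite -ofR_nat nrm_ofR ger0_norm. Qed.

Lemma nrm_iC : nrm (iC : cplx R) = 1.
Proof. by rewrite /nrm normc_def /= expr0n/= add0r expr1n sqrtr1. Qed.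

Lemma normCE z : normC z = nrm z.
Proof. by rewrite /nrm normc_def. Qed.

Lemma cplxE z : z = ofR (reC z) + iC * ofR (imC z).
Proof. exact: complexE. Qed.

Lemma reC_D z w : reC (z + w) = reC z + reC w.
Proof. by case: z w => [a b] [c d]. Qed.
Lemma imC_D z w : imC (z + w) = imC z + imC w.
Proof. by case: z w => [a b] [c d]. Qed.
Lemma reC_N z : reC (- z) = - reC z. Proof. by case: z. Qed.
Lemma imC_N z : imC (- z) = - imC z. Proof. by case: z. Qed.
Lemma reC_B z w : reC (z - w) = reC z - reC w.
Proof. by rewrite reC_D reC_N. Qed.
Lemma imC_B z w : imC (z - w) = imC z - imC w.
Proof. by rewrite imC_D imC_N. Qed.
Lemma reC_M z w : reC (z * w) = reC z * reC w - imC z * imC w.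
Proof. by case: z w => [a b] [c d]. Qed.
Lemma imC_M z w : imC (z * w) = reC z * imC w + imC z * reC w.
Proof. by case: z w => [a b] [c d]. Qed.
Lemma reC_ofR (x : R) : reC (ofR x) = x. Proof. by []. Qed.
Lemma imC_ofR (x : R) : imC (ofR x) = 0. Proof. by []. Qed.
Lemma reC_iC : reC (iC : cplx R) = 0. Proof. by []. Qed.
Lemma imC_iC : imC (iC : cplx R) = 1. Proof. by []. Qed.
Lemma reC_nat n : reC (n%:R : cplx R) = n%:R. Proof. by rewrite -ofR_nat. Qed.
Lemma imC_nat n : imC (n%:R : cplx R) = 0. Proof. by rewrite -ofR_nat. Qed.
Lemma reC1 : reC (1 : cplx R) = 1. Proof. by []. Qed.
Lemma imC1 : imC (1 : cplx R) = 0. Proof. by []. Qed.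
Lemma reC0 : reC (0 : cplx R) = 0. Proof. by []. Qed.
Lemma imC0 : imC (0 : cplx R) = 0. Proof. by []. Qed.

Definition reimE := (reC_D, imC_D, reC_N, imC_N, reC_M, imC_M, reC_ofR,
  imC_ofR, reC_iC, imC_iC, reC_nat, imC_nat, reC1, imC1, reC0, imC0).

Lemma cplx_eq z w : reC z = reC w -> imC z = imC w -> z = w.
Proof. by case: z w => [a b] [c d] /= -> ->. Qed.

Lemma reC_le_nrm z : `|reC z| <= nrm z.
Proof.
rewrite -normCE /normC -sqrtr_sqr ler_sqrt ?lerDl ?sqr_ge0//.
by rewrite addr_ge0// sqr_ge0.
Qed.

Lemma imC_le_nrm z : `|imC z| <= nrm z.
Proof.
rewrite -normCE /normC -sqrtr_sqr ler_sqrt ?lerDr ?sqr_ge0//.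
by rewrite addr_ge0// sqr_ge0.
Qed.

Lemma nrm_le_reim z : nrm z <= `|reC z| + `|imC z|.
Proof.
rewrite {1}(cplxE z) (le_trans (nrmD _ _))// nrmM nrm_iC mul1r.
by rewrite -(nrm_ofR (reC z)) -(nrm_ofR (imC z)).
Qed.

Lemma nrm_sqr z : nrm z ^+ 2 = reC z ^+ 2 + imC z ^+ 2.
Proof. by rewrite -normCE sqr_sqrtr// addr_ge0// sqr_ge0. Qed.

Lemma nrm_pair V W (v : V) (w : W) : nrm ((v, w) : V * W) = Num.max (nrm v) (nrm w).
Proof.
rewrite /nrm prod_normE/= -!/(nrm _) (normr_nrm v) (normr_nrm w).
by rewrite /Num.max ofR_lt /Order.max; case: ifP.
Qed.

Lemma nbhs_nrm V (p : V) (A : set V) :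
  nbhs p A <-> exists2 d : R, 0 < d & forall q, nrm (q - p) < d -> A q.
Proof.
split.
  move/nbhs_normP => [e /= /pos_ofR[d d0 ->] H]; exists d => // q qd.
  by apply: H => /=; rewrite /ball_/= distrC normr_nrm ofR_lt.
move=> [d d0 H]; apply/nbhs_normP; exists (ofR d); first by rewrite /= ofR_lt.
by move=> q /=; rewrite distrC normr_nrm ofR_lt; exact: H.
Qed.

Lemma cvg_nrm T (F : set_system T) (FF : Filter F) V (f : T -> V) (l : V) :
  f @ F --> l <-> forall e : R, 0 < e -> \forall x \near F, nrm (f x - l) < e.
Proof.
split.
  move/cvgrPdist_lt => H e e0; have := H (ofR e); rewrite ofR_lt => /(_ e0).
  by apply: filterS => x; rewrite distrC normr_nrm ofR_lt.
move=> H; apply/cvgrPdist_lt => _ /pos_ofR[d d0 ->].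
by have := H d d0; apply: filterS => x; rewrite distrC normr_nrm ofR_lt.
Qed.

Lemma cvg_nrm_le T (F : set_system T) (FF : Filter F) V (f : T -> V) (l : V) :
  (forall e : R, 0 < e -> \forall x \near F, nrm (f x - l) <= e) -> f @ F --> l.
Proof.
move=> H; apply/cvg_nrm => e e0; have := H (e / 2); rewrite divr_gt0// => /(_ isT).
apply: filterS => x /le_lt_trans; apply; lra.
Qed.

Lemma continuous_nrm V (T : topologicalType) (f : T -> V) (x : T) :
  {for x, continuous f} -> {for x, continuous (fun y => nrm (f y))}.
Proof.
move=> cf; apply/cvgrPdist_lt => e e0.
move/cvg_nrm: cf => /(_ _ e0); apply: filterS => y; apply: le_lt_trans.
rewrite ler_norml; have := nrmB_ge (f y) (f x).
have := nrmB_ge (f x) (f y); rewrite (nrmC (f x)); lra.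
Qed.

Lemma continuous_reC (T : topologicalType) (f : T -> cplx R) (x : T) :
  {for x, continuous f} -> {for x, continuous (fun y => reC (f y))}.
Proof.
move=> cf; apply/cvgrPdist_lt => e e0.
move/cvg_nrm: cf => /(_ _ e0); apply: filterS => y; apply: le_lt_trans.
by rewrite distrC -reC_B reC_le_nrm.
Qed.

Lemma continuous_imC (T : topologicalType) (f : T -> cplx R) (x : T) :
  {for x, continuous f} -> {for x, continuous (fun y => imC (f y))}.
Proof.
move=> cf; apply/cvgrPdist_lt => e e0.
move/cvg_nrm: cf => /(_ _ e0); apply: filterS => y; apply: le_lt_trans.
by rewrite distrC -imC_B imC_le_nrm.
Qed.

Lemma continuous_reim (T : topologicalType) (f : T -> cplx R) (x : T) :
  {for x, continuous (fun y => reC (f y))} ->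
  {for x, continuous (fun y => imC (f y))} -> {for x, continuous f}.
Proof.
move=> c1 c2; apply/cvg_nrm => e e0.
have e2 : 0 < e / 2 by lra.
move/cvgrPdist_lt: c1 => /(_ _ e2) c1; move/cvgrPdist_lt: c2 => /(_ _ e2) c2.
near=> y; rewrite (le_lt_trans (nrm_le_reim _))// [ltRHS]splitr ltrD//.
  by rewrite reC_B distrC; near: y.
by rewrite imC_B distrC; near: y.
Unshelve. all: by end_near. Qed.

Lemma continuous_ofR : continuous (@ofR R).
Proof.
move=> x; apply/cvg_nrm => e e0; near=> y.
rewrite -ofRB nrm_ofR distrC; near: y.
by apply: (@cvgr_dist_lt _ _ _ (nbhs x) _ id x).
Unshelve. all: by end_near. Qed.

End ComplexNorm.

(** * Differentiation over R[i] *)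
Section ComplexDiff.
Context {R : realType}.
Implicit Types (V W : normedModType R[i]) (z w : cplx R).

Lemma continuous_near0 V W (f : V -> W) (p : V) : {for p, continuous f} ->
  forall e : R, 0 < e ->
  exists2 d, 0 < d & forall h, nrm h < d -> nrm (f (p + h) - f p) < e.
Proof.
move=> /cvg_nrm cf e e0; have /nbhs_nrm[d d0 H] := cf e e0.
by exists d => // h hd; apply: H; rewrite addrAC subrr add0r.
Qed.

Lemma diff_nrm V W (f : V -> W) (p : V) : differentiable f p ->
  forall e : R, 0 < e -> exists2 d, 0 < d &
  forall h, nrm h < d -> nrm (f (p + h) - f p - 'd f p h) <= e * nrm h.
Proof.
move=> /diff_locally /eqaddoP H e e0.
have := H (ofR e); rewrite ofR_lt => /(_ e0) /nbhs_nrm[d d0 {}H].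
exists d => // h hd; have := H h; rewrite subr0 => /(_ hd) /=.
rewrite !normr_nrm -ofRM ofR_le; congr (_ <= _); congr nrm.
by rewrite !fctE /= opprD addrA (addrC h).
Qed.

Lemma diff_bounded V W (f : V -> W) (p : V) : differentiable f p ->
  exists2 C : R, 0 < C & forall h, nrm ('d f p h) <= C * nrm h.
Proof.
move=> /diff_continuous /linear_bounded_continuous /linear_boundedP.
move=> [M [Mr HM]]; have : M < ofR (`|complex.Re M| + 1).
  move/complex_realP: Mr => [m ->] /=; rewrite -/(ofR _) ofR_lt.
  by have := ler_norm m; lra.
move/HM => H; exists (`|complex.Re M| + 1); first by rewrite ltr_wpDl.
by move=> h; have := H h; rewrite !normr_nrm -ofRM ofR_le.
Qed.

(** The candidate [L] is a bare function: linearity and the bound [C] turn it into a continuous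
    linear map, and uniqueness of the differential then identifies it. *)
Lemma diff_intro V W (f : V -> W) (p : V) (L : V -> W) (C : R) :
  linear L -> (forall h, nrm (L h) <= C * nrm h) ->
  (forall e : R, 0 < e -> exists2 d, 0 < d &
     forall h, nrm h < d -> nrm (f (p + h) - f p - L h) <= e * nrm h) ->
  differentiable f p /\ 'd f p = L :> (V -> W).
Proof.
move=> linL Lb H.
pose lL := GRing.isLinear.Build _ _ _ _ _ linL.
pose L' : {linear V -> W} := HB.pack L lL.
have cL : continuous L'.
  apply: bounded_linear_continuous; apply/linear_boundedP.
  exists (ofR C); split; first by apply/complex_realP; exists C.
  move=> x Cx h; rewrite (le_trans _ (ler_wpM2r _ (ltW Cx)))//.
  by rewrite !normr_nrm -ofRM ofR_le Lb.
have E : f \o shift p = cst (f p) + L' +o_ 0 id.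
  apply/eqaddoP => _ /pos_ofR[e e0 ->]; have [d d0 Hd] := H e e0.
  apply/nbhs_nrm; exists d => // h; rewrite subr0 => hd.
  rewrite /= !normr_nrm -ofRM ofR_le.
  by have := Hd h hd; rewrite !fctE /= opprD addrA (addrC p).
have dE := diff_unique cL E.
by split; [apply/diff_locallyP; rewrite dE|exact: dE].
Qed.

Lemma is_diff_intro V W (f : V -> W) (p : V) (L : V -> W) (C : R) :
  linear L -> (forall h, nrm (L h) <= C * nrm h) ->
  (forall e : R, 0 < e -> exists2 d, 0 < d &
     forall h, nrm h < d -> nrm (f (p + h) - f p - L h) <= e * nrm h) ->
  is_diff p f L.
Proof. by move=> l b H; have [? ?] := diff_intro l b H; apply: DiffDef. Qed.

Lemma is_diff1_intro (f : cplx R -> cplx R) z (l : cplx R) :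
  (forall e : R, 0 < e -> exists2 d, 0 < d &
     forall h, nrm h < d -> nrm (f (z + h) - f z - h * l) <= e * nrm h) ->
  is_diff z f ( *%R^~ l).
Proof.
apply: (@is_diff_intro _ _ _ _ _ (nrm l)).
  by move=> a u v /=; rewrite mulrDl scalerAl.
by move=> h; rewrite nrmM mulrC.
Qed.

Lemma diffE1 (f : cplx R -> cplx R) z h : differentiable f z ->
  'd f z h = h * derive1 f z.
Proof. by move=> df; rewrite diff1E. Qed.

Lemma is_diff_derive1 (f : cplx R -> cplx R) z (l : cplx R) :
  is_diff z f ( *%R^~ l) -> derive1 f z = l.
Proof.
move=> [df dfE]; have : 'd f z 1 = 1 * l by rewrite dfE.
by rewrite diffE1// !mul1r.
Qed.

Lemma is_diff1P (f : cplx R -> cplx R) z : differentiable f z ->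
  is_diff z f ( *%R^~ (derive1 f z)).
Proof. by move=> df; apply: DiffDef => //; apply/funext => h; exact: diffE1. Qed.

Lemma derive1_nrm (f : cplx R -> cplx R) z : differentiable f z ->
  forall e : R, 0 < e -> exists2 d, 0 < d &
  forall h, nrm h < d -> nrm (f (z + h) - f z - h * derive1 f z) <= e * nrm h.
Proof.
move=> df e e0; have [d d0 H] := diff_nrm df e0; exists d => // h /H.
by rewrite diffE1.
Qed.

(* The domain R and the codomain R[i] are modules over different fields, so
   the derivative of a path is defined directly. *)
Definition cder (f : R -> cplx R) (t : R) (l : cplx R) :=
  forall e : R, 0 < e -> exists2 d, 0 < d &
  forall h, `|h| < d -> nrm (f (t + h) - f t - ofR h * l) <= e * `|h|.

Lemma is_deriveR_eps (f : R -> R) (t l : R) :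
  (forall e : R, 0 < e -> exists2 d, 0 < d &
   forall h, `|h| < d -> `|f (t + h) - f t - h * l| <= e * `|h|) <->
  is_derive t 1 f l.
Proof.
split.
  move=> H.
  have C : h^-1 *: ((f \o shift t) (h *: 1) - f t) @[h --> 0^'] --> l.
    apply/cvgrPdist_le => e e0; have [d d0 Hd] := H e e0.
    near=> h; have h0 : h != 0 by near: h; exact: nbhs_dnbhs_neq.
    have hd : `|h| < d by near: h; apply: dnbhs0_lt.
    have := Hd h hd; rewrite -ler_pdivrMr ?normr_gt0// -normf_div.
    rewrite /= distrC; congr (`|_| <= _).
    by rewrite /GRing.scale/= mulr1 (addrC h) mulrBl (mulrAC h) divff// mul1r mulrC.
  by split; [apply/cvg_ex; exists l|apply: cvg_lim C].
move=> [df <-] e e0; move/derivable_nbhs: df => /eqaddoP/(_ e e0).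
move/nbhs_normP => [d /= d0 H]; exists d => // h hd; have := H h.
rewrite /ball_/= sub0r normrN => /(_ hd).
rewrite !fctE /= /GRing.scale/= mulr1 (addrC h) opprD addrA.
by [].
Unshelve. all: by end_near. Qed.

Lemma cderP (f : R -> cplx R) (t : R) (l : cplx R) :
  cder f t l <->
  is_derive t 1 (fun x => reC (f x)) (reC l) /\
  is_derive t 1 (fun x => imC (f x)) (imC l).
Proof.
have reh h : reC (f (t + h) - f t - ofR h * l) =
    reC (f (t + h)) - reC (f t) - h * reC l by rewrite !reimE mul0r subr0.
have imh h : imC (f (t + h) - f t - ofR h * l) =
    imC (f (t + h)) - imC (f t) - h * imC l by rewrite !reimE mul0r addr0.
split.
  move=> H; split; apply/is_deriveR_eps => e e0; have [d d0 Hd] := H e e0;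
    exists d => // h hd; apply: le_trans (Hd h hd).
    by rewrite -reh reC_le_nrm.
  by rewrite -imh imC_le_nrm.
move=> [/is_deriveR_eps H1 /is_deriveR_eps H2] e e0.
have e2 : 0 < e / 2 by lra.
have [d1 d10 {}H1] := H1 _ e2; have [d2 d20 {}H2] := H2 _ e2.
exists (Num.min d1 d2); first by rewrite lt_min d10.
move=> h; rewrite lt_min => /andP[h1 h2].
rewrite (le_trans (nrm_le_reim _))// reh imh.
by have := H1 h h1; have := H2 h h2; lra.
Qed.

Lemma cder_cst (c : cplx R) t : cder (fun=> c) t 0.
Proof.
move=> e e0; exists 1 => // h _.
by rewrite subrr mulr0 subrr nrm0 mulr_ge0// ltW.
Qed.

Lemma cder_ofR (a : R -> R) (t l : R) : is_derive t 1 a l ->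
  cder (fun x => ofR (a x)) t (ofR l).
Proof.
by move=> da; apply/cderP; split => //; rewrite imC_ofR; exact: is_derive_cst.
Qed.

Lemma cderD (f g : R -> cplx R) t l m : cder f t l -> cder g t m ->
  cder (fun x => f x + g x) t (l + m).
Proof.
move=> /cderP[f1 f2] /cderP[g1 g2]; apply/cderP; split; rewrite reimE.
  have := is_deriveD f1 g1; rewrite /GRing.add /=.
  by under [X in _ -> is_derive _ _ X _]eq_fun do rewrite reC_D.
have := is_deriveD f2 g2; rewrite /GRing.add /=.
by under [X in _ -> is_derive _ _ X _]eq_fun do rewrite imC_D.
Qed.

Lemma cder_continuous (f : R -> cplx R) t l : cder f t l ->
  {for t, continuous f}.
Proof.
move=> /cderP[[d1 _] [d2 _]]; apply: continuous_reim.
  exact/differentiable_continuous/derivable1_diffP.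
exact/differentiable_continuous/derivable1_diffP.
Qed.

Lemma cder_comp (phi : cplx R -> cplx R) (g : R -> cplx R) t l :
  differentiable phi (g t) -> cder g t l ->
  cder (fun x => phi (g x)) t (derive1 phi (g t) * l).
Proof.
move=> dp dg e e0.
set D := derive1 phi (g t).
pose K := nrm l + 1.
have K0 : 0 < K by rewrite ltr_wpDl// nrm_ge0.
have e1 : 0 < e / (2 * K) by rewrite divr_gt0// mulr_gt0.
(* The bound 1 on the remainder of [g] keeps the increment [k] below K |h|; the other bound makes
   this remainder contribute at most e / 2 |h| after multiplication by [D]. *)
have e2 : 0 < Num.min 1 (e / (2 * (nrm D + 1))).
  by rewrite lt_min ltr01 divr_gt0// mulr_gt0// ltr_wpDl// nrm_ge0.
have [d d0 Hd] := derive1_nrm dp e1.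
have [d' d'0 Hd'] := dg _ e2.
exists (Num.min d' (d / K)); first by rewrite lt_min d'0 divr_gt0.
move=> h; rewrite lt_min => /andP[hd' hdK].
have := Hd' h hd'; set r := g (t + h) - g t - ofR h * l => rb.
set k := g (t + h) - g t.
have kb : nrm k <= K * `|h|.
  have -> : k = r + ofR h * l by rewrite /r subrK.
  rewrite (le_trans (nrmD _ _))// nrmM nrm_ofR /K mulrDl mul1r addrC.
  rewrite mulrC lerD2l (le_trans rb)// ler_piMl// ge_min lexx//.
have kd : nrm k < d by rewrite (le_lt_trans kb)// mulrC -ltr_pdivlMr.
have := Hd k kd; rewrite /k (addrC (g t)) subrK -/k -/D => H.
have -> : phi (g (t + h)) - phi (g t) - ofR h * (D * l) =
  (phi (g (t + h)) - phi (g t) - k * D) + r * D.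
  by rewrite /r /k; ring.
rewrite (le_trans (nrmD _ _))// nrmM [leRHS](_ : _ = e / 2 * `|h| + e / 2 * `|h|);
  last by field.
apply: lerD.
  rewrite (le_trans H)// [leRHS](_ : _ = e / (2 * K) * (K * `|h|)).
    by rewrite ler_wpM2l// ltW.
  by field; rewrite gt_eqF.
have nD0 := nrm_ge0 D.
apply: le_trans (_ : e / (2 * (nrm D + 1)) * `|h| * nrm D <= _).
  rewrite ler_wpM2r// (le_trans rb)// ler_wpM2r// ge_min lexx orbT//.
rewrite [leRHS](_ : _ = e / (2 * (nrm D + 1)) * `|h| * (nrm D + 1)).
  rewrite ler_wpM2l//; last lra.
  by rewrite mulr_ge0// divr_ge0//; lra.
by field; lra.
Qed.

Lemma cderM (f g : R -> cplx R) (t : R) l m : cder f t l -> cder g t m ->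
  cder (fun x => f x * g x) t (f t * m + g t * l).
Proof.
move=> /cderP[f1 f2] /cderP[g1 g2]; apply/cderP; split.
  have -> : (fun x => reC (f x * g x)) = (fun x => reC (f x)) * (fun x => reC (g x))
      - (fun x => imC (f x)) * (fun x => imC (g x)).
    by apply/funext => x; rewrite !fctE reC_M.
  apply: is_derive_eq; rewrite !reimE /GRing.scale/=.
  by move: (reC (f t))
    (reC (g t)) (imC (f t)) (imC (g t)) (reC l) (imC l) (reC m) (imC m); clear => *; ring.
have -> : (fun x => imC (f x * g x)) = (fun x => reC (f x)) * (fun x => imC (g x))
    + (fun x => imC (f x)) * (fun x => reC (g x)).
  by apply/funext => x; rewrite !fctE imC_M.
apply: is_derive_eq; rewrite !reimE /GRing.scale/=.
by move: (reC (f t))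
  (reC (g t)) (imC (f t)) (imC (g t)) (reC l) (imC l) (reC m) (imC m); clear => *; ring.
Qed.

Lemma cder_eq (f : R -> cplx R) t l m : cder f t l -> l = m -> cder f t m.
Proof. by move=> ? <-. Qed.

Lemma dif_add V (f g : V -> cplx R) (p : V) :
  differentiable f p -> differentiable g p -> differentiable (fun q => f q + g q) p.
Proof. by move=> df dg; exact: (@differentiableD _ _ _ f g p df dg). Qed.

Lemma dif_sub V (f g : V -> cplx R) (p : V) :
  differentiable f p -> differentiable g p -> differentiable (fun q => f q - g q) p.
Proof. by move=> df dg; exact: (@differentiableB _ _ _ f g p df dg). Qed.

Lemma dif_mul V (f g : V -> cplx R) (p : V) :
  differentiable f p -> differentiable g p -> differentiable (fun q => f q * g q) p.
Proof. by move=> df dg; exact: (@differentiableM _ _ f g p df dg). Qed.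

Lemma dif_inv V (f : V -> cplx R) (p : V) :
  differentiable f p -> f p != 0 -> differentiable (fun q => (f q)^-1) p.
Proof. by move=> df f0; exact: (@differentiableV _ _ f p df f0). Qed.

Lemma dif_cst V (c : cplx R) (p : V) : differentiable (fun _ : V => c) p.
Proof. exact: differentiable_cst. Qed.

Lemma dif_id z : differentiable (fun w : cplx R => w) z.
Proof. exact: ex_diff. Qed.

Lemma dif_exp V (f : V -> cplx R) (p : V) n :
  differentiable f p -> differentiable (fun q => f q ^+ n) p.
Proof.
move=> df; elim: n => [|n IH]; first exact: dif_cst.
under eq_fun do rewrite exprS.
exact: dif_mul.
Qed.

Lemma derive1_mul (f g : cplx R -> cplx R) z :
  differentiable f z -> differentiable g z ->
  derive1 (fun w => f w * g w) z = f z * derive1 g z + g z * derive1 f z.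
Proof.
move=> df dg; have d := dif_mul df dg.
have [_ E] := is_diffM (is_diff1P df) (is_diff1P dg).
rewrite -[LHS]mul1r -(diffE1 1 d).
transitivity (f z * (1 * derive1 g z) + g z * (1 * derive1 f z)).
  exact: (congr1 (fun k : cplx R -> cplx R => k 1) E).
by move: (derive1 f z) (derive1 g z) (f z) (g z) => a b c k; rewrite !mul1r.
Qed.

Lemma derive1_add (f g : cplx R -> cplx R) z :
  differentiable f z -> differentiable g z ->
  derive1 (fun w => f w + g w) z = derive1 f z + derive1 g z.
Proof.
move=> df dg; have d := dif_add df dg.
have [_ E] := is_diffD (is_diff1P df) (is_diff1P dg).
rewrite -[LHS]mul1r -(diffE1 1 d).
transitivity (1 * derive1 f z + 1 * derive1 g z).
  exact: (congr1 (fun k : cplx R -> cplx R => k 1) E).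
by move: (derive1 f z) (derive1 g z) (f z) (g z) => a b c k; rewrite !mul1r.
Qed.

Lemma derive1_const (c z : cplx R) : derive1 (fun _ : cplx R => c) z = 0.
Proof. exact: derive1_cst. Qed.

Lemma derive1_idc z : derive1 (fun w : cplx R => w) z = 1.
Proof.
apply: is_diff_derive1; apply: is_diff1_intro => e e0; exists 1 => // h _.
rewrite (_ : _ - _ = 0) ?nrm0; last by ring.
by rewrite mulr_ge0 ?nrm_ge0 ?(ltW e0).
Qed.

(** The product of [f] and its inverse is 1 near [z], so the product rule determines the derivative
    of the inverse. *)
Lemma derive1_inv (f : cplx R -> cplx R) z : differentiable f z -> f z != 0 ->
  derive1 (fun w => (f w)^-1) z = - derive1 f z / f z ^+ 2.
Proof.
move=> df fz0; have dV := dif_inv df fz0.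
have cf : {for z, continuous f} by exact: differentiable_continuous.
have n0 : \forall w \near z, f w * (f w)^-1 = 1.
  have f0 : 0 < nrm (f z) by rewrite nrm_gt0.
  have [d d0 Hd] := continuous_near0 cf f0.
  apply/nbhs_nrm; exists d => // w /Hd; rewrite (addrC z) subrK => fw.
  rewrite divff// -nrm_gt0; have := nrmB_ge (f z) (f w); rewrite nrmC; lra.
have E : derive1 (fun w => f w * (f w)^-1) z = 0.
  apply: is_diff_derive1; apply: is_diff1_intro => e e0.
  have [d d0 Hd] := (nbhs_nrm _ _).1 n0; exists d => // h hd.
  rewrite Hd ?(Hd z) ?subrr ?nrm0//; last by rewrite addrAC subrr add0r.
  by rewrite mulr0 subr0 nrm0 mulr_ge0 ?nrm_ge0 ?(ltW e0).
move: E; rewrite (derive1_mul df dV).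
move: (derive1 (fun w => (f w)^-1) z) (derive1 f z) (f z) fz0 => D F k k0 E.
apply: (mulfI k0); apply/eqP; rewrite -subr_eq0; apply/eqP.
by rewrite -[RHS]E; field.
Qed.

Lemma derive1_exp (f : cplx R -> cplx R) z n : differentiable f z ->
  derive1 (fun w => f w ^+ n) z = n%:R * f z ^+ n.-1 * derive1 f z.
Proof.
move=> df; elim: n => [|n IH].
  by rewrite mul0r mul0r derive1_const.
have -> : (fun w => f w ^+ n.+1) = (fun w => f w * f w ^+ n).
  by apply/funext => w; rewrite exprS.
rewrite (derive1_mul df (dif_exp n df)) IH -natr1.
by case: n {IH} => [|n]; rewrite ?expr0 ?exprS /=; ring.
Qed.

Lemma dif_subc z (a : cplx R) : differentiable (fun w : cplx R => w - a) z.
Proof. by apply: dif_sub; [exact: dif_id|exact: dif_cst]. Qed.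

Lemma dif_invsub z (a : cplx R) : z - a != 0 ->
  differentiable (fun w : cplx R => (w - a)^-1) z.
Proof. by move=> h; apply: dif_inv => //; exact: dif_subc. Qed.

Lemma continuous_mul (T : topologicalType) (f g : T -> cplx R) (x : T) :
  {for x, continuous f} -> {for x, continuous g} ->
  {for x, continuous (fun y => f y * g y)}.
Proof. by move=> cf cg; exact: (cvgM cf cg). Qed.

End ComplexDiff.

(** * Exponential, logarithm and powers *)
Section ComplexExp.
Context {R : realType}.
Implicit Types (z w s : cplx R).

Lemma reC_expC z : reC (expC z) = expR (reC z) * cos (imC z).
Proof. by rewrite /expC !reimE; ring. Qed.

Lemma imC_expC z : imC (expC z) = expR (reC z) * sin (imC z).
Proof. by rewrite /expC !reimE; ring. Qed.

Lemma expC0 : expC 0 = 1 :> cplx R.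
Proof.
by apply: cplx_eq; rewrite ?reC_expC ?imC_expC !reimE expR0 ?cos0 ?sin0 ?mulr1 ?mulr0.
Qed.

Lemma expCD z w : expC (z + w) = expC z * expC w.
Proof.
by apply: cplx_eq; rewrite !(reimE, reC_expC, imC_expC) expRD ?cosD ?sinD; ring.
Qed.

Lemma nrm_expC z : nrm (expC z) = expR (reC z).
Proof.
have : nrm (expC z) ^+ 2 = expR (reC z) ^+ 2.
  by rewrite nrm_sqr reC_expC imC_expC !exprMn -mulrDr cos2Dsin2 mulr1.
by move/eqP; rewrite eqrXn2 ?nrm_ge0 ?expR_ge0// => /eqP.
Qed.

Lemma expC_neq0 z : expC z != 0.
Proof. by rewrite -nrm_gt0 nrm_expC expR_gt0. Qed.

Lemma expC_ofR (x : R) : expC (ofR x) = ofR (expR x).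
Proof.
by apply: cplx_eq; rewrite !(reimE, reC_expC, imC_expC) ?cos0 ?sin0 ?mulr1 ?mulr0.
Qed.

Lemma expC_2pi z : expC (z + iC * ofR (pi *+ 2)) = expC z.
Proof.
rewrite expCD; set a := (X in _ * X); suff -> : a = 1 by rewrite mulr1.
by apply: cplx_eq; rewrite !(reimE, reC_expC, imC_expC) !(mul0r, mulr0, subr0, addr0, add0r, mul1r)
  expR0 ?cos2pi ?sin2pi mul1r.
Qed.

(** The real and imaginary parts of [expC h - 1 - h] split into the first-order errors of exp, cos
    and sin at 0 and a product of two small factors. The addition law then carries the derivative at
    0 to every point. *)
Lemma expC_small (e : R) : 0 < e -> exists2 d, 0 < d &
  forall h : cplx R, nrm h < d -> nrm (expC h - 1 - h) <= e * nrm h.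
Proof.
move=> e0.
have e6 : 0 < Num.min 1 (e / 6) by rewrite lt_min ltr01/=; lra.
have [d1 d10 H1] := (is_deriveR_eps _ _ _).2 (is_derive_expR (0:R)) _ e6.
have [d2 d20 H2] := (is_deriveR_eps _ _ _).2 (is_derive_cos (0:R)) _ e6.
have [d3 d30 H3] := (is_deriveR_eps _ _ _).2 (is_derive_sin (0:R)) _ e6.
(* The radius 1/2 yields [expR x <= 2], and e / 12 yields |expR x - 1| <= e / 6. *)
set d := Num.min (Num.min d1 d2) (Num.min d3 (Num.min (1/2) (e / 12))).
exists d; first by rewrite !lt_min d10 d20 d30/=; lra.
move=> h; rewrite !lt_min => /andP[/andP[h1 h2] /andP[h3 /andP[h4 h5]]].
have := reC_le_nrm h; have := imC_le_nrm h.
set x := reC h; set y := imC h; set N := nrm h => yN xN.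
have := H1 x (le_lt_trans xN h1); rewrite add0r expR0 mulr1.
have := H2 y (le_lt_trans yN h2); rewrite add0r cos0 sin0 oppr0 mulr0 subr0.
have := H3 y (le_lt_trans yN h3); rewrite add0r cos0 sin0 subr0 mulr1.
set m := Num.min 1 _ in e6 *.
have m1 : m <= 1 by rewrite ge_min lexx.
have me : m <= e / 6 by rewrite ge_min lexx orbT.
move=> A3 A2 A1.
apply: le_trans (nrm_le_reim _) _.
rewrite !(reimE, reC_expC, imC_expC) -/x -/y subr0.
have N0 : 0 <= N by exact: nrm_ge0.
have mx : m * `|x| <= e / 6 * N by apply: ler_pM => //; exact: ltW.
have my : m * `|y| <= e / 6 * N by apply: ler_pM => //; exact: ltW.
have mx1 : m * `|x| <= N by rewrite (le_trans _ xN)// ler_piMl.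
have Eb : `|expR x - 1| <= 2 * N.
  rewrite -(subrK x (expR x - 1)) (le_trans (ler_normD _ _))//; lra.
have E2 : expR x <= 2 by move: Eb; rewrite ler_norml; lra.
have E0 := expR_ge0 x.
have -> : expR x * cos y - 1 - x = (expR x - 1 - x) + expR x * (cos y - 1) by ring.
have -> : expR x * sin y - y = expR x * (sin y - y) + (expR x - 1) * y by ring.
have := ler_normD (expR x - 1 - x) (expR x * (cos y - 1)).
have := ler_normD (expR x * (sin y - y)) ((expR x - 1) * y).
rewrite !normrM (ger0_norm E0).
have : expR x * `|cos y - 1| <= 2 * (e / 6 * N).
  by apply: ler_pM => //; apply: le_trans my.
have : expR x * `|sin y - y| <= 2 * (e / 6 * N).
  by apply: ler_pM => //; apply: le_trans my.
have : `|expR x - 1| * `|y| <= e / 6 * N.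
  apply: ler_pM => //; apply: (le_trans Eb); lra.
lra.
Qed.

Global Instance is_diff_expC z : is_diff z (@expC R) ( *%R^~ (expC z)).
Proof.
apply: is_diff1_intro => e e0.
have nz : 0 < nrm (expC z) by rewrite nrm_gt0 expC_neq0.
have [d d0 H] := expC_small (divr_gt0 e0 nz); exists d => // h hd.
rewrite expCD -[X in _ - X - _]mulr1 (mulrC h) -!mulrBr nrmM.
by have := H h hd; rewrite mulrAC ler_pdivlMr// mulrC.
Qed.

Lemma differentiable_expC z : differentiable (@expC R) z.
Proof. exact: ex_diff. Qed.

Lemma derive1_expC z : derive1 (@expC R) z = expC z.
Proof. exact: is_diff_derive1. Qed.

Lemma logC_ofR (x : R) : 0 < x -> logC (ofR x) = ofR (ln x).
Proof.
move=> x0; rewrite /logC /argC normCE nrm_ofR imC_ofR lexx reC_ofR gtr0_norm//.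
by rewrite divff ?gt_eqF// acos1 mulr0 addr0.
Qed.

Lemma reC_logC z : reC (logC z) = ln (nrm z).
Proof. by rewrite /logC !reimE normCE; ring. Qed.

Lemma imC_logC z : imC (logC z) = argC z.
Proof. by rewrite /logC !reimE; ring. Qed.

Lemma halfplane_neq0 z : halfplane z -> z != 0.
Proof. by rewrite /halfplane/= => h; apply/eqP => z0; rewrite z0 ltxx in h. Qed.

(** In the upper half-plane the argument is an arc cosine, whose sine is the nonnegative square
    root, hence Im z / |z|. *)
Lemma logCK z : halfplane z -> expC (logC z) = z.
Proof.
move=> hz; have nz : 0 < nrm z by rewrite nrm_gt0 halfplane_neq0.
have zle : -1 <= reC z / nrm z <= 1.
  rewrite -ler_norml normf_div (gtr0_norm nz) ler_pdivrMr// mul1r.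
  exact: reC_le_nrm.
rewrite /halfplane/= in hz.
apply: cplx_eq; rewrite ?reC_expC ?imC_expC reC_logC imC_logC lnK//.
  by rewrite /argC (ltW hz) normCE acosK ?in_itv//= mulrC divfK ?gt_eqF.
rewrite /argC (ltW hz) normCE sin_acos//.
have -> : 1 - (reC z / nrm z) ^+ 2 = (imC z / nrm z) ^+ 2.
  rewrite !expr_div_n.
  apply: (mulIf (x := nrm z ^+ 2)); first by rewrite expf_neq0// gt_eqF.
  rewrite mulrBl !divfK ?expf_neq0 ?gt_eqF// mul1r nrm_sqr; ring.
rewrite sqrtr_sqr ger0_norm; last by rewrite divr_ge0 ?ltW.
by rewrite mulrC divfK// gt_eqF.
Qed.

Lemma eq_continuous (T U : topologicalType) (f g : T -> U) (x : T) :
  f =1 g -> {for x, continuous f} -> {for x, continuous g}.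
Proof. by move=> /funext ->. Qed.

(** Near a point of the half-plane the test in [argC] always takes the same branch, and Re z / |z|
    lies strictly between -1 and 1, where acos is continuous. *)
Lemma continuous_logC z : halfplane z -> {for z, continuous (@logC R)}.
Proof.
move=> hz; have nz : 0 < nrm z by rewrite nrm_gt0 halfplane_neq0.
have cid : {for z, continuous (id : cplx R -> cplx R)} by exact: cvg_id.
have cn := continuous_nrm cid.
apply: continuous_reim.
  apply: (@eq_continuous _ _ (fun y => ln (nrm y))) => [y|]; first by rewrite reC_logC.
  by apply: (continuous_comp cn); exact: continuous_ln.
apply: (@eq_continuous _ _ (@argC R)) => [y|]; first by rewrite imC_logC.
have nearh : \forall y \near z, 0 < imC y.
  have := continuous_imC cid => /cvgrPdist_lt /(_ _ hz).
  by apply: filterS => y /=; rewrite ltr_norml; lra.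
have E : {near z, (fun y => acos (reC y / nrm y)) =1 (@argC R)}.
  by apply: filterS nearh => y hy; rewrite /argC (ltW hy) normCE.
rewrite /prop_for /continuous_at -(nbhs_singleton E).
apply: cvg_trans (near_eq_cvg E) _.
have cq : {for z, continuous (fun y : cplx R => reC y / nrm y)}.
  apply: (@continuousM _ _ (fun y : cplx R => reC y)); first exact: (continuous_reC cid).
  by apply: (@continuousV _ _ (fun y : cplx R => nrm y)); [rewrite gt_eqF|exact: cn].
apply: (continuous_comp cq); apply: continuous_acos.
have := nrm_sqr z; rewrite /halfplane /= in hz.
have i2 : 0 < imC z ^+ 2 by rewrite exprn_gt0.
move=> E2; rewrite -ltr_norml normf_div (gtr0_norm nz) ltr_pdivrMr// mul1r.
by rewrite -(@ltr_pXn2r _ 2)// ?nnegrE ?nrm_ge0// real_normK ?num_real// E2 ltrDl.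
Qed.

(** Continuity of the logarithm suffices: its increment [k] is small, and the derivative of exp at
    log z says that h = k z up to an error small compared with [k]. *)
Lemma is_diff_logC z : halfplane z -> is_diff z (@logC R) ( *%R^~ z^-1).
Proof.
move=> hz; have z0 := halfplane_neq0 hz.
have nz : 0 < nrm z by rewrite nrm_gt0.
apply: is_diff1_intro => e e0.
(* The bound |z| / 2 absorbs the error and gives |k| <= 2 |h| / |z|; the second entry is what is
   left of [e] once this estimate of [k] is used. *)
pose e1 := Num.min (nrm z / 2) (e * nrm z ^+ 2 / 2).
have e10 : 0 < e1 by rewrite lt_min !divr_gt0// mulr_gt0// exprn_gt0.
have [d d0 Hd] := derive1_nrm (differentiable_expC (logC z)) e10.
have [d' d'0 Hd'] := continuous_near0 (continuous_logC hz) d0.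
exists (Num.min d' (imC z)); first by rewrite lt_min d'0.
move=> h; rewrite lt_min => /andP[hd' hi].
have hzh : halfplane (z + h).
  rewrite /halfplane/= imC_D; have := imC_le_nrm h; rewrite ler_norml; lra.
set k := logC (z + h) - logC z.
have := Hd k (Hd' h hd'); rewrite derive1_expC.
rewrite (_ : logC z + k = logC (z + h)); last by rewrite /k addrC subrK.
rewrite !logCK// (_ : z + h - z = h); last by rewrite addrAC subrr add0r.
move=> H.
have kb : nrm k <= 2 / nrm z * nrm h.
  have e1z : e1 <= nrm z / 2 by rewrite ge_min lexx.
  have := le_trans H (ler_wpM2r (nrm_ge0 k) e1z).
  have := nrmB_ge (k * z) h; rewrite (nrmC (k * z)) nrmM.
  move=> A1 A2; rewrite mulrAC ler_pdivlMr//.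
  by move: A1 A2; set a := nrm k; set b := nrm z; nra.
have -> : k - h / z = - (h - k * z) / z by field.
rewrite nrmM nrmN nrmV ler_pdivrMr// (le_trans H)//.
apply: le_trans (_ : e * nrm z ^+ 2 / 2 * (2 / nrm z * nrm h) <= _).
  apply: ler_pM => //; rewrite ?nrm_ge0 ?(ltW e10)//.
  by rewrite ge_min lexx orbT.
by rewrite le_eqVlt; apply/orP; left; apply/eqP; field; rewrite gt_eqF.
Qed.

Lemma powCD z s t : powC z (s + t) = powC z s * powC z t.
Proof. by rewrite /powC mulrDl expCD. Qed.

Lemma powC_neq0 z s : powC z s != 0.
Proof. exact: expC_neq0. Qed.

Lemma is_diff_powC s z : halfplane z ->
  is_diff z (fun w => powC w s) ( *%R^~ (s / z * powC z s)).
Proof.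
move=> hz; have dl := is_diff_logC hz.
have := is_diff_comp (is_diffZ s dl) (is_diff_expC (s * logC z)).
rewrite (_ : _ \o _ = fun w => powC w s)//.
move=> H; apply: is_diff_eq H _; apply/funext => h /=.
by rewrite !fctE /powC /GRing.scale/=; ring.
Qed.

Lemma powC_ofR (x : R) s : 0 < x -> powC (ofR x) s = expC (s * ofR (ln x)).
Proof. by move=> x0; rewrite /powC logC_ofR. Qed.

Lemma nrm_powC (x : R) s : 0 < x -> nrm (powC (ofR x) s) = x `^ reC s.
Proof.
by move=> x0; rewrite powC_ofR// nrm_expC !reimE mulr0 subr0 /powR gt_eqF.
Qed.

Lemma powC_ofR1 (x : R) : 0 < x -> powC (ofR x) 1 = ofR x.
Proof. by move=> x0; rewrite powC_ofR// mul1r expC_ofR lnK. Qed.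

Lemma powC0r z : powC z 0 = 1.
Proof. by rewrite /powC mul0r expC0. Qed.

Lemma cder_powC (x : R -> R) (t l : R) s : 0 < x t -> is_derive t 1 x l ->
  cder (fun u => powC (ofR (x u)) s) t (s * ofR (l / x t) * powC (ofR (x t)) s).
Proof.
move=> xt dx.
have dl := is_derive1_comp (is_derive1_ln xt) dx.
have H1 := cderM (cder_cst s t) (cder_ofR dl).
have H2 := cder_comp (differentiable_expC _) H1.
rewrite derive1_expC in H2.
have nearx : \forall u \near t, 0 < x u.
  have cx : {for t, continuous x}.
    by apply/differentiable_continuous/derivable1_diffP; case: dx.
  by move/cvgrPdist_lt: cx => /(_ _ xt); apply: filterS => y; rewrite ltr_norml; lra.
move=> e e0; have [d d0 H] := H2 e e0.
move/nbhs_normP: nearx => [d1 /= d10 H1'].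
exists (Num.min d d1); first by rewrite lt_min d0.
move=> h; rewrite lt_min => /andP[hd hd1].
have xh : 0 < x (t + h).
  by apply: (H1' (t + h)); rewrite /ball_/= opprD addrA subrr sub0r normrN.
have := H h hd; rewrite /= mulr0 addr0 !powC_ofR//.
by rewrite (mulrC (expC (s * ofR (ln (x t))))) (mulrC (x t)^-1).
Qed.

End ComplexExp.

(** * Complex-valued Lebesgue integrals *)
Section ComplexIntegral.
Context {R : realType}.
Notation mu := (@lebesgue_measure R).
Implicit Types (D : set (measurableTypeR R)) (f g : R -> cplx R) (c : cplx R).

Definition cmeasurable D f :=
  measurable_fun D (fun x => reC (f x)) /\ measurable_fun D (fun x => imC (f x)).

Definition cintegrable D f :=
  mu.-integrable D (EFin \o (fun x => reC (f x))) /\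
  mu.-integrable D (EFin \o (fun x => imC (f x))).

Lemma cintegrable_measurable D f : cintegrable D f -> cmeasurable D f.
Proof.
by move=> [/integrableP[m1 _] /integrableP[m2 _]]; split; apply/measurable_EFinP.
Qed.

Lemma cintegrable_dominated D f (m : R -> R) : measurable D ->
  cmeasurable D f -> mu.-integrable D (EFin \o m) ->
  (forall x, D x -> nrm (f x) <= m x) -> cintegrable D f.
Proof.
move=> mD [m1 m2] im fm; split.
  apply: (@le_integrable _ _ _ mu D mD _ (EFin \o m)) => //; first exact/measurable_EFinP.
  move=> x Dx; rewrite lee_fin (le_trans (reC_le_nrm _))// (le_trans (fm _ Dx))//.
  exact: ler_norm.
apply: (@le_integrable _ _ _ mu D mD _ (EFin \o m)) => //; first exact/measurable_EFinP.
move=> x Dx; rewrite lee_fin (le_trans (imC_le_nrm _))// (le_trans (fm _ Dx))//.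
exact: ler_norm.
Qed.

Lemma cintegrableD D f g : measurable D -> cintegrable D f -> cintegrable D g ->
  cintegrable D (fun x => f x + g x).
Proof.
move=> mD [f1 f2] [g1 g2]; split.
  by have := integrableD mD f1 g1; apply: eq_integrable => // x _ /=; rewrite reimE.
by have := integrableD mD f2 g2; apply: eq_integrable => // x _ /=; rewrite reimE.
Qed.

Lemma cintegrableZ D c f : measurable D -> cintegrable D f ->
  cintegrable D (fun x => c * f x).
Proof.
move=> mD [f1 f2]; split.
  have := integrableB mD (integrableZl mD (reC c) f1) (integrableZl mD (imC c) f2).
  by apply: eq_integrable => // x _ /=; rewrite reimE.
have := integrableD mD (integrableZl mD (reC c) f2) (integrableZl mD (imC c) f1).
by apply: eq_integrable => // x _ /=; rewrite reimE.
Qed.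

Lemma cintegrableN D f : measurable D -> cintegrable D f ->
  cintegrable D (fun x => - f x).
Proof.
move=> mD /(cintegrableZ (-1) mD); congr cintegrable.
by apply/funext => x; rewrite mulN1r.
Qed.

Lemma cintegrableB D f g : measurable D -> cintegrable D f -> cintegrable D g ->
  cintegrable D (fun x => f x - g x).
Proof. by move=> mD f1 g1; apply: cintegrableD => //; exact: cintegrableN. Qed.

Lemma reC_integralC D f :
  reC (integralC D f) = (\int[mu]_(x in D) reC (f x)).
Proof. by rewrite /integralC !reimE mul0r mul1r subrr addr0. Qed.

Lemma imC_integralC D f :
  imC (integralC D f) = (\int[mu]_(x in D) imC (f x)).
Proof. by rewrite /integralC !reimE mul0r mul1r !add0r. Qed.

Lemma eq_integralC D f g : (forall x, D x -> f x = g x) ->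
  integralC D f = integralC D g.
Proof.
move=> fg; rewrite /integralC; congr (ofR _ + iC * ofR _);
  by apply: eq_Rintegral => x /set_mem Dx; rewrite fg.
Qed.

Lemma integralCD D f g : measurable D -> cintegrable D f -> cintegrable D g ->
  integralC D (fun x => f x + g x) = integralC D f + integralC D g.
Proof.
move=> mD [f1 f2] [g1 g2]; apply: cplx_eq.
  rewrite reC_D !reC_integralC -RintegralD//.
  by apply: eq_Rintegral => x _; rewrite reimE.
rewrite imC_D !imC_integralC -RintegralD//.
by apply: eq_Rintegral => x _; rewrite reimE.
Qed.

Lemma integrable_mull D (k : R) (h : R -> R) : measurable D ->
  mu.-integrable D (EFin \o h) -> mu.-integrable D (EFin \o (fun x => k * h x)).
Proof. by move=> mD ih; exact: (integrableZl mD k ih). Qed.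

Lemma integralCZ D c f : measurable D -> cintegrable D f ->
  integralC D (fun x => c * f x) = c * integralC D f.
Proof.
move=> mD [f1 f2]; apply: cplx_eq.
  rewrite reC_M !reC_integralC imC_integralC -!RintegralZl// -RintegralB//;
    try exact: integrable_mull.
  by apply: eq_Rintegral => x _; rewrite reimE.
rewrite imC_M reC_integralC !imC_integralC -!RintegralZl// -RintegralD//;
  try exact: integrable_mull.
by apply: eq_Rintegral => x _; rewrite reimE.
Qed.

Lemma integralCN D f : measurable D -> cintegrable D f ->
  integralC D (fun x => - f x) = - integralC D f.
Proof.
move=> mD i; rewrite -mulN1r -integralCZ//.
by apply: eq_integralC => x _; rewrite mulN1r.
Qed.

Lemma integralCB D f g : measurable D -> cintegrable D f -> cintegrable D g ->
  integralC D (fun x => f x - g x) = integralC D f - integralC D g.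
Proof.
move=> mD f1 g1; rewrite integralCD// ?integralCN//.
exact: cintegrableN.
Qed.

(* The factor 2 comes from bounding the two components separately. *)
Lemma integralC_bound D f (m : R -> R) : measurable D ->
  cintegrable D f -> mu.-integrable D (EFin \o m) ->
  (forall x, D x -> nrm (f x) <= m x) ->
  nrm (integralC D f) <= 2 * (\int[mu]_(x in D) m x).
Proof.
move=> mD [f1 f2] im fm; rewrite (le_trans (nrm_le_reim _))//.
rewrite reC_integralC imC_integralC mulr_natl mulr2n lerD//.
  rewrite (le_trans (le_normr_Rintegral mD f1))// le_Rintegral//.
    by have /integrable_abse := f1.
  by move=> x Dx; rewrite (le_trans (reC_le_nrm _))// fm.
rewrite (le_trans (le_normr_Rintegral mD f2))// le_Rintegral//.
  by have /integrable_abse := f2.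
by move=> x Dx; rewrite (le_trans (imC_le_nrm _))// fm.
Qed.

Lemma integrable_cst_itv (a b M : R) : mu.-integrable `[a, b] (EFin \o cst M).
Proof.
apply: continuous_compact_integrable; first exact: segment_compact.
by apply/continuous_subspaceT => x; exact: cvg_cst.
Qed.

Lemma Rintegral_cst_itv (a b M : R) : a <= b ->
  (\int[mu]_(x in `[a, b]) M) = M * (b - a).
Proof.
move=> ab; rewrite Rintegral_cst//= lebesgue_measure_itv/= lte_fin.
case: ltP => [//|ba]; rewrite (_ : b = a) ?subrr ?mulr0//.
by apply/le_anti; rewrite ab ba.
Qed.

Lemma integralC_bound_itv (a b M : R) f : a <= b -> cintegrable `[a, b] f ->
  (forall x, x \in `[a, b] -> nrm (f x) <= M) ->
  nrm (integralC `[a, b] f) <= 2 * (M * (b - a)).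
Proof.
move=> ab fi fM; rewrite -(Rintegral_cst_itv _ ab).
by apply: integralC_bound => //; exact: integrable_cst_itv.
Qed.

Definition ccont (a b : R) f := forall x, x \in `[a, b] -> {for x, continuous f}.

Lemma ccont_integrable (a b : R) f : ccont a b f -> cintegrable `[a, b] f.
Proof.
move=> cf; split; apply: continuous_compact_integrable; try exact: segment_compact.
  by apply: continuous_in_subspaceT => x /set_mem/cf; exact: continuous_reC.
by apply: continuous_in_subspaceT => x /set_mem/cf; exact: continuous_imC.
Qed.

Lemma integralC_itv_split (a b d : R) f : a <= b -> b <= d ->
  cintegrable `[a, d] f ->
  integralC `[a, d] f = integralC `[a, b] f + integralC `[b, d] f.
Proof.
move=> ab bd [f1 f2].
have S (h : R -> R) : mu.-integrable `[a, d] (EFin \o h) ->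
  (\int[mu]_(x in `[a, d]) h x) =
  (\int[mu]_(x in `[a, b]) h x) + (\int[mu]_(x in `[b, d]) h x).
  move=> ih; apply/eqP; rewrite addrC -subr_eq; apply/eqP.
  rewrite Rintegral_itvB ?bnd_simp// Rintegral_itv_obnd_cbnd//.
  apply: integrableS ih => //; apply: subset_itvr; rewrite bnd_simp//.
apply: cplx_eq; rewrite reimE ?reC_integralC ?imC_integralC; exact: S.
Qed.

Lemma integralC_cst (a b : R) c : a <= b ->
  integralC `[a, b] (fun=> c) = c * ofR (b - a).
Proof.
move=> ab; apply: cplx_eq.
  by rewrite reC_integralC Rintegral_cst_itv// !reimE mulr0 subr0.
by rewrite imC_integralC Rintegral_cst_itv// !reimE mulr0 add0r.
Qed.

Lemma integralC_FTC (a b : R) (f f' : R -> cplx R) : a <= b ->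
  (forall x, x \in `[a, b] -> cder f x (f' x)) -> ccont a b f' ->
  integralC `[a, b] f' = f b - f a.
Proof.
move=> ab df cf'.
move: (ab); rewrite le_eqVlt => /predU1P[->|ltab].
  by apply: cplx_eq; rewrite reimE ?reC_integralC ?imC_integralC set_itv1
    Rintegral_set1 !reimE subrr.
have main (F h : R -> R) :
    (forall x, x \in `[a, b] -> is_derive x 1 F (h x)) ->
    (forall x, x \in `[a, b] -> {for x, continuous h}) ->
    (\int[mu]_(x in `[a, b]) h x) = F b - F a.
  move=> dF ch.
  have ain : a \in `[a, b] by rewrite in_itv/= lexx.
  have bin : b \in `[a, b] by rewrite in_itv/= lexx andbT.
  have cF x : x \in `[a, b] -> {for x, continuous F}.
    by move=> /dF[dx _]; exact/differentiable_continuous/derivable1_diffP.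
  rewrite /Rintegral (@continuous_FTC2 _ h F)//.
  - by apply: continuous_in_subspaceT => x /set_mem/ch.
  - split.
    + by move=> x xab; have [] := dF x (subset_itv_oo_cc xab).
    + exact/cvg_at_right_filter/cF.
    + exact/cvg_at_left_filter/cF.
  - move=> x xab; rewrite derive1E.
    by have [_ ->] := dF x (subset_itv_oo_cc xab).
apply: cplx_eq; rewrite ?reC_integralC ?imC_integralC !reimE.
  apply: (main (fun x => reC (f x))) => x xab.
    by have /cderP[] := df x xab.
  exact/continuous_reC/cf'.
apply: (main (fun x => imC (f x))) => x xab.
  by have /cderP[] := df x xab.
exact/continuous_imC/cf'.
Qed.

Lemma cvg_reim (u : nat -> cplx R) c :
  u @ \oo --> c <->
  (fun n => reC (u n)) @ \oo --> reC c /\ (fun n => imC (u n)) @ \oo --> imC c.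
Proof.
split.
  move=> /cvg_nrm H; split; apply/cvgrPdist_lt => e /H; apply: filterS => n;
    apply: le_lt_trans; rewrite distrC -?reC_B -?imC_B.
    exact: reC_le_nrm.
  exact: imC_le_nrm.
move=> [/cvgrPdist_lt H1 /cvgrPdist_lt H2]; apply/cvg_nrm => e e0.
have e2 : 0 < e / 2 by lra.
near=> n; rewrite (le_lt_trans (nrm_le_reim _))// [ltRHS]splitr ltrD//.
  by rewrite reC_B distrC; near: n; exact: H1.
by rewrite imC_B distrC; near: n; exact: H2.
Unshelve. all: by end_near. Qed.

Lemma integralC_dominated_cvg D (f_ : nat -> R -> cplx R) f (m : R -> R) :
  measurable D -> (forall n, cmeasurable D (f_ n)) ->
  (forall x, D x -> f_ ^~ x @ \oo --> f x) ->
  mu.-integrable D (EFin \o m) ->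
  (forall n x, D x -> nrm (f_ n x) <= m x) ->
  cintegrable D f /\ (fun n => integralC D (f_ n)) @ \oo --> integralC D f.
Proof.
move=> mD mf cf im fm.
have main (g_ : nat -> R -> R) (g : R -> R) :
    (forall n, measurable_fun D (g_ n)) ->
    (forall x, D x -> g_ ^~ x @ \oo --> g x) ->
    (forall n x, D x -> `|g_ n x| <= m x) ->
    mu.-integrable D (EFin \o g) /\
    (fun n => (\int[mu]_(x in D) g_ n x)) @ \oo --> (\int[mu]_(x in D) g x).
  move=> mg cg gm.
  have mgl : measurable_fun D (EFin \o g).
    apply/measurable_EFinP; apply: (measurable_fun_cvg mg) => x Dx.
    exact: cg.
  have [|||||ig _ H] := @dominated_convergence _ _ _ mu D mD
     (fun n => EFin \o g_ n) (EFin \o g) (EFin \o m).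
  - by move=> n; exact/measurable_EFinP.
  - by [].
  - apply: aeW => x Dx; apply: cvg_EFin; first exact: nearW.
    exact: cg.
  - exact: im.
  - by apply: aeW => x n Dx; rewrite /= lee_fin gm.
  split => //; apply: fine_cvg; rewrite /Rintegral fineK//.
  exact: integrable_fin_num.
have [|||i1 c1] := main (fun n x => reC (f_ n x)) (fun x => reC (f x)).
- by move=> n; have [] := mf n.
- by move=> x Dx; have /cvg_reim[] := cf x Dx.
- by move=> n x Dx; rewrite (le_trans (reC_le_nrm _))// fm.
have [|||i2 c2] := main (fun n x => imC (f_ n x)) (fun x => imC (f x)).
- by move=> n; have [] := mf n.
- by move=> x Dx; have /cvg_reim[] := cf x Dx.
- by move=> n x Dx; rewrite (le_trans (imC_le_nrm _))// fm.
split => //; apply/cvg_reim; split.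
  by under eq_fun do rewrite reC_integralC; rewrite reC_integralC.
by under eq_fun do rewrite imC_integralC; rewrite imC_integralC.
Qed.

Lemma cmeasurable_cvg D (f_ : nat -> R -> cplx R) f :
  measurable D -> (forall n, cmeasurable D (f_ n)) ->
  (forall x, D x -> f_ ^~ x @ \oo --> f x) -> cmeasurable D f.
Proof.
move=> mD mf cf; split.
  apply: (@measurable_fun_cvg _ _ _ D (fun n x => reC (f_ n x))) => [n|x Dx].
    by have [] := mf n.
  by have /cvg_reim[] := cf x Dx.
apply: (@measurable_fun_cvg _ _ _ D (fun n x => imC (f_ n x))) => [n|x Dx].
  by have [] := mf n.
by have /cvg_reim[] := cf x Dx.
Qed.

Lemma cmeasurableD D f g : cmeasurable D f -> cmeasurable D g ->
  cmeasurable D (fun x => f x + g x).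
Proof.
move=> [f1 f2] [g1 g2]; split; under eq_fun do rewrite !reimE.
  exact: measurable_funD.
exact: measurable_funD.
Qed.

Lemma cmeasurableM D f g : cmeasurable D f -> cmeasurable D g ->
  cmeasurable D (fun x => f x * g x).
Proof.
move=> [f1 f2] [g1 g2]; split; under eq_fun do rewrite !reimE.
  by apply: measurable_funB; exact: measurable_funM.
by apply: measurable_funD; exact: measurable_funM.
Qed.

Lemma cmeasurable_cst D c : cmeasurable D (fun=> c).
Proof. by split; exact: measurable_cst. Qed.

Lemma cmeasurableB D f g : cmeasurable D f -> cmeasurable D g ->
  cmeasurable D (fun x => f x - g x).
Proof.
move=> mf mg; have := cmeasurableD mf (cmeasurableM (cmeasurable_cst D (-1)) mg).
by congr cmeasurable; apply/funext => x; rewrite mulN1r.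
Qed.

Lemma continuous_cmeasurable D f : open D ->
  (forall x, D x -> {for x, continuous f}) -> cmeasurable D f.
Proof.
move=> oD cf; split; apply: open_continuous_measurable_fun => // x /set_mem Dx.
  exact/continuous_reC/cf.
exact/continuous_imC/cf.
Qed.

End ComplexIntegral.

(** * Goursat's lemma *)
Section Goursat.
Context {R : realType}.
Implicit Types (g : cplx R -> cplx R) (a b c d x y : R).

Definition cpt x y : cplx R := ofR x + iC * ofR y.

Lemma reC_cpt x y : reC (cpt x y) = x.
Proof. by rewrite /cpt !reimE; ring. Qed.

Lemma imC_cpt x y : imC (cpt x y) = y.
Proof. by rewrite /cpt !reimE; ring. Qed.

Lemma cpt_reim (z : cplx R) : cpt (reC z) (imC z) = z.
Proof. by rewrite /cpt -cplxE. Qed.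

Lemma cder_cptl x y : cder (fun t => cpt t y) x 1.
Proof.
move=> e e0; exists 1 => // h _.
rewrite (_ : _ - _ = 0) ?nrm0 ?mulr_ge0 ?(ltW e0)//.
by rewrite /cpt ofRD; ring.
Qed.

Lemma cder_cptr x y : cder (fun t => cpt x t) y iC.
Proof.
move=> e e0; exists 1 => // h _.
rewrite (_ : _ - _ = 0) ?nrm0 ?mulr_ge0 ?(ltW e0)//.
by rewrite /cpt ofRD; ring.
Qed.

(** The integral of g(z) dz along the counterclockwise boundary of the rectangle, opposite sides
    being paired. *)
Definition rect_integral g a b c d : cplx R :=
  integralC `[a, b] (fun x => g (cpt x c) - g (cpt x d)) +
  iC * integralC `[c, d] (fun y => g (cpt b y) - g (cpt a y)).

Definition diff_rect g a b c d :=
  forall x y, a <= x <= b -> c <= y <= d -> differentiable g (cpt x y).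

Lemma continuous_cptl g x y : differentiable g (cpt x y) ->
  {for x, continuous (fun t => g (cpt t y))}.
Proof.
move=> dg; have := cder_comp (phi := g) (g := fun t => cpt t y) (t := x) dg (cder_cptl _ _).
exact: cder_continuous.
Qed.

Lemma continuous_cptr g x y : differentiable g (cpt x y) ->
  {for y, continuous (fun t => g (cpt x t))}.
Proof.
move=> dg; have := cder_comp (phi := g) (g := cpt x) (t := y) dg (cder_cptr _ _).
exact: cder_continuous.
Qed.

Lemma ccontB a b (f h : R -> cplx R) : ccont a b f -> ccont a b h ->
  ccont a b (fun x => f x - h x).
Proof. by move=> cf ch x xab; apply: cvgB; [exact: cf|exact: ch]. Qed.

Lemma rect_split_x g a m b c d : a <= m -> m <= b -> c <= d ->
  diff_rect g a b c d ->
  rect_integral g a b c d = rect_integral g a m c d + rect_integral g m b c d.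
Proof.
move=> am mb cd dg; have ab := le_trans am mb.
rewrite /rect_integral (integralC_itv_split am mb); last first.
  apply/ccont_integrable/ccontB => x; rewrite in_itv/= => xab;
    apply: continuous_cptl; apply: dg => //; rewrite lexx// cd//.
have cont x : a <= x <= b -> cintegrable `[c, d] (fun y => g (cpt x y)).
  move=> xab; apply/ccont_integrable => y; rewrite in_itv/= => ycd.
  by apply: continuous_cptr; exact: dg.
have EB u w : a <= u <= b -> a <= w <= b ->
    integralC `[c, d] (fun y => g (cpt u y) - g (cpt w y)) =
    integralC `[c, d] (fun y => g (cpt u y)) - integralC `[c, d] (fun y => g (cpt w y)).
  by move=> hu hw; rewrite integralCB//; exact: cont.
by rewrite !EB ?lexx ?am ?mb ?ab//; ring.
Qed.

Lemma rect_split_y g a b c m d : c <= m -> m <= d -> a <= b ->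
  diff_rect g a b c d ->
  rect_integral g a b c d = rect_integral g a b c m + rect_integral g a b m d.
Proof.
move=> cm md ab dg; have cd := le_trans cm md.
rewrite /rect_integral (integralC_itv_split cm md); last first.
  apply/ccont_integrable/ccontB => x; rewrite in_itv/= => xab;
    apply: continuous_cptr; apply: dg => //; rewrite lexx// ab//.
have cont x : c <= x <= d -> cintegrable `[a, b] (fun y => g (cpt y x)).
  move=> xab; apply/ccont_integrable => y; rewrite in_itv/= => ycd.
  by apply: continuous_cptl; exact: dg.
have EB u w : c <= u <= d -> c <= w <= d ->
    integralC `[a, b] (fun y => g (cpt y u) - g (cpt y w)) =
    integralC `[a, b] (fun y => g (cpt y u)) - integralC `[a, b] (fun y => g (cpt y w)).
  by move=> hu hw; rewrite integralCB//; exact: cont.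
by rewrite !EB ?lexx ?cm ?md ?cd//; ring.
Qed.

(** The affine part of [g] has zero integral along the boundary, so only the remainder counts. The
    factor 4 is 2 for the paired sides times 2 for the componentwise bound of an integral. *)
Lemma rect_integral_small g a b c d (z l : cplx R) (e : R) : a <= b -> c <= d ->
  diff_rect g a b c d ->
  (forall x y, a <= x <= b -> c <= y <= d ->
     nrm (g (cpt x y) - g z - (cpt x y - z) * l) <= e) ->
  nrm (rect_integral g a b c d) <= 4 * e * ((b - a) + (d - c)).
Proof.
move=> ab cd dg H.
pose r (w : cplx R) := g w - g z - (w - z) * l.
have dr w : differentiable g w -> differentiable r w.
  move=> dgw; apply: dif_sub; first by apply: dif_sub => //; exact: dif_cst.
  by apply: dif_mul; [exact: dif_subc|exact: dif_cst].
have E1 : integralC `[a, b] (fun x => g (cpt x c) - g (cpt x d)) =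
    integralC `[a, b] (fun x => r (cpt x c) - r (cpt x d)) +
    iC * ofR (c - d) * l * ofR (b - a).
  rewrite -integralC_cst// -integralCD//; last 2 first.
  - apply: ccont_integrable; apply: ccontB => x; rewrite in_itv/= => xab;
      apply: (@continuous_cptl r); apply: dr;
      by apply: dg; rewrite ?lexx ?cd.
  - by apply: ccont_integrable => x _; exact: cvg_cst.
  by apply: eq_integralC => x _; rewrite /r /cpt ofRB; ring.
have E2 : integralC `[c, d] (fun y => g (cpt b y) - g (cpt a y)) =
    integralC `[c, d] (fun y => r (cpt b y) - r (cpt a y)) +
    ofR (b - a) * l * ofR (d - c).
  rewrite -integralC_cst// -integralCD//; last 2 first.
  - apply: ccont_integrable; apply: ccontB => x; rewrite in_itv/= => xab;
      apply: (@continuous_cptr r); apply: dr;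
      by apply: dg; rewrite ?lexx ?ab.
  - by apply: ccont_integrable => x _; exact: cvg_cst.
  by apply: eq_integralC => x _; rewrite /r /cpt ofRB; ring.
rewrite /rect_integral E1 E2.
set I1 := integralC _ _; set I2 := integralC _ _.
have -> : I1 + iC * ofR (c - d) * l * ofR (b - a) +
  iC * (I2 + ofR (b - a) * l * ofR (d - c)) = I1 + iC * I2.
  by rewrite !ofRB; ring.
rewrite (le_trans (nrmD _ _))// nrmM nrm_iC mul1r.
have B1 : nrm I1 <= 2 * (2 * e * (b - a)).
  apply: integralC_bound_itv => //.
    apply: ccont_integrable; apply: ccontB => x; rewrite in_itv/= => xab;
      apply: (@continuous_cptl r); apply: dr;
      by apply: dg; rewrite ?lexx ?cd.
  move=> x; rewrite in_itv/= => xab; rewrite (le_trans (nrmB _ _))//.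
  by rewrite mulr_natl mulr2n lerD// H// lexx ?cd.
have B2 : nrm I2 <= 2 * (2 * e * (d - c)).
  apply: integralC_bound_itv => //.
    apply: ccont_integrable; apply: ccontB => x; rewrite in_itv/= => xab;
      apply: (@continuous_cptr r); apply: dr;
      by apply: dg; rewrite ?lexx ?ab.
  move=> x; rewrite in_itv/= => xab; rewrite (le_trans (nrmB _ _))//.
  by rewrite mulr_natl mulr2n lerD// H// lexx ?ab.
move: B1 B2; move: (nrm I1) (nrm I2) => x1 x2; clear; lra.
Qed.

Lemma nested_intervals (u v : nat -> R) :
  (forall n, u n <= u n.+1) -> (forall n, v n.+1 <= v n) ->
  (forall n, u n <= v n) -> exists x, forall n, u n <= x <= v n.
Proof.
move=> iu dv uv.
have mu_ n m : (n <= m)%N -> u n <= u m.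
  by move=> nm; rewrite -(subnK nm); elim: (m - n)%N => //= k /le_trans; exact.
have mv n m : (n <= m)%N -> v m <= v n.
  move=> nm; rewrite -(subnK nm); elim: (m - n)%N => //= k; apply: le_trans.
  exact: dv.
have uvnm n m : u n <= v m.
  rewrite (le_trans (mu_ _ _ (leq_maxl n m)))// (le_trans (uv _))//.
  exact/mv/leq_maxr.
exists (sup (range u)) => n; apply/andP; split.
  apply: ub_le_sup; last by exists n.
  by exists (v 0%N) => _ [m _ <-].
apply: ge_sup; first by exists (u 0%N); exists 0%N.
by move=> _ [m _ <-].
Qed.

Let rect := (R * R * (R * R))%type.
Let B g (q : rect) := rect_integral g q.1.1 q.1.2 q.2.1 q.2.2.
Let ok g (q : rect) := [/\ q.1.1 <= q.1.2, q.2.1 <= q.2.2 &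
  diff_rect g q.1.1 q.1.2 q.2.1 q.2.2].
Let halves g (q q' : rect) := [/\ ok g q', q.1.1 <= q'.1.1, q'.1.2 <= q.1.2,
  q.2.1 <= q'.2.1 & q'.2.2 <= q.2.2].

(** By additivity, one of the two halves carries at least half of the integral. *)
Let bisect_x g q : ok g q -> exists q', [/\ halves g q q',
  q'.1.2 - q'.1.1 = (q.1.2 - q.1.1) / 2, q'.2.2 - q'.2.1 = q.2.2 - q.2.1 &
  nrm (B g q) <= 2 * nrm (B g q')].
Proof.
case: q => [[a b] [c d]] [/= ab cd dg].
set m := (a + b) / 2; have am : a <= m by rewrite /m; lra.
have mb : m <= b by rewrite /m; lra.
have E := rect_split_x am mb cd dg.
have ok1 : ok g ((a, m), (c, d)).
  split => //= x y /andP[ax xm] ycd; apply: dg => //.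
  by rewrite ax (le_trans xm).
have ok2 : ok g ((m, b), (c, d)).
  split => //= x y /andP[ax xm] ycd; apply: dg => //.
  by rewrite xm (le_trans am).
have [h|h] := leP (nrm (rect_integral g a b c d)) (2 * nrm (rect_integral g a m c d)).
  by exists ((a, m), (c, d)); split => //=; rewrite /m; lra.
exists ((m, b), (c, d)); split => //=; first by rewrite /m; lra.
rewrite /B/=; have := nrmD (rect_integral g a m c d) (rect_integral g m b c d).
rewrite -E; move: h; clear.
by move: (nrm _) (nrm _) (nrm _) => x1 x2 x3; lra.
Qed.

Let bisect_y g q : ok g q -> exists q', [/\ halves g q q',
  q'.1.2 - q'.1.1 = q.1.2 - q.1.1, q'.2.2 - q'.2.1 = (q.2.2 - q.2.1) / 2 &
  nrm (B g q) <= 2 * nrm (B g q')].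
Proof.
case: q => [[a b] [c d]] [/= ab cd dg].
set m := (c + d) / 2; have am : c <= m by rewrite /m; lra.
have mb : m <= d by rewrite /m; lra.
have E := rect_split_y am mb ab dg.
have ok1 : ok g ((a, b), (c, m)).
  split => //= x y xab /andP[cy ym]; apply: dg => //.
  by rewrite cy (le_trans ym).
have ok2 : ok g ((a, b), (m, d)).
  split => //= x y xab /andP[cy ym]; apply: dg => //.
  by rewrite ym (le_trans am).
have [h|h] := leP (nrm (rect_integral g a b c d)) (2 * nrm (rect_integral g a b c m)).
  by exists ((a, b), (c, m)); split => //=; rewrite /m; lra.
exists ((a, b), (m, d)); split => //=; first by rewrite /m; lra.
rewrite /B/=; have := nrmD (rect_integral g a b c m) (rect_integral g a b m d).
rewrite -E; move: h; clear.
by move: (nrm _) (nrm _) (nrm _) => x1 x2 x3; lra.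
Qed.

Let bisect g q : ok g q -> exists q', [/\ halves g q q',
  q'.1.2 - q'.1.1 = (q.1.2 - q.1.1) / 2, q'.2.2 - q'.2.1 = (q.2.2 - q.2.1) / 2 &
  nrm (B g q) <= 4 * nrm (B g q')].
Proof.
move=> /bisect_x[q1 [[ok1 h1 h2 h3 h4] w1 v1 b1]].
have [q2 [[ok2 k1 k2 k3 k4] w2 v2 b2]] := bisect_y ok1.
exists q2; split; rewrite ?w2 ?v2 ?w1 ?v1//; last first.
  rewrite (le_trans b1)// (_ : 4 = 2 * 2); last by rewrite -natrM.
  by rewrite -mulrA ler_wpM2l.
by split => //; [exact: le_trans k1|exact: le_trans h2|exact: le_trans k3|exact: le_trans h4].
Qed.

(** After n bisections the integral is at least 4^-n times the initial one, while differentiability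
    at the common point of the rectangles makes it at most a small multiple of their squared size,
    which is also of order 4^-n. *)
Lemma Goursat_rect g a b c d : a <= b -> c <= d ->
  diff_rect g a b c d -> rect_integral g a b c d = 0.
Proof.
move=> ab cd dg.
have /choice[step stepP] (q : rect) : exists q', ok g q -> [/\ halves g q q',
  q'.1.2 - q'.1.1 = (q.1.2 - q.1.1) / 2, q'.2.2 - q'.2.1 = (q.2.2 - q.2.1) / 2 &
  nrm (B g q) <= 4 * nrm (B g q')].
  (* A rectangle that is not [ok] gets an arbitrary image, so that [step] is a total function. *)
  have [/bisect[q' ?]|nq] := pselect (ok g q); last by exists q.
  by exists q'.
pose Q n := iter n step ((a, b), (c, d)).
have okQ n : ok g (Q n).
  by elim: n => [|n IH]; [split|have [[]] := stepP _ IH].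
have hQ n := stepP _ (okQ n).
set W := (b - a) + (d - c).
have wQ n : ((Q n).1.2 - (Q n).1.1) + ((Q n).2.2 - (Q n).2.1) = W / 2 ^+ n.
  elim: n => [|n IH]; first by rewrite expr0 divr1.
  have [_ /= -> -> _] := hQ n; rewrite exprSr invfM mulrA -IH; ring.
have bQ n : nrm (rect_integral g a b c d) <= 4 ^+ n * nrm (B g (Q n)).
  elim: n => [|n IH]; first by rewrite expr0 mul1r.
  have [_ _ _ h] := hQ n; rewrite (le_trans IH)// exprSr -mulrA.
  by rewrite ler_wpM2l// exprn_ge0.
have [x xP] : exists x, forall n, (Q n).1.1 <= x <= (Q n).1.2.
  by apply: nested_intervals => n; have [[]] := hQ n => //; have [] := okQ n.
have [y yP] : exists y, forall n, (Q n).2.1 <= y <= (Q n).2.2.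
  by apply: nested_intervals => n; have [[]] := hQ n => //; have [] := okQ n.
set z := cpt x y.
have dz : differentiable g z by apply: dg; [exact: (xP 0%N)|exact: (yP 0%N)].
apply/eqP; rewrite -nrm_eq0 eq_le nrm_ge0 andbT.
have W0 : 0 <= W by rewrite /W; lra.
apply/ler_addgt0Pr => e e0; rewrite add0r.
(* The estimate ends with e W^2 / (W^2 + 1); the added 1 keeps the denominator positive for a
   rectangle reduced to a point. *)
have e1 : 0 < e / (4 * (W ^+ 2 + 1)).
  by rewrite divr_gt0// mulr_gt0// ltr_wpDl// sqr_ge0.
set e' := e / _ in e1.
have [del del0 H] := derive1_nrm dz e1.
have [n nP] : exists n, W / 2 ^+ n < del.
  have /cvgrPdist_lt/(_ _ del0)[n _ /(_ n (leqnn n))] :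
      (fun n => W / 2 ^+ n : R) @ \oo --> W * 0.
    apply: cvgMr; under eq_fun do rewrite -exprVn.
    by apply: cvg_expr; rewrite ger0_norm; lra.
  rewrite mulr0 sub0r normrN ger0_norm ?divr_ge0 ?exprn_ge0//.
  by exists n.
rewrite (le_trans (bQ n))//.
have {bQ} := rect_integral_small (z := z) (l := derive1 g z) (e := e' * (W / 2 ^+ n)).
move=> /(_ g (Q n).1.1 (Q n).1.2 (Q n).2.1 (Q n).2.2).
have [h1 h2 h3] := okQ n; move=> /(_ h1 h2 h3).
rewrite wQ -/(B g (Q n)) => HB.
suff : nrm (B g (Q n)) <= 4 * (e' * (W / 2 ^+ n)) * (W / 2 ^+ n).
  move=> /(ler_wpM2l (exprn_ge0 n (ler0n R 4))) /le_trans; apply.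
  have -> : 4 ^+ n * (4 * (e' * (W / 2 ^+ n)) * (W / 2 ^+ n)) = e / (W ^+ 2 + 1) * W ^+ 2.
    rewrite (_ : 4 = 2 * 2 :> R); last by rewrite -natrM.
    rewrite exprMn /e' (_ : 4 = 2 * 2 :> R); last by rewrite -natrM.
    by field; rewrite expf_neq0// ?gt_eqF// ltr_wpDl// sqr_ge0.
  rewrite mulrAC ler_pdivrMr; last by rewrite ltr_wpDl// sqr_ge0.
  by rewrite ler_wpM2l ?(ltW e0)// lerDl.
apply: HB => x' y' hx hy.
have hn : nrm (cpt x' y' - z) <= W / 2 ^+ n.
  rewrite (le_trans (nrm_le_reim _))// reC_B imC_B !reC_cpt !imC_cpt -wQ.
  have := xP n; have := yP n; move: hx hy.
  set q := Q n => /andP[? ?] /andP[? ?] /andP[? ?] /andP[? ?].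
  by apply: lerD; rewrite ler_norml; lra.
have := H (cpt x' y' - z) (le_lt_trans hn nP).
rewrite (addrC z) subrK => /le_trans; apply.
by rewrite ler_wpM2l// ltW.
Qed.

End Goursat.

(** * Integrals over circles *)
Section Cauchy.
Context {R : realType}.
Implicit Types (phi g : cplx R -> cplx R) (r s t : R) (z a : cplx R).

Definition twopi : R := pi *+ 2.

Lemma twopi_gt0 : 0 < twopi.
Proof. by rewrite pmulrn_lgt0// pi_gt0. Qed.

Definition circ r t : cplx R := ofR r * expC (iC * ofR t).

Lemma nrm_circ r t : 0 <= r -> nrm (circ r t) = r.
Proof.
move=> r0; rewrite /circ nrmM nrm_ofR ger0_norm// nrm_expC !reimE.
by rewrite mul0r mulr0 subr0 expR0 mulr1.
Qed.

Lemma cder_circ r t : cder (circ r) t (iC * circ r t).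
Proof.
have H1 := cderM (cder_cst iC t) (cder_ofR (is_derive_id t 1)).
have H2 := cder_comp (differentiable_expC _) H1.
have H3 := cderM (cder_cst (ofR r) t) H2.
by apply: cder_eq H3 _; rewrite derive1_expC /circ ofR1/=; ring.
Qed.

Lemma continuous_circ2 r t :
  {for (t, r), continuous (fun p : R * R => circ p.2 p.1)}.
Proof.
have c1 : {for (t, r), continuous (fun p : R * R => ofR p.2 : cplx R)}.
  by apply: (continuous_comp (cvg_snd)); exact: continuous_ofR.
have c2 : {for (t, r), continuous (fun p : R * R => expC (iC * ofR p.1) : cplx R)}.
  apply: (@continuous_comp _ _ _ (fun p : R * R => p.1) (fun t => expC (iC * ofR t))).
    exact: cvg_fst.
  have H1 := cderM (cder_cst iC t) (cder_ofR (is_derive_id t 1)).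
  exact: cder_continuous (cder_comp (differentiable_expC _) H1).
exact: cvgM c1 c2.
Qed.

(** As dz = i z dt on the circle, this is the contour integral of g(z) dz / (i z). Cauchy kernels
    and Taylor coefficients are adapted to this normalization by one factor z. *)
Definition circle_int g r := integralC `[0, twopi] (fun t => g (circ r t)).

Lemma diff_circ_cont g r : (forall t, differentiable g (circ r t)) ->
  ccont 0 twopi (fun t => g (circ r t)).
Proof.
move=> dg t _; apply: cder_continuous; apply: cder_comp => //.
exact: cder_circ.
Qed.

Lemma circ_ln r t : 0 < r -> expC (cpt (ln r) t) = circ r t.
Proof. by move=> r0; rewrite /cpt expCD expC_ofR lnK. Qed.

(* Under z = exp u the annulus between the two circles is a rectangle whose
   horizontal sides have opposite integrals, exp being 2 pi i-periodic. *)
Lemma circle_int_const g r s : 0 < r -> r <= s ->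
  (forall z, r <= nrm z <= s -> differentiable g z) ->
  circle_int g r = circle_int g s.
Proof.
move=> r0 rs dg; have s0 := lt_le_trans r0 rs.
pose G w := g (expC w).
have lrs : ln r <= ln s by rewrite ler_ln.
have dG : diff_rect G (ln r) (ln s) 0 twopi.
  move=> x y /andP[rx xs] _; apply: differentiable_comp.
    exact: differentiable_expC.
  apply: dg; rewrite nrm_expC reC_cpt; apply/andP; split.
    by rewrite -(lnK (_ : r \in Num.pos))// ler_expR.
  by rewrite -(lnK (_ : s \in Num.pos))// ler_expR.
have := Goursat_rect lrs (ltW twopi_gt0) dG.
rewrite /rect_integral (_ : integralC `[ln r, ln s] _ = 0); last first.
  rewrite (@eq_integralC _ _ _ (fun=> 0)); first by rewrite integralC_cst// mul0r.
  by move=> x _; rewrite /G /cpt !mulr0 addr0 expC_2pi subrr.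
rewrite add0r => /eqP; rewrite mulf_eq0 => /orP[/eqP i0|/eqP].
  by have := @nrm_iC R; rewrite i0 nrm0 => /eqP; rewrite eq_sym oner_eq0.
rewrite integralCB//; last 2 first.
- apply: ccont_integrable => y; rewrite in_itv/= => hy; apply: continuous_cptr.
  by apply: dG => //; rewrite lrs lexx.
- apply: ccont_integrable => y; rewrite in_itv/= => hy; apply: continuous_cptr.
  by apply: dG => //; rewrite lrs lexx.
move/eqP; rewrite subr_eq0 => /eqP E; rewrite /circle_int.
transitivity (integralC `[0, twopi] (fun y => G (cpt (ln r) y))).
  by apply: eq_integralC => y _; rewrite /G circ_ln.
by rewrite -E; apply: eq_integralC => y _; rewrite /G circ_ln.
Qed.

(** Compactness of the segment turns joint continuity at each [(t, x0)] into a neighbourhood of [x0]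
    that serves all [t]. *)
Lemma unif_near (X : topologicalType) (x0 : X) (H : X -> R -> cplx R) (a b : R) :
  (forall t, t \in `[a, b] -> {for (t, x0), continuous (fun p : R * X => H p.2 p.1)}) ->
  forall e : R, 0 < e -> \forall x \near x0, forall t, t \in `[a, b] ->
    nrm (H x t - H x0 t) < e.
Proof.
move=> cH e e0.
have /compact_near_coveringP := @segment_compact R a b.
move=> /(_ X (nbhs x0) (fun x t => nrm (H x t - H x0 t) < e) _) Hc.
suff /Hc : forall t, t \in `[a, b] ->
    \forall t' \near t & x \near x0, nrm (H x t' - H x0 t') < e.
  by apply: filterS => x Hx t tab; exact: Hx.
move=> t tab; have e2 : 0 < e / 2 by lra.
have /cvg_nrm /(_ _ e2) := cH t tab.
move=> [[U V] /= [Ut Vx] UV].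
exists (U, V) => //= -[t' x'] [/= Ut' Vx'].
have /= h1 := UV (t', x') (conj Ut' Vx').
have /= h2 := UV (t', x0) (conj Ut' (nbhs_singleton Vx)).
rewrite (le_lt_trans (nrm_dist (H x0 t) _ _))//.
by rewrite [ltRHS]splitr ltrD// nrmC.
Qed.

(** Values on a nearby circle are uniformly close to those on the circle of radius [r]; continuity
    on the nearby circles makes the integrals subtractable. *)
Lemma circle_int_continuous g r : 
  (forall t, {for circ r t, continuous g}) ->
  (\forall s \near r, forall t, t \in `[0, twopi] -> {for circ s t, continuous g}) ->
  {for r, continuous (circle_int g)}.
Proof.
move=> cg cgs; apply: cvg_nrm_le => e e0.
have e4 : 0 < e / (2 * twopi) by rewrite divr_gt0// mulr_gt0// twopi_gt0.
have H : \forall s \near r, forall t, t \in `[0, twopi] ->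
    nrm (g (circ s t) - g (circ r t)) < e / (2 * twopi).
  apply: (@unif_near _ r (fun s t => g (circ s t))) => // t ht.
  apply: (@continuous_comp _ _ _ (fun p : R * R => circ p.2 p.1) g).
    exact: continuous_circ2.
  exact: cg.
near=> s.
have cs : forall t, t \in `[0, twopi] -> {for circ s t, continuous g} by near: s.
have ccs : ccont 0 twopi (fun t => g (circ s t)).
  move=> t ht; apply: (@continuous_comp _ _ _ (circ s) g t); last exact: cs.
  exact: cder_continuous (cder_circ s t).
have ccr : ccont 0 twopi (fun t => g (circ r t)).
  move=> t ht; apply: (@continuous_comp _ _ _ (circ r) g t); last exact: cg.
  exact: cder_continuous (cder_circ r t).
rewrite /circle_int -integralCB//; try exact: ccont_integrable.
rewrite [leRHS](_ : _ = 2 * (e / (2 * twopi) * (twopi - 0))); last first.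
  by have := twopi_gt0; move: twopi => P P0; field; rewrite gt_eqF.
apply: integralC_bound_itv; first exact/ltW/twopi_gt0.
  by apply: ccont_integrable; exact: ccontB.
move=> t ht; apply/ltW; move: t ht; near: s; exact: H.
Unshelve. all: by end_near. Qed.

Lemma circle_int_cst (k : cplx R) r : circle_int (fun=> k) r = k * ofR twopi.
Proof. by rewrite /circle_int integralC_cst ?subr0// ltW// twopi_gt0. Qed.

Lemma circle_int_bound g r (M : R) : (forall t, differentiable g (circ r t)) ->
  (forall t, t \in `[0, twopi] -> nrm (g (circ r t)) <= M) ->
  nrm (circle_int g r) <= 2 * M * twopi.
Proof.
move=> dg gM; rewrite -mulrA -[X in M * X]subr0.
apply: (integralC_bound_itv _ _ gM); first exact/ltW/twopi_gt0.
exact/ccont_integrable/diff_circ_cont.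
Qed.

(** Write z / (z - a) = 1 + a / (z - a). The integral is the same for all radii beyond |a|, and the
    second term is small on large circles. *)
Lemma circle_int_kernel a r : nrm a < r ->
  circle_int (fun z => z / (z - a)) r = ofR twopi.
Proof.
move=> ar; have r0 : 0 < r := le_lt_trans (nrm_ge0 a) ar.
have za z : r <= nrm z -> z - a != 0.
  move=> rz; rewrite subr_eq0; apply/eqP => za; move: rz; rewrite za; lra.
have dk z : r <= nrm z -> differentiable (fun z => z / (z - a)) z.
  move=> rz; apply: dif_mul; first exact: dif_id.
  by apply: dif_invsub; exact: za.
apply/eqP; rewrite -subr_eq0 -nrm_eq0 eq_le nrm_ge0 andbT.
apply/ler_addgt0Pr => e e0; rewrite add0r.
have P0 := twopi_gt0; have N0 := nrm_ge0 a.
(* For nonzero [a] the bound 2 twopi |a| / (s - r) of the second term is then exactly [e]. *)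
pose s := r + 2 * nrm a * twopi / e.
have rs : r <= s by rewrite lerDl divr_ge0 ?(ltW e0)// !mulr_ge0// ltW.
rewrite (circle_int_const r0 rs); last by move=> z /andP[rz _]; exact: dk.
have s0 := lt_le_trans r0 rs.
have -> : circle_int (fun z => z / (z - a)) s =
   circle_int (fun z => a / (z - a)) s + ofR twopi.
  rewrite -[ofR twopi]mul1r -(circle_int_cst 1 s) /circle_int -integralCD//; last 2 first.
  - apply/ccont_integrable; apply: (@diff_circ_cont (fun z => a / (z - a))) => t.
    apply: dif_mul; first exact: dif_cst.
    by apply: dif_invsub; apply: za; rewrite nrm_circ// ltW.
  - by apply: ccont_integrable => x _; exact: cvg_cst.
  apply: eq_integralC => t _; have h : circ s t - a != 0.
    by apply: za; rewrite nrm_circ// ltW.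
  by field.
rewrite addrK (le_trans (circle_int_bound (M := nrm a / (s - r)) _ _))//.
- move=> t; apply: dif_mul; first exact: dif_cst.
  by apply: dif_invsub; apply: za; rewrite nrm_circ// ltW.
- move=> t _; rewrite nrmM nrmV.
  have [->|a0] := eqVneq a 0; first by rewrite nrm0 !mul0r.
  rewrite -nrm_gt0 in a0.
  have sr : 0 < s - r by rewrite /s addrAC subrr add0r divr_gt0// !mulr_gt0.
  rewrite ler_wpM2l// lef_pV2 ?posrE//.
    by have := nrmB_ge (circ s t) a; rewrite nrm_circ ?(ltW s0)//; lra.
  by rewrite nrm_gt0 za// nrm_circ// ltW.
have [a0|a0] := eqVneq (nrm a) 0; first by rewrite a0 !(mul0r, mulr0)// ltW.
rewrite le_eqVlt; apply/orP; left; apply/eqP.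
rewrite /s addrAC subrr add0r; clear -a0 e0 P0.
by move: twopi P0 => P P0; field; rewrite a0 !gt_eqF.
Qed.

End Cauchy.

(** * Cauchy's formula and Taylor expansion *)
Section CauchyFormula.
Context {R : realType}.
Implicit Types (phi g : cplx R -> cplx R) (r s t : R) (z a : cplx R).

Lemma near_is_diff (V W : normedModType R[i]) (f g : V -> W) (p : V) (L : V -> W) :
  {near p, f =1 g} -> is_diff p f L -> is_diff p g L.
Proof.
move=> fg [df dfL].
have [C C0 Cb] := diff_bounded df.
have [d1 d10 H1] := (nbhs_nrm _ _).1 fg.
apply: (@is_diff_intro _ _ _ _ _ _ C).
- by rewrite -dfL; exact: linearP.
- by rewrite -dfL.
move=> e e0; have [d d0 H] := diff_nrm df e0.
exists (Num.min d d1); first by rewrite lt_min d0.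
move=> h; rewrite lt_min => /andP[hd hd1].
rewrite -dfL -(H1 (p + h)); last by rewrite addrAC subrr add0r.
by rewrite -(H1 p) ?subrr ?nrm0//; exact: H.
Qed.

Lemma near_differentiable (V W : normedModType R[i]) (f g : V -> W) (p : V) :
  {near p, f =1 g} -> differentiable f p -> differentiable g p.
Proof. by move=> fg /differentiableP/(near_is_diff fg)[]. Qed.

Section Formula.
Context (phi : cplx R -> cplx R) (r0 : R) (a : cplx R).
Context (dphi : forall z, nrm z < r0 -> differentiable phi z) (ar0 : nrm a < r0).

Let G z := if z == a then a * derive1 phi a else z * (phi z - phi a) / (z - a).

Let dG z : nrm z < r0 -> z != a -> differentiable G z.
Proof.
move=> zr za.
apply: (@near_differentiable _ _ (fun z => z * (phi z - phi a) / (z - a))).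
  have d0 : 0 < nrm (z - a) by rewrite nrm_gt0 subr_eq0.
  apply/nbhs_nrm; exists (nrm (z - a)) => // w wz; rewrite /G.
  by case: eqP => // wa; move: wz; rewrite wa nrmC ltxx.
apply: dif_mul; last by apply: dif_invsub; rewrite subr_eq0.
apply: dif_mul; first exact: dif_id.
by apply: dif_sub; [exact: dphi|exact: dif_cst].
Qed.

Let cGa : {for a, continuous G}.
Proof.
have cq : {for a, continuous (fun z => if z == a then derive1 phi a
                                 else (phi z - phi a) / (z - a))}.
  apply: (cvg_nrm_le (F := nbhs a)) => e e0.
  have [d d0 H] := derive1_nrm (dphi ar0) e0.
  apply/nbhs_nrm; exists d => // z zd; rewrite eqxx.
  case: eqP => [_|/eqP za]; first by rewrite subrr nrm0 ltW.
  have := H _ zd; rewrite (addrC a) subrK => Hz.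
  have za0 : z - a != 0 by rewrite subr_eq0.
  have -> : (phi z - phi a) / (z - a) - derive1 phi a =
     (phi z - phi a - (z - a) * derive1 phi a) / (z - a) by field.
  by rewrite nrmM nrmV ler_pdivrMr ?nrm_gt0.
apply: (@eq_continuous _ _ (fun z => z * (if z == a then derive1 phi a
                                 else (phi z - phi a) / (z - a)))).
  by move=> z; rewrite /G; case: eqP => [->|_]//; rewrite mulrA.
have cid : {for a, continuous (fun z : cplx R => z)} by exact: cvg_id.
exact: (continuous_mul cid cq).
Qed.

Let cG z : nrm z < r0 -> {for z, continuous G}.
Proof.
move=> zr; have [->|za] := eqVneq z a; first exact: cGa.
exact/differentiable_continuous/dG.
Qed.

Let cI r : 0 < r -> r < r0 -> {for r, continuous (circle_int G)}.
Proof.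
move=> r_gt0 rr; apply: circle_int_continuous => [t|].
  by apply: cG; rewrite nrm_circ// ltW.
near=> s => t _; apply: cG; rewrite nrm_circ.
  by near: s; exact: lt_nbhsl.
by apply/ltW; near: s; exact: lt_nbhsr.
Unshelve. all: by end_near. Qed.

Let I0 : circle_int G 0 = 0.
Proof.
rewrite /circle_int (@eq_integralC _ _ _ (fun=> 0)).
  by rewrite integralC_cst ?mul0r// ltW// twopi_gt0.
move=> t _; rewrite /circ ofR0 mul0r /G.
by case: eqP => [<-|_]; rewrite !mul0r.
Qed.

Let cI0 : forall e : R, 0 < e -> exists2 d, 0 < d &
  forall r, 0 <= r -> r < d -> nrm (circle_int G r) < e.
Proof.
move=> e e0; have r00 : 0 < r0 := le_lt_trans (nrm_ge0 a) ar0.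
have : {for 0, continuous (circle_int G)}.
  apply: circle_int_continuous => [t|].
    by apply: cG; rewrite nrm_circ.
  near=> s => t _; apply: cG.
  rewrite /circ nrmM nrm_ofR nrm_expC !reimE mul0r mulr0 subr0 expR0 mulr1.
  by near: s; apply/nbhs_normP; exists r0 => //= s; rewrite /ball_/= sub0r normrN.
move=> /cvg_nrm/(_ _ e0)/nbhs_normP[d /= d0 H]; exists d => // r rge rd.
by have := H r; rewrite I0 subr0; apply; rewrite /ball_/= sub0r normrN ger0_norm.
Unshelve. all: by end_near. Qed.

(** Circles inside |z| < |a| can be shrunk to radius 0, where the integral vanishes; for a = 0 all
    circles can. The radius |a| itself is reached by continuity from below. *)
Let I_below r : 0 < r -> r < r0 -> r <= nrm a \/ a = 0 -> circle_int G r = 0.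
Proof.
move=> rgt0 rr0 ra.
have below s r' : 0 < s -> s <= r' -> r' < r0 -> (r' < nrm a \/ a = 0) ->
    circle_int G s = circle_int G r'.
  move=> s0 sr rr ha; apply: (circle_int_const s0 sr) => z /andP[sz zr].
  apply: dG; first exact: le_lt_trans rr.
  apply/eqP => za; case: ha => [|a0]; first by rewrite -za; lra.
  by move: sz; rewrite za a0 nrm0; lra.
have zero r' : 0 < r' -> r' < r0 -> (r' < nrm a \/ a = 0) -> circle_int G r' = 0.
  move=> r'0 rr ha; apply/eqP; rewrite -nrm_eq0 eq_le nrm_ge0 andbT.
  apply/ler_addgt0Pr => e e0; rewrite add0r.
  have [d d0 H] := cI0 e0.
  pose s := Num.min r' (d / 2).
  have s0 : 0 < s by rewrite lt_min r'0/=; lra.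
  rewrite -(below s r')//; last by rewrite ge_min lexx.
  apply/ltW/H; first exact: ltW.
  by rewrite gt_min; apply/orP; right; lra.
case: ra => [|a0]; last by apply: zero => //; right.
rewrite le_eqVlt => /predU1P[ra|ra]; last by apply: zero => //; left.
apply/eqP; rewrite -nrm_eq0 eq_le nrm_ge0 andbT.
apply/ler_addgt0Pr => e e0; rewrite add0r.
have /cvg_nrm/(_ _ e0)/nbhs_normP[d /= d0 H] := cI rgt0 rr0.
pose s := Num.max (r / 2) (r - d / 2).
have sr : s < r by rewrite gt_max; apply/andP; split; lra.
have s0 : 0 < s by rewrite lt_max; apply/orP; left; lra.
have := H s; rewrite (zero s)//; [|exact: lt_trans rr0|by left; rewrite -ra].
rewrite sub0r nrmN => h; apply/ltW/h; rewrite /ball_/= gtr0_norm; last lra.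
have : r - d / 2 <= s by rewrite le_max lexx orbT.
lra.
Qed.

(** The integral is constant for radii beyond |a|, and continuity at |a| joins it to the value 0
    obtained there. *)
Let I_zero r : nrm a < r -> r < r0 -> circle_int G r = 0.
Proof.
move=> ar rr0; have [a0|a0] := eqVneq a 0.
  by apply: I_below => //; [move: ar; rewrite a0 nrm0|right].
rewrite -nrm_gt0 in a0.
apply/eqP; rewrite -nrm_eq0 eq_le nrm_ge0 andbT.
apply/ler_addgt0Pr => e e0; rewrite add0r.
have /cvg_nrm/(_ _ e0)/nbhs_normP[d /= d0 H] := cI a0 ar0.
pose s := Num.min r (nrm a + d / 2).
have sr : nrm a < s by rewrite lt_min ar/=; lra.
have := H s; rewrite (I_below a0 ar0) ?subr0; last by left.
have sr' : s <= r by rewrite ge_min lexx.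
rewrite (circle_int_const (lt_trans a0 sr) sr'); last first.
  move=> z /andP[sz zr]; apply: dG; first exact: le_lt_trans rr0.
  by apply/eqP => za; move: sz; rewrite za; lra.
move=> h; apply/ltW/h; rewrite /ball_/= ltr0_norm; last lra.
have : s <= nrm a + d / 2 by rewrite ge_min lexx orbT.
lra.
Qed.

Lemma Cauchy_circle r : nrm a < r -> r < r0 ->
  circle_int (fun z => phi z * (z / (z - a))) r = phi a * ofR twopi.
Proof.
move=> ar rr0; have rgt0 : 0 < r := le_lt_trans (nrm_ge0 a) ar.
have za t : circ r t - a != 0.
  by rewrite subr_eq0; apply/eqP => za; move: ar; rewrite -za nrm_circ ?ltxx ?ltW.
have dk t : differentiable (fun z => z / (z - a)) (circ r t).
  by apply: dif_mul; [exact: dif_id|exact: dif_invsub].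
have dp t : differentiable phi (circ r t) by apply: dphi; rewrite nrm_circ// ltW.
have := I_zero ar rr0.
have -> : circle_int G r = circle_int (fun z => phi z * (z / (z - a))) r -
   circle_int (fun z => phi a * (z / (z - a))) r.
  rewrite /circle_int -integralCB//; last 2 first.
  - apply/ccont_integrable; apply: (@diff_circ_cont _ (fun z => phi z * (z / (z - a)))) => t.
    exact: dif_mul.
  - apply/ccont_integrable; apply: (@diff_circ_cont _ (fun z => phi a * (z / (z - a)))) => t.
    by apply: dif_mul => //; exact: dif_cst.
  apply: eq_integralC => t _; rewrite /G ifN; last by rewrite -subr_eq0.
  by have := za t; set z := circ r t => z0; field.
rewrite /circle_int (integralCZ (phi a))//; last first.
  exact/ccont_integrable/(diff_circ_cont dk).
rewrite -/(circle_int (fun z => phi z * (z / (z - a))) r) -/(circle_int (fun z => z / (z - a)) r).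
by rewrite circle_int_kernel// => /eqP; rewrite subr_eq0 => /eqP.
Qed.

End Formula.

(** The usual integral of phi(z) / z^(k+1) dz over 2 pi i, one power of z being absorbed by dz = i z
    dt. *)
Definition Taylor_coef phi r (k : nat) : cplx R :=
  circle_int (fun z => phi z / z ^+ k) r / ofR twopi.

(** Cauchy's kernel z / (z - a) is expanded as a geometric series in a / z; what is left after n
    terms is the kernel times (a / z)^n. The factor 2 is that of the componentwise bound of an
    integral. *)
Lemma Taylor_remainder phi r0 r (M : R) a n :
  (forall z, nrm z < r0 -> differentiable phi z) ->
  nrm a < r -> r < r0 ->
  (forall t, t \in `[0, twopi] -> nrm (phi (circ r t)) <= M) ->
  nrm (phi a - \sum_(k < n) Taylor_coef phi r k * a ^+ k) <=
  2 * M * ((nrm a / r) ^+ n * (r / (r - nrm a))).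
Proof.
move=> dphi ar rr0 phiM; have rgt0 : 0 < r := le_lt_trans (nrm_ge0 a) ar.
have P0 := @twopi_gt0 R.
have P0' : ofR twopi != 0 :> cplx R by rewrite ofR_eq0 gt_eqF.
have za t : circ r t - a != 0.
  by rewrite subr_eq0; apply/eqP => za; move: ar; rewrite -za nrm_circ ?ltxx ?ltW.
have z0 t : circ r t != 0 by rewrite -nrm_gt0 nrm_circ// ltW.
have dp t : differentiable phi (circ r t) by apply: dphi; rewrite nrm_circ// ltW.
have dV k t : differentiable (fun z => (z ^+ k)^-1) (circ r t).
  by apply: dif_inv; [apply: dif_exp; exact: dif_id|rewrite expf_neq0].
have dpk k t : differentiable (fun z => phi z / z ^+ k) (circ r t).
  exact: dif_mul.
pose K z := z / (z - a).
have dK t : differentiable K (circ r t).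
  by apply: dif_mul; [exact: dif_id|exact: dif_invsub].
pose rem k z := phi z * (a ^+ k / z ^+ k * K z).
have drem k t : differentiable (rem k) (circ r t).
  apply: dif_mul; first exact: dp.
  apply: dif_mul; last exact: dK.
  by apply: dif_mul; [exact: dif_cst|exact: dV].
(* Each step uses (a/z)^k z/(z - a) - (a/z)^k = (a/z)^(k+1) z/(z - a). *)
have E k : phi a * ofR twopi - \sum_(j < k) circle_int (fun z => phi z / z ^+ j) r * a ^+ j =
    circle_int (rem k) r.
  elim: k => [|k IH].
    rewrite big_ord0 subr0 -(Cauchy_circle dphi (lt_trans ar rr0) ar rr0).
    by rewrite /circle_int; apply: eq_integralC => t _; rewrite /rem !expr0 divr1 mul1r.
  rewrite big_ord_recr/= opprD addrA IH mulrC.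
  rewrite /circle_int -integralCZ//; last exact/ccont_integrable/(diff_circ_cont (dpk k)).
  rewrite -integralCB//; last 2 first.
  - exact/ccont_integrable/(diff_circ_cont (drem k)).
  - apply: cintegrableZ => //; exact/ccont_integrable/(diff_circ_cont (dpk k)).
  apply: eq_integralC => t _; rewrite /rem /K.
  have := za t; have := z0 t; set z := circ r t => h1 h2.
  by rewrite !exprSr; field; rewrite h1 h2 expf_neq0.
have -> : phi a - \sum_(k < n) Taylor_coef phi r k * a ^+ k =
   circle_int (rem n) r / ofR twopi.
  rewrite -E mulrBl mulfK// mulr_suml; congr (_ - _).
  by apply: eq_bigr => k _; rewrite /Taylor_coef mulrAC.
rewrite nrmM nrmV nrm_ofR gtr0_norm// ler_pdivrMr//.
rewrite [leRHS](_ : _ = 2 * (M * ((nrm a / r) ^+ n * (r / (r - nrm a)))) * twopi);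
  last by ring.
apply: (circle_int_bound (drem n)) => t ht.
have := nrm_circ t (ltW rgt0); have := za t; have := phiM t ht.
rewrite /rem /K; move: (circ r t) => z pM zne zn.
rewrite !nrmM !nrmV !nrmX zn.
have M0 : 0 <= M by rewrite (le_trans _ pM)// nrm_ge0.
rewrite ler_pM ?nrm_ge0//.
  by rewrite !mulr_ge0 ?invr_ge0 ?exprn_ge0 ?nrm_ge0 ?(ltW rgt0).
rewrite expr_div_n ler_wpM2l//.
  by rewrite divr_ge0 ?exprn_ge0 ?nrm_ge0 ?(ltW rgt0).
rewrite ler_wpM2l ?(ltW rgt0)// lef_pV2 ?posrE ?nrm_gt0 ?subr_gt0//.
by have := nrmB_ge z a; rewrite zn.
Qed.

Lemma Taylor_coef0 phi r0 r : (forall z, nrm z < r0 -> differentiable phi z) ->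
  0 < r -> r < r0 -> Taylor_coef phi r 0 = phi 0.
Proof.
move=> dphi rgt0 rr0.
have := Cauchy_circle (a := 0) dphi; rewrite nrm0 => /(_ (lt_trans rgt0 rr0) _ rgt0 rr0).
have P0' : ofR twopi != 0 :> cplx R by rewrite ofR_eq0 gt_eqF// twopi_gt0.
rewrite /Taylor_coef => H; apply: (mulIf P0'); rewrite divfK// -H.
apply: eq_integralC => t _; rewrite subr0 divff ?expr0 ?mulr1 ?divr1//.
by rewrite -nrm_gt0 nrm_circ// ltW.
Qed.

Lemma Taylor1 phi r0 (M : R) h : 0 < r0 ->
  (forall z, nrm z < r0 -> differentiable phi z) ->
  (forall z, nrm z < r0 -> nrm (phi z) <= M) ->
  nrm h <= r0 / 4 ->
  nrm (phi h - phi 0 - h * derive1 phi 0) <= 16 * M * (nrm h / r0) ^+ 2.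
Proof.
move=> r0gt dphi phiM hr.
(* With half the radius, |h| <= r0 / 4 gives r / (r - |h|) <= 2, whence the constant 16 = 2 * 4 *
   2. *)
pose r := r0 / 2; have rgt0 : 0 < r by rewrite /r; lra.
have rr0 : r < r0 by rewrite /r; lra.
have M0 : 0 <= M by rewrite (le_trans _ (phiM 0 _)) ?nrm_ge0// nrm0.
have cM t : t \in `[0, twopi] -> nrm (phi (circ r t)) <= M.
  by move=> _; apply: phiM; rewrite nrm_circ// ltW.
have c0 := Taylor_coef0 dphi rgt0 rr0.
pose c1 := Taylor_coef phi r 1.
have est k : nrm k <= r0 / 4 -> nrm (phi k - phi 0 - k * c1) <= 16 * M * (nrm k / r0) ^+ 2.
  move=> kr; have kr' : nrm k < r by rewrite /r; lra.
  have := Taylor_remainder 2 dphi kr' rr0 cM.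
  rewrite !big_ord_recl big_ord0 /= addr0 expr0 mulr1 c0 expr1 opprD addrA.
  rewrite (mulrC _ k) => /le_trans; apply.
  have N0 := nrm_ge0 k.
  have rb : r / (r - nrm k) <= 2.
    by rewrite ler_pdivrMr ?subr_gt0// /r; lra.
  have -> : 16 * M * (nrm k / r0) ^+ 2 = 2 * M * ((nrm k / r) ^+ 2 * 2).
    by rewrite /r; field; rewrite gt_eqF.
  rewrite ler_wpM2l ?mulr_ge0// ler_wpM2l// sqr_ge0//.
(* The estimate itself identifies the first Taylor coefficient with the derivative at 0. *)
have [_ d1] : differentiable phi 0 /\ derive1 phi 0 = c1.
  suff H : is_diff 0 phi ( *%R^~ c1) by split; [exact: ex_diff|exact: is_diff_derive1].
  apply: is_diff1_intro => e e0.
  exists (Num.min (r0 / 4) (e * r0 ^+ 2 / (16 * M + 1))).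
    rewrite lt_min !divr_gt0// ?mulr_gt0 ?exprn_gt0// ltr_wpDl// mulr_ge0//.
  move=> k; rewrite lt_min => /andP[k1 k2]; rewrite add0r.
  rewrite (le_trans (est k (ltW k1)))//.
  rewrite expr_div_n expr2 mulrA mulrA -!mulrA (mulrCA (16 : R)) !mulrA.
  rewrite ltr_pdivlMr in k2; last by rewrite ltr_wpDl// mulr_ge0.
  rewrite ler_pdivrMr ?exprn_gt0//.
  have N0 := nrm_ge0 k.
  have := ler_wpM2r N0 (ltW k2); nra.
by rewrite d1; exact: est.
Qed.

(** At h = r0 / 4 the quadratic estimate equals M, so h phi'(0) is bounded by 3 M. *)
Lemma Cauchy_derive1 phi r0 (M : R) : 0 < r0 ->
  (forall z, nrm z < r0 -> differentiable phi z) ->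
  (forall z, nrm z < r0 -> nrm (phi z) <= M) ->
  nrm (derive1 phi 0) <= 12 * M / r0.
Proof.
move=> r0gt dphi phiM.
have M0 : 0 <= M by rewrite (le_trans _ (phiM 0 _)) ?nrm_ge0// nrm0.
pose h : cplx R := ofR (r0 / 4).
have hn : nrm h = r0 / 4 by rewrite nrm_ofR gtr0_norm//; lra.
have := Taylor1 r0gt dphi phiM (h := h); rewrite hn lexx => /(_ isT).
have -> : 16 * M * (r0 / 4 / r0) ^+ 2 = M by field; rewrite gt_eqF.
move=> H.
have : nrm (h * derive1 phi 0) <= 3 * M.
  have -> : h * derive1 phi 0 = phi h - phi 0 - (phi h - phi 0 - h * derive1 phi 0).
    by ring.
  rewrite (le_trans (nrmB _ _))//.
  have := nrmB (phi h) (phi 0).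
  have : nrm (phi h) <= M by apply: phiM; rewrite hn; lra.
  have : nrm (phi 0) <= M by apply: phiM; rewrite nrm0.
  lra.
rewrite nrmM hn => H'; rewrite ler_pdivlMr//; lra.
Qed.

End CauchyFormula.

(** * Holomorphic limits and parameter integrals *)
Section Weierstrass.
Context {R : realType}.
Implicit Types (V : normedModType R[i]).
Notation mu := (@lebesgue_measure R).

Lemma is_diff_line V (p h : V) (t : cplx R) :
  is_diff t (fun s : cplx R => p + s *: h) ( *:%R^~ h).
Proof.
apply: (@is_diff_intro _ _ _ _ _ _ (nrm h)).
- by move=> a u v /=; rewrite scalerDl scalerA.
- by move=> k; rewrite nrmZ mulrC.
move=> e e0; exists 1 => // k _.
rewrite scalerDl addrA (addrAC (p + _)) subrr add0r subrr nrm0 mulr_ge0 ?nrm_ge0//.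
exact: ltW.
Qed.

Lemma derive1_line V (f : V -> cplx R) (p h : V) (t : cplx R) :
  differentiable f (p + t *: h) ->
  differentiable (fun s : cplx R => f (p + s *: h)) t /\
  derive1 (fun s : cplx R => f (p + s *: h)) t = 'd f (p + t *: h) h.
Proof.
move=> df; have := is_diff_comp (is_diff_line p h t) (differentiableP df).
rewrite (_ : _ \o _ = fun s : cplx R => f (p + s *: h))// => H.
split; first exact: ex_diff.
apply: is_diff_derive1; apply: is_diff_eq H _; apply/funext => k /=.
by rewrite linearZ.
Qed.

(** On the complex line s -> p + s h the ball of radius rho becomes a disc of radius rho / |h|, and
    p + h becomes the point s = 1, to which the one-variable estimate applies. *)
Lemma second_order_bound V (f : V -> cplx R) (p h : V) (rho M : R) :
  0 < rho -> (forall q, nrm (q - p) < rho -> differentiable f q) ->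
  (forall q, nrm (q - p) < rho -> nrm (f q) <= M) -> nrm h <= rho / 4 ->
  nrm (f (p + h) - f p - 'd f p h) <= 16 * M * (nrm h / rho) ^+ 2.
Proof.
move=> rho0 df fM hr.
have [->|h0] := eqVneq h 0.
  by rewrite addr0 subrr linear0 subr0 !nrm0 mul0r expr0n/= mulr0.
rewrite -nrm_gt0 in h0.
have r0 : 0 < rho / nrm h by rewrite divr_gt0.
have inb (z : cplx R) : nrm z < rho / nrm h -> nrm (p + z *: h - p) < rho.
  by rewrite addrAC subrr add0r nrmZ ltr_pdivlMr.
have dphi z : nrm z < rho / nrm h -> differentiable (fun s : cplx R => f (p + s *: h)) z.
  by move=> /inb/df/derive1_line[].
have := Taylor1 (h := 1) r0 dphi (fun z zr => fM _ (inb z zr)).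
have h1 : 1 <= rho / nrm h / 4 by rewrite ler_pdivlMr// ler_pdivlMr//; lra.
rewrite nrm1 !mul1r scale1r scale0r addr0 => /(_ h1).
have [|_ ->] := @derive1_line _ f p h 0; rewrite scale0r addr0.
  by apply: df; rewrite subrr nrm0.
by rewrite invf_div.
Qed.

Lemma first_order_bound V (f : V -> cplx R) (p h : V) (rho M : R) :
  0 < rho -> (forall q, nrm (q - p) < rho -> differentiable f q) ->
  (forall q, nrm (q - p) < rho -> nrm (f q) <= M) ->
  nrm ('d f p h) <= 12 * M * (nrm h / rho).
Proof.
move=> rho0 df fM.
have [->|h0] := eqVneq h 0.
  by rewrite linear0 !nrm0 mul0r mulr0 lexx.
rewrite -nrm_gt0 in h0.
have r0 : 0 < rho / nrm h by rewrite divr_gt0.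
have inb (z : cplx R) : nrm z < rho / nrm h -> nrm (p + z *: h - p) < rho.
  by rewrite addrAC subrr add0r nrmZ ltr_pdivlMr.
have dphi z : nrm z < rho / nrm h -> differentiable (fun s : cplx R => f (p + s *: h)) z.
  by move=> /inb/df/derive1_line[].
have := Cauchy_derive1 r0 dphi (fun z zr => fM _ (inb z zr)).
have [|_ ->] := @derive1_line _ f p h 0; rewrite scale0r addr0.
  by apply: df; rewrite subrr nrm0.
by rewrite invf_div.
Qed.

Lemma cvg_le_nrm (u : nat -> cplx R) (l : cplx R) (c : R) :
  u @ \oo --> l -> (\forall n \near \oo, nrm (u n) <= c) -> nrm l <= c.
Proof.
move=> ul uc; apply/ler_addgt0Pr => e e0.
have /cvg_nrm/(_ _ e0) H := ul.
have [n [h1 h2]] : exists n, nrm (u n) <= c /\ nrm (u n - l) < e.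
  by apply: (@filter_ex _ \oo); apply: filterI.
have := nrmB_ge l (u n); rewrite nrmC; lra.
Qed.

Lemma cvg_nrm_unique (u : nat -> cplx R) (l m : cplx R) :
  u @ \oo --> l -> u @ \oo --> m -> l = m.
Proof. by move=> ul um; exact: cvg_unique ul um. Qed.

Lemma cplx_complete (u : nat -> cplx R) :
  (forall e : R, 0 < e -> exists N, forall n m, (N <= n)%N -> (N <= m)%N ->
     nrm (u n - u m) <= e) -> exists l : cplx R, u @ \oo --> l.
Proof.
move=> H.
have main (w : nat -> R) : (forall n m, `|w n - w m| <= nrm (u n - u m)) ->
    exists l : R, w @ \oo --> l.
  move=> wu; apply/cvg_ex/cauchy_cvgP/cauchy_exP => e e0.
  have [|N HN] := H (e / 2); first by rewrite divr_gt0.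
  exists (w N); exists N => // n /= hn; rewrite /ball/= (le_lt_trans (wu _ _))//.
  rewrite (le_lt_trans (HN _ _ (leqnn N) hn))//; lra.
have [a ha] : exists a : R, (fun n => reC (u n)) @ \oo --> a.
  by apply: main => n m; rewrite -reC_B reC_le_nrm.
have [b hb] : exists b : R, (fun n => imC (u n)) @ \oo --> b.
  by apply: main => n m; rewrite -imC_B imC_le_nrm.
by exists (cpt a b); apply/cvg_reim; rewrite reC_cpt imC_cpt.
Qed.

Lemma diffBE V (f g : V -> cplx R) (p h : V) :
  differentiable f p -> differentiable g p ->
  'd (fun q => f q - g q) p h = 'd f p h - 'd g p h.
Proof.
move=> df dg.
exact: (congr1 (fun k : V -> cplx R => k h) (@diffB _ _ _ f g p df dg)).
Qed.

(** The first-order Cauchy estimate makes the differentials a Cauchy sequence, and their limit [L]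
    is the candidate. The remainder of [f] is compared with that of one fixed [f_ N1], the
    second-order estimate controlling the remainder of the difference. *)
Lemma Weierstrass V (f_ : nat -> V -> cplx R) (f : V -> cplx R) (p : V) (rho : R) :
  0 < rho -> (forall n q, nrm (q - p) < rho -> differentiable (f_ n) q) ->
  (forall e : R, 0 < e -> exists N, forall n, (N <= n)%N ->
     forall q, nrm (q - p) < rho -> nrm (f_ n q - f q) <= e) ->
  differentiable f p /\
  forall h, (fun n => 'd (f_ n) p h) @ \oo --> ('d f p h : cplx R).
Proof.
move=> rho0 df uf.
have dfp n : differentiable (f_ n) p by apply: df; rewrite subrr nrm0.
have cauchy e : 0 < e -> exists N, forall n m, (N <= n)%N -> (N <= m)%N ->
    forall q, nrm (q - p) < rho -> nrm (f_ n q - f_ m q) <= e.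
  move=> e0; have [|N HN] := uf (e / 2); first lra.
  exists N => n m hn hm q hq; rewrite (le_trans (nrm_dist (f q) _ _))//.
  by rewrite [leRHS]splitr lerD ?(nrmC (f q)) ?HN.
have cauchyD e : 0 < e -> exists N, forall n m, (N <= n)%N -> (N <= m)%N ->
    forall h, nrm ('d (f_ n) p h - 'd (f_ m) p h) <= e * nrm h.
  move=> e0; have [|N HN] := cauchy (e * rho / 12); first by rewrite !mulr_gt0.
  exists N => n m hn hm h; rewrite -diffBE//.
  have := @first_order_bound _ (fun q => f_ n q - f_ m q) p h rho (e * rho / 12) rho0.
  rewrite [X in _ <= X](_ : _ = e * nrm h); last by field; rewrite gt_eqF.
  by apply => q hq; [apply: dif_sub; exact: df|exact: HN].
have /choice[L HL] h : exists l : cplx R, (fun n => 'd (f_ n) p h : cplx R) @ \oo --> l.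
  apply: cplx_complete => e e0.
  have e1 : 0 < e / (nrm h + 1) by rewrite divr_gt0// ltr_wpDl// nrm_ge0.
  have [N HN] := cauchyD _ e1; exists N => n m hn hm.
  rewrite (le_trans (HN n m hn hm h))// mulrAC ler_pdivrMr ?ltr_wpDl ?nrm_ge0//.
  by rewrite ler_wpM2l ?(ltW e0)// lerDl.
have linL : linear L.
  move=> a0 u v; set a : cplx R := a0.
  apply: (cvg_unique _ (HL (a *: u + v))) => //.
  have -> : (fun n => 'd (f_ n) p (a *: u + v) : cplx R) =
      (fun n => a * ('d (f_ n) p u : cplx R) + 'd (f_ n) p v).
    by apply/funext => n; exact: linearP.
  have h1 : (fun n => a * ('d (f_ n) p u : cplx R)) @ \oo --> a * L u.
    by apply: cvgM; [exact: cvg_cst|exact: HL].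
  exact: (cvgD h1 (HL v)).
have LD e : 0 < e -> exists N, forall n, (N <= n)%N -> forall h,
    nrm (L h - 'd (f_ n) p h) <= e * nrm h.
  move=> e0; have [N HN] := cauchyD e e0; exists N => n hn h.
  apply: (@cvg_le_nrm (fun m => 'd (f_ m) p h - 'd (f_ n) p h)).
    by apply: cvgB; [exact: HL|exact: cvg_cst].
  by exists N => // m /= hm; exact: HN.
have [C LC] : exists C, forall h, nrm (L h) <= C * nrm h.
  have [N HN] := LD 1 ltr01; have [C C0 HC] := diff_bounded (dfp N).
  exists (1 + C) => h; have := HN N (leqnn N) h; have := HC h.
  have := nrmB_ge (L h) ('d (f_ N) p h); lra.
suff [df0 dfL] : differentiable f p /\ 'd f p = L :> (V -> cplx R).
  split; first exact: df0.
  move=> h; have E : 'd f p h = L h :> cplx R by rewrite dfL.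
  by have := HL h; rewrite -E.
apply: (diff_intro linL LC) => e e0.
(* For |h| <= rho / 4 one has 16 (e rho / 8) (|h| / rho)^2 <= e / 2 |h|. *)
have e1 : 0 < e * rho / 8 by rewrite !mulr_gt0.
have [N1 HN1] := cauchy _ e1.
have e2 : 0 < e / 2 by lra.
have [d d0 Hd] := diff_nrm (dfp N1) e2.
exists (Num.min d (rho / 4)); first by rewrite lt_min d0/=; lra.
move=> h; rewrite lt_min => /andP[hd hr].
(* The remainder of [f_ m - f_ N1], whose limit [l] is that of [f - f_ N1]. *)
pose u m : cplx R := (f_ m (p + h) - f_ N1 (p + h)) - (f_ m p - f_ N1 p) -
   ('d (f_ m) p h - 'd (f_ N1) p h).
pose l : cplx R := (f (p + h) - f_ N1 (p + h)) - (f p - f_ N1 p) -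
   (L h - 'd (f_ N1) p h).
have cf q : nrm (q - p) < rho -> f_ ^~ q @ \oo --> f q.
  move=> hq; apply: cvg_nrm_le => e' /uf[N HN].
  by exists N => // n /= hn; exact: HN.
have ul : u @ \oo --> l.
  have hr' : nrm (p + h - p) < rho by rewrite addrAC subrr add0r; lra.
  have hr0 : nrm (p - p) < rho by rewrite subrr nrm0.
  apply: cvgB; last by apply: cvgB; [exact: HL|exact: cvg_cst].
  apply: cvgB; apply: cvgB; try exact: cvg_cst; exact: cf.
have ub : nrm l <= e / 2 * nrm h.
  apply: (cvg_le_nrm ul); exists N1 => // m /= hm.
  rewrite /u -diffBE//.
  apply: (le_trans (second_order_bound (M := e * rho / 8) rho0 _ _ (ltW hr))).
  - by move=> q hq; apply: dif_sub; exact: df.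
  - by move=> q hq; exact: HN1.
  have -> : 16 * (e * rho / 8) * (nrm h / rho) ^+ 2 = 2 * e * nrm h * (nrm h / rho).
    by field; rewrite gt_eqF.
  have : nrm h / rho <= 1 / 4 by rewrite ler_pdivrMr//; lra.
  have : 0 <= e * nrm h by rewrite mulr_ge0 ?nrm_ge0 ?ltW.
  move=> x0 /(ler_wpM2l x0); lra.
have -> : f (p + h) - f p - L h = l + (f_ N1 (p + h) - f_ N1 p - 'd (f_ N1) p h).
  by rewrite /l; ring.
rewrite (le_trans (nrmD _ _))// [leRHS](_ : _ = e / 2 * nrm h + e / 2 * nrm h).
  by rewrite lerD// Hd.
by field.
Qed.

Lemma cvg_inv_shift (c : R) : (fun n => c / n.+1%:R) @ \oo --> (0 : R).
Proof.
rewrite -(mulr0 c); apply: cvgMr.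
by apply/(@cvg_harmonic R).
Qed.

Lemma ex_small_inv (c e : R) : 0 <= c -> 0 < e ->
  exists N, forall n, (N <= n)%N -> c / n.+1%:R <= e.
Proof.
move=> c0 e0; have /cvgrPdist_lt/(_ _ e0)[N _ H] := cvg_inv_shift c.
exists N => n hn; have := H n hn; rewrite sub0r normrN ger0_norm ?divr_ge0//.
exact: ltW.
Qed.

(** The factor [k] scales all steps, so that the shifted points can be kept in a given ball already
    from n = 0 on. *)
Definition diff_quot V (f : V -> cplx R) (v : V) (k : R) (n : nat) (q : V) : cplx R :=
  (f (q + ofR (k / n.+1%:R) *: v) - f q) / ofR (k / n.+1%:R).

Lemma diff_quot_unif V (f : V -> cplx R) (p v : V) (rho M : R) (k : R) :
  0 < rho -> 0 < k -> k * nrm v <= rho / 4 ->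
  (forall q, nrm (q - p) < 2 * rho -> differentiable f q) ->
  (forall q, nrm (q - p) < 2 * rho -> nrm (f q) <= M) ->
  forall n q, nrm (q - p) < rho ->
  nrm (diff_quot f v k n q - 'd f q v) <= 16 * M * (nrm v / rho) ^+ 2 * (k / n.+1%:R).
Proof.
move=> rho0 k0 kv df fM n q qp.
have M0 : 0 <= M by apply: le_trans (fM p _); rewrite ?nrm_ge0// subrr nrm0 mulr_gt0.
set kn := k / n.+1%:R; have kn0 : 0 < kn by rewrite divr_gt0.
have knk : kn <= k by rewrite ler_pdivrMr// ler_peMr ?ler1n// ltW.
have z0 : ofR kn != 0 :> cplx R by rewrite ofR_eq0 gt_eqF.
have sub x : nrm (x - q) < rho -> nrm (x - p) < 2 * rho.
  by move=> xq; rewrite (le_lt_trans (nrm_dist q _ _))//; lra.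
have hb : nrm (ofR kn *: v) <= rho / 4.
  by rewrite nrmZ nrm_ofR gtr0_norm// (le_trans _ kv)// ler_wpM2r ?nrm_ge0.
have := second_order_bound rho0 (fun x xq => df x (sub x xq))
  (fun x xq => fM x (sub x xq)) hb.
rewrite linearZ nrmZ nrm_ofR gtr0_norm// => H.
have -> : diff_quot f v k n q - 'd f q v =
    (f (q + ofR kn *: v) - f q - ofR kn *: 'd f q v) / ofR kn.
  by rewrite /diff_quot -/kn /GRing.scale/=; field.
rewrite nrmM nrmV nrm_ofR gtr0_norm// ler_pdivrMr// (le_trans H)//.
by rewrite le_eqVlt; apply/orP; left; apply/eqP; field; rewrite gt_eqF.
Qed.

Lemma locally_bounded V (f : V -> cplx R) (p : V) : {for p, continuous f} ->
  exists2 d : R, 0 < d & forall q, nrm (q - p) < d -> nrm (f q) <= nrm (f p) + 1.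
Proof.
move=> cf; have [d d0 H] := continuous_near0 cf ltr01; exists d => // q qd.
have := H _ qd; rewrite (addrC p) subrK.
by have := nrmB_ge (f q) (f p); lra.
Qed.

Lemma is_diff_shift V (f : V -> cplx R) (p v : V) : differentiable f (p + v) ->
  is_diff p (fun q => f (q + v)) ('d f (p + v)).
Proof.
move=> df; have [C C0 HC] := diff_bounded df.
apply: (is_diff_intro (C := C)) => //.
  by move=> a u w; rewrite linearP.
move=> e e0; have [d d0 H] := diff_nrm df e0; exists d => // h hd.
by rewrite (addrAC p h); exact: H.
Qed.

Lemma diff_quot_diff V (f : V -> cplx R) (p v h : V) (k : R) n :
  differentiable f p -> differentiable f (p + ofR (k / n.+1%:R) *: v) ->
  differentiable (diff_quot f v k n) p /\
  'd (diff_quot f v k n) p h = diff_quot (fun q => 'd f q h) v k n p.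
Proof.
move=> df dfs; have ds := is_diff_shift dfs.
set c := ofR _ in dfs ds *.
have -> : diff_quot f v k n = c^-1 \*: (fun q => f (q + c *: v) - f q).
  by apply/funext => q; rewrite /diff_quot -/c/= /GRing.scale/= mulrC.
have dB := is_diffZ c^-1 (is_diffB ds (differentiableP df)).
split; first exact: ex_diff.
have [_ dE] := dB; rewrite /diff_quot -/c.
transitivity (c^-1 * (('d f (p + c *: v) h : cplx R) - 'd f p h)).
  exact: (congr1 (fun k : V -> cplx R => k h) dE).
by rewrite mulrC.
Qed.

(** A directional derivative is a locally uniform limit of difference quotients, which are
    holomorphic, so the limit theorem applies. The differential of the limit is recorded as a limit
    of difference quotients in which the two directions have exchanged roles; [directional_comm]
    rests on this form. *)
Lemma directional_diff V (f : V -> cplx R) (p v : V) (rho : R) : 0 < rho ->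
  (forall q, nrm (q - p) < rho -> differentiable f q) ->
  differentiable (fun q => 'd f q v) p /\
  exists2 k0 : R, 0 < k0 & forall k : R, 0 < k -> k <= k0 ->
    forall h, (fun n => diff_quot (fun q => 'd f q h) v k n p) @ \oo -->
      ('d (fun q => 'd f q v : cplx R) p h : cplx R).
Proof.
move=> rho0 df.
have cf : {for p, continuous f}.
  by apply/differentiable_continuous/df; rewrite subrr nrm0.
have [d d0 fM] := locally_bounded cf; set M : R := nrm (f p) + 1 in fM.
have M0 : 0 <= M by rewrite addr_ge0// nrm_ge0.
(* The ball of radius 2 r lies where [f] is differentiable and bounded; [k0] then keeps the steps
   below r / 4. *)
pose r : R := Num.min (rho / 2) (d / 2) / 2.
have r0 : 0 < r by rewrite divr_gt0// lt_min; apply/andP; split; lra.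
have r1 : 2 * r <= rho / 2.
  have : Num.min (rho / 2) (d / 2) <= rho / 2 by rewrite ge_min lexx.
  rewrite /r; lra.
have r2 : 2 * r <= d / 2.
  have : Num.min (rho / 2) (d / 2) <= d / 2 by rewrite ge_min lexx orbT.
  rewrite /r; lra.
pose k0 : R := r / (4 * (nrm v + 1)).
have k00 : 0 < k0 by rewrite divr_gt0// mulr_gt0// ltr_wpDl// nrm_ge0.
have k0v (k : R) : 0 < k -> k <= k0 -> k * nrm v <= r / 4.
  move=> kp kk0; have : k * (nrm v + 1) <= r / 4.
    apply: le_trans (_ : k0 * (nrm v + 1) <= _).
      by rewrite ler_wpM2r// addr_ge0// nrm_ge0.
    rewrite le_eqVlt; apply/orP; left; apply/eqP; rewrite /k0; field.
    by rewrite gt_eqF// ltr_wpDl// nrm_ge0.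
  lra.
have main (k : R) : 0 < k -> k <= k0 -> differentiable (fun q => 'd f q v : cplx R) p /\
    forall h, (fun n => 'd (diff_quot f v k n) p h : cplx R) @ \oo -->
      ('d (fun q => 'd f q v : cplx R) p h : cplx R).
  move=> kp kk0; have kv := k0v _ kp kk0.
  apply: (@Weierstrass _ _ _ _ r r0).
    move=> n q qp; have [||d1 _] := @diff_quot_diff _ f q v 0 k n; last exact: d1.
      by apply: df; lra.
    apply: df; rewrite addrAC (le_lt_trans (nrmD _ _))// nrmZ nrm_ofR gtr0_norm ?divr_gt0//.
    have : k / n.+1%:R * nrm v <= k * nrm v.
      by rewrite ler_wpM2r ?nrm_ge0// ler_pdivrMr// ler_peMr ?ler1n// ltW.
    move: (k / n.+1%:R * nrm v) (k * nrm v) kv => x1 x2 kv; move: (nrm (q - p)) qp => x3 qp; clear -qp kv rho0 r0 r1; lra.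
  move=> e e0.
  have c0 : 0 <= 16 * M * (nrm v / r) ^+ 2 * k.
    by rewrite !mulr_ge0 ?invr_ge0 ?nrm_ge0 ?M0 ?(ltW kp) ?(ltW r0).
  have [N HN] := ex_small_inv c0 e0; exists N => n hn q qp.
  apply: le_trans (HN n hn); rewrite -mulrA.
  by apply: (@diff_quot_unif _ f p v r M k r0 kp kv _ _ n q qp) => x xp;
    [apply: df|apply: fM]; lra.
split; first by have [] := main k0 k00 (lexx _).
exists k0; first exact: k00.
move=> k kp kk0 h; have [_ H] := main k kp kk0.
have := H h; rewrite (_ : (fun n => _) = (fun n => diff_quot (fun q => 'd f q h) v k n p))//.
apply/funext => n; have [||_ ->//] := @diff_quot_diff _ f p v h k n.
  by apply: df; rewrite subrr nrm0.
apply: df; rewrite addrAC subrr add0r nrmZ nrm_ofR gtr0_norm ?divr_gt0//.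
have : k / n.+1%:R * nrm v <= k * nrm v.
  by rewrite ler_wpM2r ?nrm_ge0// ler_pdivrMr// ler_peMr ?ler1n// ltW.
move: (k / n.+1%:R * nrm v) (k * nrm v) (k0v _ kp kk0) => x1 x2 kv.
clear -kv rho0 r0 r1; lra.
Qed.

Lemma diff_quot_cvg V (f : V -> cplx R) (p v : V) (k : R) : 0 < k ->
  differentiable f p ->
  (fun n => diff_quot f v k n p) @ \oo --> ('d f p v : cplx R).
Proof.
move=> k0 df; apply: cvg_nrm_le => e e0.
have nv : 0 < nrm v + 1 by rewrite ltr_wpDl// nrm_ge0.
have e'0 : 0 < e / (nrm v + 1) by rewrite divr_gt0.
have [d d0 Hd] := diff_nrm df e'0.
have d20 : 0 < d / 2 by rewrite divr_gt0.
have kv0 : 0 <= k * nrm v by rewrite mulr_ge0 ?nrm_ge0 ?ltW.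
have [N HN] := ex_small_inv kv0 d20; exists N => // n /= hn.
set c := k / n.+1%:R; have c0 : 0 < c by rewrite divr_gt0.
have z0 : ofR c != 0 :> cplx R by rewrite ofR_eq0 gt_eqF.
have := Hd (ofR c *: v); rewrite nrmZ nrm_ofR gtr0_norm//.
have cd : c * nrm v < d.
  have := HN n hn; rewrite mulrAC -/c; move: (c * nrm v) => x; clear -d0; lra.
move=> /(_ cd); rewrite linearZ => Hc.
rewrite /diff_quot -/c.
set X := f _ - _ in Hc *; set Y := 'd f p v in Hc *.
have -> : X / ofR c - Y = (X - ofR c *: Y) / ofR c.
  by rewrite /GRing.scale/=; field.
rewrite nrmM nrmV nrm_ofR gtr0_norm// ler_pdivrMr// (le_trans Hc)//.
rewrite mulrCA mulrC ler_wpM2r ?(ltW c0)//.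
by rewrite mulrAC ler_pdivrMr// ler_wpM2l ?(ltW e0)// lerDl.
Qed.

(** The difference quotients in direction [v] of the derivative along [w] converge to both sides. *)
Lemma directional_comm V (f : V -> cplx R) (p v w : V) (rho : R) : 0 < rho ->
  (forall q, nrm (q - p) < rho -> differentiable f q) ->
  'd (fun q => 'd f q v : cplx R) p w = 'd (fun q => 'd f q w : cplx R) p v.
Proof.
move=> rho0 df.
have [dv [k0 k00 H]] := directional_diff v rho0 df.
have [dw _] := directional_diff w rho0 df.
have C1 := H k0 k00 (lexx _) w.
exact: (cvg_nrm_unique C1 (diff_quot_cvg k00 dw)).
Qed.

(* No hypothesis on the derivative is needed: the second order Cauchy estimate
   bounds the remainder of [F ^~ t] by a multiple of [m t]. *)
Lemma param_integral_diff V (F : V -> R -> cplx R) (D : set (measurableTypeR R))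
    (p : V) (rho : R) (m : R -> R) :
  0 < rho -> measurable D -> mu.-integrable D (EFin \o m) ->
  (forall q, nrm (q - p) < rho -> cmeasurable D (F q)) ->
  (forall t q, D t -> nrm (q - p) < rho -> differentiable (F ^~ t) q) ->
  (forall t q, D t -> nrm (q - p) < rho -> nrm (F q t) <= m t) ->
  [/\ differentiable (fun q => integralC D (F q)) p,
      forall h, cintegrable D (fun t => 'd (F ^~ t) p h) &
      forall h, 'd (fun q => integralC D (F q)) p h =
        integralC D (fun t => 'd (F ^~ t) p h)].
Proof.
move=> rho0 mD im mF dF Fm.
have pp : nrm (p - p) < rho by rewrite subrr nrm0.
have iF q : nrm (q - p) < rho -> cintegrable D (F q).
  by move=> qp; apply: (cintegrable_dominated mD (mF q qp) im) => t Dt; exact: Fm.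
have imZ (c : R) : mu.-integrable D (EFin \o (fun t => c * m t)).
  exact: integrable_mull.
have bD h t : D t -> nrm ('d (F ^~ t) p h) <= 12 * (nrm h / rho) * m t.
  move=> Dt; rewrite mulrAC.
  by apply: first_order_bound => // q qp; [exact: dF|exact: Fm].
have iD h : cintegrable D (fun t => 'd (F ^~ t) p h).
  apply: (cintegrable_dominated mD _ (imZ _) (bD h)).
  pose k : R := rho / 4 / (nrm h + 1).
  have nh : 0 < nrm h + 1 by rewrite ltr_wpDl// nrm_ge0.
  have k0 : 0 < k by rewrite !divr_gt0.
  have kh : k * nrm h <= rho / 4.
    rewrite /k mulrAC ler_pdivrMr// ler_wpM2l ?lerDl//; lra.
  have khn n : k / n.+1%:R * nrm h <= k * nrm h.
    by rewrite ler_wpM2r ?nrm_ge0// ler_pdivrMr// ler_peMr ?ler1n// ltW.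
  (* The derivative is measurable in [t] as a pointwise limit of difference quotients, whose points
     [k] keeps in the ball. *)
  apply: (cmeasurable_cvg (f_ := fun n t => diff_quot (F ^~ t) h k n p)) => //.
    move=> n; apply: cmeasurableM; last exact: cmeasurable_cst.
    apply: cmeasurableB; apply: mF => //.
    rewrite addrAC subrr add0r nrmZ nrm_ofR gtr0_norm ?divr_gt0//.
    move: (khn n) kh; move: (k / n.+1%:R * nrm h) (k * nrm h) => x1 x2.
    clear -rho0; lra.
  by move=> t Dt; apply: diff_quot_cvg => //; exact: dF.
pose L h := integralC D (fun t => 'd (F ^~ t) p h).
set I := (\int[mu]_(t in D) m t).
have linL : linear L.
  move=> a0 u v; set a : cplx R := a0.
  transitivity (integralC D (fun t => a * ('d (F ^~ t) p u : cplx R) + 'd (F ^~ t) p v)).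
    by apply: eq_integralC => t _; exact: linearP.
  have iZ : cintegrable D (fun t => a * ('d (F ^~ t) p u : cplx R)) by exact: cintegrableZ.
  by rewrite integralCD// integralCZ.
have LC h : nrm (L h) <= 24 / rho * I * nrm h.
  have := integralC_bound mD (iD h) (imZ _) (bD h).
  rewrite RintegralZl// -/I => /le_trans; apply.
  by rewrite le_eqVlt; apply/orP; left; apply/eqP; field; rewrite gt_eqF.
suff [df dL] : differentiable (fun q => integralC D (F q)) p /\
    'd (fun q => integralC D (F q)) p = L :> (V -> cplx R).
  split; [exact: df|exact: iD|move=> h].
  exact: (congr1 (fun k : V -> cplx R => k h) dL).
have I0 : 0 <= I.
  apply: Rintegral_ge0 => t Dt; apply: le_trans (Fm t p Dt pp); exact: nrm_ge0.
apply: (diff_intro linL LC) => e e0.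
(* 32 is 2 from the componentwise bound times 16 from the second-order estimate; the added 1 makes
   [K] positive when the integral is 0. *)
pose K : R := 32 * I / rho ^+ 2 + 1.
have K0 : 0 < K by rewrite ltr_wpDl// divr_ge0 ?sqr_ge0// mulr_ge0.
exists (Num.min (rho / 4) (e / K)); first by rewrite lt_min !divr_gt0.
move=> h; rewrite lt_min => /andP[h1 h2].
have hp : nrm (p + h - p) < rho by rewrite addrAC subrr add0r; lra.
rewrite /L -integralCB//; try exact: iF.
rewrite -integralCB//; last by apply: cintegrableB => //; exact: iF.
have bR t : D t -> nrm (F (p + h) t - F p t - 'd (F ^~ t) p h) <=
    16 * (nrm h / rho) ^+ 2 * m t.
  move=> Dt; rewrite mulrAC.
  by apply: (second_order_bound (f := F ^~ t)) (ltW h1) => // q qp; [exact: dF|exact: Fm].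
have iR : cintegrable D (fun t => F (p + h) t - F p t - 'd (F ^~ t) p h).
  by apply: cintegrableB => //; apply: cintegrableB => //; exact: iF.
have := integralC_bound mD iR (imZ _) bR.
rewrite RintegralZl// -/I => /le_trans; apply.
have -> : 2 * (16 * (nrm h / rho) ^+ 2 * I) = (K - 1) * nrm h * nrm h.
  by rewrite /K; field; rewrite gt_eqF.
rewrite ler_wpM2r ?nrm_ge0//.
rewrite ltr_pdivlMr// in h2; have := nrm_ge0 h; nra.
Qed.

End Weierstrass.

(** * The identity theorem *)
Section Identity.
Context {R : realType}.
Implicit Types (phi f g : cplx R -> cplx R) (z w a c : cplx R).

Lemma near_eq_lim_at (T : Type) (F : set_system T) (FF : Filter F)
    (u v : T -> cplx R) : (\forall x \near F, u x = v x) -> lim (u @ F) = lim (v @ F).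
Proof.
move=> uv; congr (lim _); apply/funext => A; apply/propext; split => H.
  by apply: filterS2 uv H => x; rewrite /= => ->.
by apply: filterS2 uv H => x; rewrite /= => ->.
Qed.

Lemma near_eq_derive1 f g z : (\forall w \near z, f w = g w) ->
  derive1 f z = derive1 g z.
Proof.
move=> fg; rewrite /derive1; apply: near_eq_lim_at.
have [d d0 Hd] := (nbhs_nrm _ _).1 fg.
apply: nbhs_dnbhs; apply/nbhs_nrm; exists d => // h; rewrite subr0 => hd.
by rewrite (Hd (h + z)) ?addrK// (Hd z)// subrr nrm0.
Qed.

Definition disc c (r : R) : set (cplx R) := [set z | nrm (z - c) < r].

Lemma disc_nbhs c r z : disc c r z -> \forall w \near z, disc c r w.
Proof.
rewrite /disc/= => zr; apply/nbhs_nrm; exists (r - nrm (z - c)); first by rewrite subr_gt0.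
by move=> q qz; rewrite /disc/= (le_lt_trans (nrm_dist z _ _))// -ltrBrDr.
Qed.

Lemma disc_derive1 f c r : (forall z, disc c r z -> differentiable f z) ->
  forall z, disc c r z -> differentiable (derive1 f) z.
Proof.
move=> df z zr; have [d d0 Hd] := (nbhs_nrm _ _).1 (disc_nbhs zr).
have [H _] := directional_diff (1 : cplx R) d0 (fun q qz => df q (Hd q qz)).
apply: near_differentiable H; apply: filterS (disc_nbhs zr) => w wr.
by rewrite (diffE1 _ (df _ wr)) mul1r.
Qed.

Lemma derive1_shift f a z : derive1 (fun w => f (a + w)) z = derive1 f (a + z).
Proof.
rewrite /derive1; set u := (X in X @ _); set v := (X in _ = lim (X @ _)).
suff -> : u = v by [].
by apply/funext => h; rewrite /u /v addrCA.
Qed.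

Lemma iter_derive1_shift f a n :
  iter n (@derive1 _ _) (fun w => f (a + w)) = fun z => iter n (@derive1 _ _) f (a + z).
Proof.
elim: n => [//|n IH]; rewrite iterS IH; apply/funext => z.
by rewrite derive1_shift.
Qed.

(** Along the circle, phi(z) / z^(n+1) has t-derivative i (phi'(z) / z^n - (n + 1) phi(z) /
    z^(n+1)), which integrates to 0 over a period. *)
Lemma Taylor_coef_derive1 phi r0 r n :
  (forall z, nrm z < r0 -> differentiable phi z) -> 0 < r -> r < r0 ->
  Taylor_coef (derive1 phi) r n = n.+1%:R * Taylor_coef phi r n.+1.
Proof.
move=> dphi rgt0 rr0.
have dphi' z : nrm z < r0 -> differentiable (derive1 phi) z.
  move=> zr; apply: (@disc_derive1 _ 0 r0); last by rewrite /disc/= subr0.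
  by move=> w; rewrite /disc/= subr0; exact: dphi.
have inr t : nrm (circ r t) < r0 by rewrite nrm_circ// ltW.
have z0 t : circ r t != 0 by rewrite -nrm_gt0 nrm_circ// ltW.
have dV k t : differentiable (fun z => (z ^+ k)^-1) (circ r t).
  by apply: dif_inv; [apply: dif_exp; exact: dif_id|rewrite expf_neq0].
have d1 t : differentiable (fun z => derive1 phi z / z ^+ n) (circ r t).
  by apply: dif_mul; [exact: dphi'|exact: dV].
have d2 t : differentiable (fun z => phi z / z ^+ n.+1) (circ r t).
  by apply: dif_mul; [exact: dphi|exact: dV].
have E t : derive1 (fun z => phi z / z ^+ n.+1) (circ r t) * (iC * circ r t) =
    iC * (derive1 phi (circ r t) / circ r t ^+ n - n.+1%:R * (phi (circ r t) / circ r t ^+ n.+1)).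
  rewrite (derive1_mul (dphi _ (inr t)) (dV n.+1 t)).
  rewrite (derive1_inv (dif_exp _ (dif_id _))) ?expf_neq0//.
  rewrite (derive1_exp _ (dif_id _)) derive1_idc /=.
  have := z0 t; move: (circ r t) (derive1 phi _) (phi _) => z p1 p0 zn.
  by rewrite !exprS; field; rewrite zn expf_neq0.
have P0 : 0 <= @twopi R by apply/ltW/twopi_gt0.
have i1 : cintegrable `[0, twopi] (fun t => derive1 phi (circ r t) / circ r t ^+ n).
  exact/ccont_integrable/(diff_circ_cont d1).
have i2 : cintegrable `[0, twopi] (fun t => phi (circ r t) / circ r t ^+ n.+1).
  exact/ccont_integrable/(diff_circ_cont d2).
have cd t : cder (fun t => phi (circ r t) / circ r t ^+ n.+1) t
    (iC * (derive1 phi (circ r t) / circ r t ^+ n - n.+1%:R * (phi (circ r t) / circ r t ^+ n.+1))).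
  by rewrite -E; exact: (cder_comp (d2 t) (cder_circ r t)).
have := @integralC_FTC _ 0 twopi _ _ P0 (fun t _ => cd t).
rewrite (_ : circ r twopi = circ r 0); last first.
  by rewrite /circ -[iC * ofR twopi]add0r expC_2pi mulr0.
rewrite subrr => H.
have {H} : iC * (circle_int (fun z => derive1 phi z / z ^+ n) r -
   n.+1%:R * circle_int (fun z => phi z / z ^+ n.+1) r) = 0.
  rewrite /circle_int -integralCZ// -integralCB//; last exact: cintegrableZ.
  rewrite -integralCZ//; last by apply: cintegrableB => //; exact: cintegrableZ.
  apply: H => t _.
  have c0 (k : cplx R) : {for t, continuous (fun _ : R => k)} by exact: cvg_cst.
  have c1 := cder_continuous (cder_comp (d1 t) (cder_circ r t)).
  have c2 := cder_continuous (cder_comp (d2 t) (cder_circ r t)).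
  exact: (continuous_mul (c0 iC) (cvgB c1 (continuous_mul (c0 n.+1%:R) c2))).
move/eqP; rewrite mulf_eq0 => /orP[/eqP i0|].
  by have := @nrm_iC R; rewrite i0 nrm0 => /eqP; rewrite eq_sym oner_eq0.
by rewrite subr_eq0 /Taylor_coef => /eqP ->; rewrite mulrA.
Qed.

Lemma Taylor_coefE phi r0 r n :
  (forall z, nrm z < r0 -> differentiable phi z) -> 0 < r -> r < r0 ->
  n`!%:R * Taylor_coef phi r n = iter n (@derive1 _ _) phi 0.
Proof.
move=> dphi rgt0 rr0; elim: n phi dphi => [|n IH] phi dphi.
  by rewrite mul1r (Taylor_coef0 dphi).
rewrite iterSr -IH; last first.
  move=> z zr; apply: (@disc_derive1 _ 0 r0); last by rewrite /disc/= subr0.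
  by move=> w; rewrite /disc/= subr0; exact: dphi.
by rewrite (Taylor_coef_derive1 n dphi rgt0 rr0) factS natrM; ring.
Qed.

(** With all Taylor coefficients zero, the remainder bound is a bound on [phi a] itself, and it
    decays geometrically. *)
Lemma identity0 phi r0 : (forall z, nrm z < r0 -> differentiable phi z) ->
  (forall n, iter n (@derive1 _ _) phi 0 = 0) ->
  forall z, nrm z < r0 -> phi z = 0.
Proof.
move=> dphi H a ar0.
pose r : R := (nrm a + r0) / 2.
have ar : nrm a < r by rewrite /r; lra.
have rr0 : r < r0 by rewrite /r; lra.
have rgt0 : 0 < r := le_lt_trans (nrm_ge0 a) ar.
have c : {within `[0, twopi], continuous (fun t => nrm (phi (circ r t)))}.
  apply: continuous_in_subspaceT => t _; apply: continuous_nrm.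
  apply: cder_continuous; apply: cder_comp; last exact: cder_circ.
  by apply: dphi; rewrite nrm_circ// ltW.
have [t0 _ tM] := EVT_max (ltW (@twopi_gt0 R)) c.
set M := nrm (phi _) in tM.
have est n : nrm (phi a) <= 2 * M * ((nrm a / r) ^+ n * (r / (r - nrm a))).
  have := Taylor_remainder n dphi ar rr0 tM.
  rewrite big1 ?subr0// => k _.
  have := Taylor_coefE k dphi rgt0 rr0; rewrite H => /eqP.
  rewrite mulf_eq0 -[X in X == 0]ofR_nat ofR_eq0 pnatr_eq0.
  by rewrite -leqn0 leqNgt fact_gt0/= => /eqP ->; rewrite mul0r.
apply/eqP; rewrite -nrm_eq0 eq_le nrm_ge0 andbT.
have q1 : `|nrm a / r| < 1.
  have h : 0 <= nrm a / r by rewrite divr_ge0 ?nrm_ge0// ltW.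
  by rewrite (ger0_norm h) ltr_pdivrMr// mul1r.
apply: (cvgr_to_ge (F := \oo) (f := fun n => 2 * M * ((nrm a / r) ^+ n * (r / (r - nrm a))))).
  rewrite -(mulr0 (2 * M)) -(mul0r (r / (r - nrm a))).
  apply: cvgM; first exact: cvg_cst.
  by apply: cvgM; [exact: cvg_expr|exact: cvg_cst].
by near=> n; exact: est.
Unshelve. all: by end_near. Qed.

Lemma disc_identity phi c r : (forall z, disc c r z -> differentiable phi z) ->
  (forall n, iter n (@derive1 _ _) phi c = 0) ->
  forall z, disc c r z -> phi z = 0.
Proof.
move=> dphi H z zr.
have E : (fun w => phi (c + w)) (z - c) = 0; last by move: E; rewrite /= addrC subrK.
apply: (@identity0 (fun w => phi (c + w)) r _ _ (z - c) zr) => [w wr|n].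
  have dw : differentiable phi (c + w) by apply: dphi; rewrite /disc/= addrAC subrr add0r.
  have ds : differentiable (fun w : cplx R => c + w) w.
    by apply: dif_add; [exact: dif_cst|exact: dif_id].
  exact: (differentiable_comp ds dw).
by rewrite iter_derive1_shift addr0.
Qed.

Lemma near_eq_iter_derive1 f g z n : (\forall w \near z, f w = g w) ->
  \forall w \near z, iter n (@derive1 _ _) f w = iter n (@derive1 _ _) g w.
Proof.
elim: n => [//|n IH] /IH/near_join; apply: filterS => w.
exact: near_eq_derive1.
Qed.

Lemma iter_derive1_zero n z : iter n (@derive1 _ _) (fun _ : cplx R => 0 : cplx R) z = 0.
Proof.
elim: n z => [//|n IH] z; rewrite iterS (_ : iter n _ _ = fun=> 0) ?derive1_const//.
exact/funext.
Qed.

(** The discs of centre x + i t and radius t exhaust the half-plane as t grows. The centre at height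
    3 t / 2 lies in the disc at height t, so the vanishing of all derivatives propagates upwards. *)
Lemma halfplane_identity phi w : halfplane w ->
  (forall z, halfplane z -> differentiable phi z) ->
  (forall n, iter n (@derive1 _ _) phi w = 0) ->
  forall z, halfplane z -> phi z = 0.
Proof.
rewrite /halfplane/= => wh dphi H.
pose x : R := reC w; pose y : R := imC w.
have sub (t : R) z : disc (cpt x t) t z -> 0 < imC z.
  rewrite /disc/= => h; have := le_lt_trans (imC_le_nrm _) h.
  by rewrite imC_B imC_cpt ltr_norml; lra.
pose P (t : R) := forall n, iter n (@derive1 _ _) phi (cpt x t) = 0.
have Py : P y by rewrite /P cpt_reim.
have PD (t : R) : P t -> forall z, disc (cpt x t) t z -> phi z = 0.
  by move=> Pt; apply: disc_identity Pt => z /sub; exact: dphi.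
have step (t : R) : 0 < t -> P t -> P (t * (3 / 2)).
  move=> t0 Pt n; set c := cpt x _.
  have cd : disc (cpt x t) t c.
    rewrite /disc/= (le_lt_trans (nrm_le_reim _))// reC_B imC_B !reC_cpt !imC_cpt.
    by rewrite subrr normr0 add0r gtr0_norm; lra.
  have E : \forall z \near c, phi z = 0.
    by apply: filterS (disc_nbhs cd); exact: PD.
  have := nbhs_singleton (near_eq_iter_derive1 n E).
  by rewrite iter_derive1_zero.
have Pn k : P (y * (3 / 2) ^+ k).
  elim: k => [|k IH]; first by rewrite expr0 mulr1.
  have t0 : 0 < y * (3 / 2) ^+ k by rewrite mulr_gt0// exprn_gt0//; lra.
  by rewrite exprSr (mulrA y); exact: (step _ t0 IH).
move=> z zh.
(* A point z is in the disc at height t exactly when |z - x|^2 < 2 t Im z; Bernoulli's inequality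
   for 3/2 provides a sufficient power. *)
have [k kP] : exists k, (nrm (z - cpt x 0)) ^+ 2 < 2 * imC z * (y * (3 / 2) ^+ k).
  pose a : R := (nrm (z - cpt x 0)) ^+ 2 / (2 * imC z * y).
  have g k : 1 + k%:R * (1 / 2) <= (3 / 2 : R) ^+ k.
    elim: k => [|k IH]; first by rewrite mul0r addr0 expr0.
    rewrite exprSr -natr1; have : 0 <= k%:R :> R by []. nra.
  have a0 : 0 <= a by rewrite divr_ge0 ?sqr_ge0// !mulr_ge0 ?ltW.
  exists (Num.truncn (2 * a)).+1.
  have ta : 2 * a < (Num.truncn (2 * a)).+1%:R by rewrite truncnS_gt.
  have := g (Num.truncn (2 * a)).+1.
  set X := (3 / 2) ^+ _ => gX.
  have aX : a < X by lra.
  have q0 : 0 < 2 * imC z * y by rewrite !mulr_gt0.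
  by move: aX; rewrite /a ltr_pdivrMr// => h; rewrite (lt_le_trans h)// le_eqVlt; apply/orP; left; apply/eqP; ring.
apply: (PD _ (Pn k)); move: kP; set t := y * _ => kP.
have t0 : 0 < t by rewrite mulr_gt0// exprn_gt0//; lra.
rewrite /disc/= -(@ltr_pXn2r _ 2)// ?nnegrE ?nrm_ge0 ?(ltW t0)//.
move: kP; rewrite !nrm_sqr !reC_B !imC_B !reC_cpt !imC_cpt; nra.
Qed.

End Identity.

(** * Order of vanishing along the diagonal *)
Section TwoVariables.
Context {R : realType}.
Notation C2 := (cplx R * cplx R)%type.
Implicit Types (f g V : C2 -> cplx R) (p q : C2) (z w : cplx R).
Notation Pi2 := (@halfplane2 R).

Definition hol2 f := forall p, Pi2 p -> differentiable f p.

Lemma halfplane2_ball p : Pi2 p ->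
  exists2 d : R, 0 < d & forall q, nrm (q - p) < d -> Pi2 q.
Proof.
case: p => [p1 p2] [/= h1 h2]; exists (Num.min (imC p1) (imC p2)).
  by rewrite lt_min; apply/andP; split.
case=> [q1 q2] h; have := h.
rewrite (_ : (q1, q2) - (p1, p2) = (q1 - p1, q2 - p2))// nrm_pair gt_max.
rewrite !lt_min => /andP[/andP[a1 _] /andP[_ a2]].
have b1 := le_lt_trans (imC_le_nrm _) a1.
have b2 := le_lt_trans (imC_le_nrm _) a2.
move: b1 b2; rewrite !imC_B !ltr_norml => /andP[b1 _] /andP[b2 _].
by split; rewrite /halfplane/=; move: h1 h2; rewrite /halfplane/= => h1 h2; lra.
Qed.

Lemma halfplane2_near p : Pi2 p -> \forall q \near p, Pi2 q.
Proof. by move=> /halfplane2_ball[d d0 H]; apply/nbhs_nrm; exists d. Qed.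

Let e1 : C2 := (1, 0).
Let e2 : C2 := (0, 1).

Lemma partial1E f p : differentiable f p -> partial1 f p = 'd f p e1.
Proof.
case: p => [p1 p2] df.
have E z : (0, p2) + z *: e1 = (z, p2) :> C2.
  by congr pair; rewrite /= /GRing.scale/= ?mulr1 ?mulr0 ?add0r ?addr0.
have df' : differentiable f ((0, p2) + p1 *: e1) by rewrite E.
have [_ D] := derive1_line df'.
have E' : (fun z : cplx R => f ((0, p2) + z *: e1)) = (fun z => f (z, p2)).
  by apply/funext => z; rewrite E.
by rewrite E' E in D; exact: D.
Qed.

Lemma partial2E f p : differentiable f p -> partial2 f p = 'd f p e2.
Proof.
case: p => [p1 p2] df.
have E z : (p1, 0) + z *: e2 = (p1, z) :> C2.
  by congr pair; rewrite /= /GRing.scale/= ?mulr1 ?mulr0 ?add0r ?addr0.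
have df' : differentiable f ((p1, 0) + p2 *: e2) by rewrite E.
have [_ D] := derive1_line df'.
have E' : (fun z : cplx R => f ((p1, 0) + z *: e2)) = (fun z => f (p1, z)).
  by apply/funext => z; rewrite E.
by rewrite E' E in D; exact: D.
Qed.

Lemma dif_slice1 f z w : differentiable f (z, w) ->
  differentiable (fun x => f (x, w)) z.
Proof.
move=> df.
have E x : (0, w) + x *: e1 = (x, w) :> C2.
  by congr pair; rewrite /= /GRing.scale/= ?mulr1 ?mulr0 ?add0r ?addr0.
have df' : differentiable f ((0, w) + z *: e1) by rewrite E.
have [+ _] := derive1_line df'; congr (differentiable _ _).
by apply/funext => x; rewrite E.
Qed.

Lemma dif_slice2 f z w : differentiable f (z, w) ->
  differentiable (fun x => f (z, x)) w.
Proof.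
move=> df.
have E x : (z, 0) + x *: e2 = (z, x) :> C2.
  by congr pair; rewrite /= /GRing.scale/= ?mulr1 ?mulr0 ?add0r ?addr0.
have df' : differentiable f ((z, 0) + w *: e2) by rewrite E.
have [+ _] := derive1_line df'; congr (differentiable _ _).
by apply/funext => x; rewrite E.
Qed.

Lemma hol2_partial1 f : hol2 f -> hol2 (partial1 f).
Proof.
move=> hf p hp; have [d d0 Hd] := halfplane2_ball hp.
have [H _] := directional_diff e1 d0 (fun q qz => hf q (Hd q qz)).
apply: near_differentiable H; apply: filterS (halfplane2_near hp) => q hq.
by rewrite (partial1E (hf q hq)).
Qed.

Lemma hol2_partial2 f : hol2 f -> hol2 (partial2 f).
Proof.
move=> hf p hp; have [d d0 Hd] := halfplane2_ball hp.
have [H _] := directional_diff e2 d0 (fun q qz => hf q (Hd q qz)).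
apply: near_differentiable H; apply: filterS (halfplane2_near hp) => q hq.
by rewrite (partial2E (hf q hq)).
Qed.

Lemma hol2_iter1 f n : hol2 f -> hol2 (iter n partial1 f).
Proof. by move=> hf; elim: n => [|n IH]; [exact: hf|exact: (hol2_partial1 IH)]. Qed.

Lemma hol2_iter2 f n : hol2 f -> hol2 (iter n partial2 f).
Proof. by move=> hf; elim: n => [|n IH]; [exact: hf|exact: (hol2_partial2 IH)]. Qed.

Lemma slice1_near p : Pi2 p -> \forall z \near p.1, Pi2 (z, p.2).
Proof.
case: p => [p1 p2] /halfplane2_ball[d d0 Hd]; apply/nbhs_nrm; exists d => // z hz.
apply: Hd; rewrite (_ : _ - _ = (z - p1, p2 - p2))// nrm_pair subrr nrm0.
by rewrite gt_max d0 andbT.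
Qed.

Lemma slice2_near p : Pi2 p -> \forall z \near p.2, Pi2 (p.1, z).
Proof.
case: p => [p1 p2] /halfplane2_ball[d d0 Hd]; apply/nbhs_nrm; exists d => // z hz.
apply: Hd; rewrite (_ : _ - _ = (p1 - p1, z - p2))// nrm_pair subrr nrm0.
by rewrite gt_max d0.
Qed.

Definition eq_on f g := forall p, Pi2 p -> f p = g p.

Lemma eq_on_partial1 f g : eq_on f g -> eq_on (partial1 f) (partial1 g).
Proof.
move=> fg p hp; apply: near_eq_derive1; apply: filterS (slice1_near hp) => z.
exact: fg.
Qed.

Lemma eq_on_partial2 f g : eq_on f g -> eq_on (partial2 f) (partial2 g).
Proof.
move=> fg p hp; apply: near_eq_derive1; apply: filterS (slice2_near hp) => z.
exact: fg.
Qed.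

Lemma eq_on_iter1 f g n : eq_on f g -> eq_on (iter n partial1 f) (iter n partial1 g).
Proof. by move=> fg; elim: n => [|n IH]; [exact: fg|exact: (eq_on_partial1 IH)]. Qed.

Lemma eq_on_hol2 f g : eq_on f g -> hol2 f -> hol2 g.
Proof.
move=> fg hf p hp; apply: near_differentiable (hf p hp).
by apply: filterS (halfplane2_near hp) => q; exact: fg.
Qed.

Lemma eq_on_sym f g : eq_on f g -> eq_on g f.
Proof. by move=> fg p hp; rewrite fg. Qed.

Lemma eq_on_trans f g h : eq_on f g -> eq_on g h -> eq_on f h.
Proof. by move=> fg gh p hp; rewrite fg// gh. Qed.

Lemma partial_comm f : hol2 f ->
  eq_on (partial1 (partial2 f)) (partial2 (partial1 f)).
Proof.
move=> hf p hp; have [d d0 Hd] := halfplane2_ball hp.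
have dir q : nrm (q - p) < d -> differentiable f q by move=> /Hd/hf.
pose h1 q : cplx R := 'd f q e1; pose h2 q : cplx R := 'd f q e2.
have E1 : eq_on (partial1 f) h1 by move=> q hq; exact: (partial1E (hf q hq)).
have E2 : eq_on (partial2 f) h2 by move=> q hq; exact: (partial2E (hf q hq)).
have d1 := eq_on_hol2 E1 (hol2_partial1 hf).
have d2 := eq_on_hol2 E2 (hol2_partial2 hf).
rewrite (eq_on_partial1 E2 hp) (eq_on_partial2 E1 hp).
rewrite (partial1E (d2 p hp)) (partial2E (d1 p hp)).
exact: (directional_comm e2 e1 d0 dir).
Qed.

Lemma iter_partial_comm f i j : hol2 f ->
  eq_on (iter i partial1 (iter j.+1 partial2 f))
        (partial2 (iter i partial1 (iter j partial2 f))).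
Proof.
move=> hf; have hj := hol2_iter2 j hf.
elim: i => [//|i IH]; apply: eq_on_trans (eq_on_partial1 IH) _.
exact/partial_comm/hol2_iter1.
Qed.

Lemma diag_derivative f : hol2 f -> (forall w, halfplane w -> f (w, w) = 0) ->
  forall w, halfplane w -> partial2 f (w, w) = - partial1 f (w, w).
Proof.
move=> hf f0 w hw; have hp : Pi2 (w, w) by split.
have dfw := hf _ hp.
pose e : C2 := (1, 1).
have E z : 0 + z *: e = (z, z) :> C2.
  by congr pair; rewrite /= /GRing.scale/= mulr1 add0r.
have df' : differentiable f (0 + w *: e) by rewrite E.
have [_] := derive1_line df'.
rewrite (@near_eq_derive1 _ _ (fun=> 0)); last first.
  have : \forall z \near w, Pi2 (z, z).
    have [d d0 Hd] := halfplane2_ball hp; apply/nbhs_nrm; exists d => // z hz.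
    by apply: Hd; rewrite (_ : _ - _ = (z - w, z - w))// nrm_pair gt_max hz.
  by apply: filterS => z [hz _]; rewrite E f0.
rewrite derive1_const E (partial1E dfw) (partial2E dfw).
have -> : e = e1 + e2 by congr pair; rewrite /= ?addr0 ?add0r.
rewrite linearD => /eqP; rewrite eq_sym addrC.
by rewrite addr_eq0 => /eqP.
Qed.

Definition diagX p : cplx R := p.1 - p.2.

Lemma dif_fst p : differentiable (fun q : C2 => q.1) p.
Proof.
have H : is_diff p (fun q : C2 => q.1) (fun q : C2 => q.1).
  apply: (@is_diff_intro _ _ _ _ _ _ 1) => [a u v//|h|e e0].
    by case: h => h1 h2; rewrite mul1r nrm_pair le_max lexx.
  exists 1 => // h _; rewrite (_ : _ - _ = 0) ?nrm0 ?mulr_ge0 ?nrm_ge0 ?(ltW e0)//.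
  by rewrite /=; ring.
exact: ex_diff.
Qed.

Lemma dif_snd p : differentiable (fun q : C2 => q.2) p.
Proof.
have H : is_diff p (fun q : C2 => q.2) (fun q : C2 => q.2).
  apply: (@is_diff_intro _ _ _ _ _ _ 1) => [a u v//|h|e e0].
    by case: h => h1 h2; rewrite mul1r nrm_pair le_max lexx orbT.
  exists 1 => // h _; rewrite (_ : _ - _ = 0) ?nrm0 ?mulr_ge0 ?nrm_ge0 ?(ltW e0)//.
  by rewrite /=; ring.
exact: ex_diff.
Qed.

Lemma dif_diagX p : differentiable diagX p.
Proof. by apply: dif_sub; [exact: dif_fst|exact: dif_snd]. Qed.

Lemma partial1_mul f g p : differentiable f p -> differentiable g p ->
  partial1 (fun q => f q * g q) p = f p * partial1 g p + g p * partial1 f p.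
Proof.
case: p => [z w] df dg.
exact: (derive1_mul (dif_slice1 df) (dif_slice1 dg)).
Qed.

Lemma partial2_mul f g p : differentiable f p -> differentiable g p ->
  partial2 (fun q => f q * g q) p = f p * partial2 g p + g p * partial2 f p.
Proof.
case: p => [z w] df dg.
exact: (derive1_mul (dif_slice2 df) (dif_slice2 dg)).
Qed.

Lemma partial1_add f g p : differentiable f p -> differentiable g p ->
  partial1 (fun q => f q + g q) p = partial1 f p + partial1 g p.
Proof.
case: p => [z w] df dg.
exact: (derive1_add (dif_slice1 df) (dif_slice1 dg)).
Qed.

Lemma partial2_add f g p : differentiable f p -> differentiable g p ->
  partial2 (fun q => f q + g q) p = partial2 f p + partial2 g p.
Proof.
case: p => [z w] df dg.
exact: (derive1_add (dif_slice2 df) (dif_slice2 dg)).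
Qed.

Lemma partial1_cst c p : partial1 (fun=> c) p = 0.
Proof. exact: derive1_const. Qed.

Lemma partial2_cst c p : partial2 (fun=> c) p = 0.
Proof. exact: derive1_const. Qed.

Lemma partial1_scale c f p : differentiable f p ->
  partial1 (fun q => c * f q) p = c * partial1 f p.
Proof.
move=> df; rewrite (partial1_mul (dif_cst c p) df) partial1_cst.
by move: (partial1 f p) (f p) => x y; rewrite mulr0 addr0.
Qed.

Lemma partial2_scale c f p : differentiable f p ->
  partial2 (fun q => c * f q) p = c * partial2 f p.
Proof.
move=> df; rewrite (partial2_mul (dif_cst c p) df) partial2_cst.
by move: (partial2 f p) (f p) => x y; rewrite mulr0 addr0.
Qed.

Lemma partial1_diagX p : partial1 diagX p = 1.
Proof.
have E := @derive1_add _ (fun z : cplx R => z) (fun=> - p.2) p.1 (dif_id _) (dif_cst _ _).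
by rewrite derive1_idc derive1_const addr0 in E.
Qed.

Lemma partial2_diagX p : partial2 diagX p = -1.
Proof.
have E := @derive1_add _ (fun=> p.1) (fun z : cplx R => -1 * z) p.2 (dif_cst _ _)
  (dif_mul (dif_cst _ _) (dif_id _)).
rewrite (derive1_mul (dif_cst _ _) (dif_id _)) derive1_idc !derive1_const in E.
rewrite mulr0 addr0 add0r mulr1 in E.
have E3 : (fun z : cplx R => p.1 + -1 * z) = (fun z => diagX (p.1, z)).
  by apply/funext => z; rewrite /diagX mulN1r.
by rewrite E3 in E; exact: E.
Qed.

(** The first derivative of [diagX] is constant, so the Leibniz expansion stops after two terms. At
    k = 0 the index [k.-1] is harmless, its term being multiplied by 0. *)
Lemma Leibniz_diagX V k : hol2 V ->
  eq_on (iter k partial1 (fun p => diagX p * V p))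
        (fun p => diagX p * iter k partial1 V p + k%:R * iter k.-1 partial1 V p).
Proof.
move=> hV; elim: k => [|k IH] p hp; first by rewrite /= mul0r addr0.
rewrite iterS (eq_on_partial1 IH hp).
have dk := hol2_iter1 k hV hp; have dk1 := hol2_iter1 k.-1 hV hp.
rewrite (partial1_add (dif_mul (dif_diagX p) dk) (dif_mul (dif_cst _ p) dk1)).
rewrite (partial1_mul (dif_diagX p) dk) (partial1_scale _ dk1) partial1_diagX.
case: k {IH dk dk1} => [|k].
  rewrite iterS /=; move: (partial1 V p) (V p) (diagX p) => a b c.
  by rewrite mul0r addr0 mulr1 mul1r.
rewrite -[partial1 (iter k.+1 _ _) p]/(iter k.+2 partial1 V p).
rewrite -[partial1 (iter k.+1.-1 _ _) p]/(iter k.+1 partial1 V p).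
rewrite -[k.+2.-1]/k.+1 -[in RHS]natr1.
move: (iter k.+2 _ _ p) (iter k.+1 _ _ p) (diagX p) => a b c.
by ring.
Qed.

Lemma hol2_diagXM V : hol2 V -> hol2 (fun p => diagX p * V p).
Proof. by move=> hV p hp; apply: dif_mul; [exact: dif_diagX|exact: hV]. Qed.

Lemma Leibniz_diag V k w : hol2 V -> halfplane w ->
  iter k partial1 (fun p => diagX p * V p) (w, w) = k%:R * iter k.-1 partial1 V (w, w).
Proof.
move=> hV hw; rewrite Leibniz_diagX//.
by rewrite {1}/diagX subrr mul0r add0r.
Qed.

Lemma hol2_diagX_exp V l : hol2 V -> hol2 (fun p => diagX p ^+ l * V p).
Proof.
move=> hV p hp; apply: dif_mul; last exact: hV.
by apply: dif_exp; exact: dif_diagX.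
Qed.

Lemma diagX_expS V l : (fun p => diagX p ^+ l.+1 * V p) =
  (fun p => diagX p * (diagX p ^+ l * V p)).
Proof. by apply/funext => p; rewrite exprS mulrA. Qed.

Lemma diagX_exp_low V l k w : hol2 V -> halfplane w -> (k < l)%N ->
  iter k partial1 (fun p => diagX p ^+ l * V p) (w, w) = 0.
Proof.
move=> hV hw; elim: l k => [//|l IH] k kl.
have hl := hol2_diagX_exp l hV.
rewrite diagX_expS Leibniz_diag//; case: k kl => [|k] kl; first by rewrite mul0r.
by rewrite IH// mulr0.
Qed.

Lemma diagX_exp_order V l w : hol2 V -> halfplane w ->
  iter l partial1 (fun p => diagX p ^+ l * V p) (w, w) = l`!%:R * V (w, w).
Proof.
move=> hV hw; elim: l => [|l IH].
  by rewrite /= !expr0.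
have hl := hol2_diagX_exp l hV.
by rewrite diagX_expS Leibniz_diag// IH factS natrM mulrA.
Qed.

(** Vanishing to order [k] along the diagonal. Powers of [partial1] suffice, since [mixed_diag]
    recovers the mixed derivatives. *)
Definition diag_flat f k :=
  forall j, (j < k)%N -> forall w, halfplane w -> iter j partial1 f (w, w) = 0.

(** Derivatives of total order below [k] vanish on the diagonal, so one further [partial2] applied
    to them is there the opposite of [partial1]. *)
Lemma mixed_diag f k : hol2 f -> diag_flat f k ->
  forall j i w, (i + j <= k)%N -> halfplane w ->
  iter i partial1 (iter j partial2 f) (w, w) = (-1) ^+ j * iter (i + j) partial1 f (w, w).
Proof.
move=> hf ff; elim => [|j IH] i w ijk hw; first by rewrite expr0 mul1r addn0.
have hp : Pi2 (w, w) by split.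
rewrite iter_partial_comm// (@diag_derivative (iter i partial1 (iter j partial2 f)))//.
- rewrite -[partial1 _ _]/(iter i.+1 partial1 (iter j partial2 f) (w, w)).
  rewrite IH//; last by rewrite addSnnS.
  by rewrite addSnnS exprS mulN1r mulNr.
- exact/hol2_iter1/hol2_iter2.
move=> v hv; rewrite IH//; last by rewrite (leq_trans _ ijk)// addnS.
by rewrite ff ?mulr0// -addnS.
Qed.

Lemma iter_slice f w n :
  iter n (@derive1 _ _) (fun z => f (z, w)) = fun z => iter n partial1 f (z, w).
Proof. by elim: n => [//|n IH]; rewrite iterS IH. Qed.

Lemma diag_order f : hol2 f -> (exists2 p, Pi2 p & f p != 0) ->
  exists k, diag_flat f k /\ exists2 w, halfplane w & iter k partial1 f (w, w) != 0.
Proof.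
move=> hf [p hp fp].
pose P k := `[< exists2 w, halfplane w & iter k partial1 f (w, w) != 0 >].
have [k Pk] : exists k, P k.
  apply: contrapT => nP.
  have Z k w : halfplane w -> iter k partial1 f (w, w) = 0.
    move=> hw; apply: contrapT => /eqP nz; apply: nP; exists k.
    by apply/asboolP; exists w.
  case: p hp fp => z w [/= hz hw] /eqP; apply.
  apply: (@halfplane_identity _ (fun z => f (z, w)) w hw) => // [v hv|n].
    by apply: dif_slice1; exact: hf.
  by rewrite iter_slice Z.
have [m /asboolP Pm mmin] := ex_minnP (ex_intro _ k Pk).
exists m; split => // j jm w hw; apply: contrapT => /eqP nz.
suff : (m <= j)%N by rewrite leqNgt jm.
by apply: mmin; apply/asboolP; exists w.
Qed.

Lemma iter_pred (D : (C2 -> cplx R) -> C2 -> cplx R) f k p :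
  k%:R * iter k.-1 D (D f) p = k%:R * iter k D f p.
Proof. by case: k => [|k]; rewrite ?mul0r// -iterSr. Qed.

(** The letters stand for values on the diagonal: [a0] for d1^k f, [a1] and [a2] for d1^(k-1) of d1
    f and of d2 f, [au] for d1^(k-2) of d1 d2 f. The relations keep the factors [k] and [k.-1], so
    that they hold for k = 0 and k = 1 as well. *)
Lemma eigenvalue_algebra (l1 l2 mu au a1 a2 a0 : cplx R) k :
  k%:R * (k.-1%:R * au + -1 * (l2 * a1 + - l1 * a2)) = mu * a0 ->
  k.-1%:R * au = k.-1%:R * a2 -> k%:R * a1 = k%:R * a0 -> k%:R * a2 = k%:R * - a0 ->
  a0 != 0 -> mu = - k%:R * (l1 + l2 + k%:R - 1).
Proof.
case: k => [|k].
  rewrite !mul0r => /esym/eqP; rewrite mulf_eq0 => /orP[/eqP ->|/eqP ->].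
    by rewrite oppr0 mul0r.
  by rewrite eqxx.
have k0 : k.+1%:R != 0 :> cplx R by rewrite -ofR_nat ofR_eq0 pnatr_eq0.
move=> H /= E0 /(mulfI k0) E1 /(mulfI k0) E2 a00; apply: (mulIf a00).
by rewrite -H /= E0 E1 E2 -natr1; ring.
Qed.

Lemma order_eigenvalue (l1 l2 mu : cplx R) f k : hol2 f ->
  (forall p, Pi2 p -> opP l1 l2 f p = mu * f p) -> diag_flat f k ->
  (exists2 w, halfplane w & iter k partial1 f (w, w) != 0) ->
  mu = - k%:R * (l1 + l2 + k%:R - 1).
Proof.
move=> hf eqf ff [w hw nz]; have hp : Pi2 (w, w) by split.
have h1 := hol2_partial1 hf; have h2 := hol2_partial2 hf.
have h12 := hol2_partial1 h2.
pose u q := partial1 (partial2 f) q.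
pose v q := l2 * partial1 f q + - l1 * partial2 f q.
have hv : hol2 v.
  by move=> q hq; apply: dif_add; apply: dif_mul; [exact: dif_cst|exact: h1|exact: dif_cst|exact: h2].
pose A q := diagX q * u q.
have hA : hol2 A by exact: hol2_diagXM.
(* One factor x is taken out of the operator: the equation reads x B = mu f, and k derivatives on
   the diagonal leave k d1^(k-1) B on the left. *)
pose B q := A q + -1 * v q.
have hB : hol2 B.
  move=> q hq; apply: dif_add; first exact: hA.
  by apply: dif_mul; [exact: dif_cst|exact: hv].
have E : eq_on (fun q => diagX q * B q) (fun q => mu * f q).
  move=> q hq; rewrite -eqf// /opP /B /A /v /u -/(diagX q).
  move: (partial1 (partial2 f) q) (partial1 f q) (partial2 f q) (diagX q) => a b c x.
  by ring.
have := eq_on_iter1 k E hp; rewrite Leibniz_diag//.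
have Zmul c g n : hol2 g -> eq_on (iter n partial1 (fun q => c * g q)) (fun q => c * iter n partial1 g q).
  move=> hg; elim: n => [//|n IH] q hq.
  rewrite iterS (eq_on_partial1 IH hq) (partial1_scale c (hol2_iter1 n hg hq)).
  by [].
have Zadd g h n : hol2 g -> hol2 h -> eq_on (iter n partial1 (fun q => g q + h q)) (fun q => iter n partial1 g q + iter n partial1 h q).
  move=> hg hh; elim: n => [//|n IH] q hq.
  rewrite iterS (eq_on_partial1 IH hq) (partial1_add (hol2_iter1 n hg hq) (hol2_iter1 n hh hq)).
  by [].
have hl1 : hol2 (fun q => l2 * partial1 f q).
  by move=> q hq; apply: dif_mul; [exact: dif_cst|exact: h1].
have hl2 : hol2 (fun q => - l1 * partial2 f q).
  by move=> q hq; apply: dif_mul; [exact: dif_cst|exact: h2].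
have hv' : hol2 (fun q => -1 * v q).
  by move=> q hq; apply: dif_mul; [exact: dif_cst|exact: hv].
have EB : iter k.-1 partial1 B (w, w) = iter k.-1 partial1 A (w, w) +
    -1 * (l2 * iter k.-1 partial1 (partial1 f) (w, w) +
          - l1 * iter k.-1 partial1 (partial2 f) (w, w)).
  transitivity (iter k.-1 partial1 A (w, w) +
                iter k.-1 partial1 (fun q => -1 * v q) (w, w)).
    exact: (Zadd _ _ k.-1 hA hv' _ hp).
  congr (_ + _); transitivity (-1 * iter k.-1 partial1 v (w, w)).
    exact: (Zmul _ _ k.-1 hv _ hp).
  congr (_ * _); transitivity (iter k.-1 partial1 (fun q => l2 * partial1 f q) (w, w) +
      iter k.-1 partial1 (fun q => - l1 * partial2 f q) (w, w)).
    exact: (Zadd _ _ k.-1 hl1 hl2 _ hp).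
  congr (_ + _); first exact: (Zmul _ _ k.-1 h1 _ hp).
  exact: (Zmul _ _ k.-1 h2 _ hp).
have Ef : iter k partial1 (fun q => mu * f q) (w, w) = mu * iter k partial1 f (w, w).
  exact: (Zmul _ _ k hf _ hp).
have EA : iter k.-1 partial1 A (w, w) = k.-1%:R * iter k.-1.-1 partial1 u (w, w).
  exact: Leibniz_diag.
rewrite EB Ef EA {EB Ef EA} => H.
apply: (eigenvalue_algebra H _ _ _ nz).
- exact: (iter_pred partial1 (partial2 f) k.-1).
- exact: (iter_pred partial1 f k).
- case: (k) ff => [|m] ff; first by exact: (etrans (mul0r _) (esym (mul0r _))).
  congr (_ * _); have := mixed_diag hf ff (j := 1) (i := m) (w := w).
  by rewrite addn1 expr1 mulN1r; apply.
Qed.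

Lemma diagX_exp_eigen (a b : cplx R) (V : C2 -> cplx R) l : hol2 V ->
  (forall p, Pi2 p -> diagX p * partial1 (partial2 V) p =
      b * partial1 V p - a * partial2 V p) ->
  forall p, Pi2 p ->
  opP (a - l%:R) (b - l%:R) (fun q => diagX q ^+ l * V q) p =
  - l%:R * ((a - l%:R) + (b - l%:R) + l%:R - 1) * (diagX p ^+ l * V p).
Proof.
move=> hV EPD p hp.
have h1 := hol2_partial1 hV; have h2 := hol2_partial2 hV.
have dX q n : differentiable (fun q => diagX q ^+ n) q by apply: dif_exp; exact: dif_diagX.
have X1 n q : partial1 (fun q => diagX q ^+ n) q = n%:R * diagX q ^+ n.-1.
  elim: n => [|n IH]; first by rewrite mul0r (partial1_cst 1).
  have -> : (fun q => diagX q ^+ n.+1) = (fun q => diagX q * diagX q ^+ n).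
    by apply/funext => x; rewrite exprS.
  rewrite (partial1_mul (dif_diagX q) (dX q n)) IH partial1_diagX.
  by rewrite -natr1; case: n {IH} => [|n]; rewrite /= ?expr0 ?exprS; ring.
have X2 n q : partial2 (fun q => diagX q ^+ n) q = - n%:R * diagX q ^+ n.-1.
  elim: n => [|n IH]; first by rewrite oppr0 mul0r (partial2_cst 1).
  have -> : (fun q => diagX q ^+ n.+1) = (fun q => diagX q * diagX q ^+ n).
    by apply/funext => x; rewrite exprS.
  rewrite (partial2_mul (dif_diagX q) (dX q n)) IH partial2_diagX.
  by rewrite -natr1; case: n {IH} => [|n]; rewrite /= ?expr0 ?exprS; ring.
have P1 n W q : differentiable W q -> partial1 (fun q => diagX q ^+ n * W q) q =
    diagX q ^+ n * partial1 W q + W q * (n%:R * diagX q ^+ n.-1).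
  by move=> dW; rewrite (partial1_mul (dX q n) dW) X1.
have P2 n W q : differentiable W q -> partial2 (fun q => diagX q ^+ n * W q) q =
    diagX q ^+ n * partial2 W q + W q * (- n%:R * diagX q ^+ n.-1).
  by move=> dW; rewrite (partial2_mul (dX q n) dW) X2.
have E2 : eq_on (partial2 (fun q => diagX q ^+ l * V q))
    (fun q => diagX q ^+ l * partial2 V q + - l%:R * (diagX q ^+ l.-1 * V q)).
  move=> q hq; rewrite (P2 _ _ _ (hV q hq)).
  move: (partial2 V q) (V q) (diagX q ^+ l) (diagX q ^+ l.-1) => x1 x2 x3 x4.
  by ring.
have E12 : partial1 (partial2 (fun q => diagX q ^+ l * V q)) p =
   diagX p ^+ l * partial1 (partial2 V) p + partial2 V p * (l%:R * diagX p ^+ l.-1) +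
   - l%:R * (diagX p ^+ l.-1 * partial1 V p + V p * (l.-1%:R * diagX p ^+ l.-1.-1)).
  refine (etrans (eq_on_partial1 E2 hp) _).
  have d1 := dif_mul (dX p l) (h2 p hp); have d2 := dif_mul (dX p l.-1) (hV p hp).
  refine (etrans (partial1_add d1 (dif_mul (dif_cst _ p) d2)) _).
  congr (_ + _); first exact: (P1 l (partial2 V) p (h2 p hp)).
  refine (etrans (partial1_scale _ d2) _); congr (_ * _).
  exact: (P1 l.-1 V p (hV p hp)).
rewrite /opP E12 (P1 _ _ _ (hV p hp)) (P2 _ _ _ (hV p hp)) -/(diagX p).
have := EPD p hp.
move: (partial1 (partial2 V) p) (partial1 V p) (partial2 V p) (V p) (diagX p).
move=> v12 v1 v2 v0 x H.
(* The exponents l - 1 and l - 2 are truncated for l = 0 and l = 1, which are computed apart. In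
   each case [y] isolates the product that the equation for [V] replaces. *)
case: l {dX X1 X2 P1 P2 E2 E12} => [|[|l]] /=.
- set y := x * v12 in H.
  transitivity (x * y - x * ((b - 0%:R) * v1 - (a - 0%:R) * v2)).
    by rewrite /y; ring.
  by rewrite H; ring.
- rewrite !expr0 !expr1; set y := x * v12 in H.
  transitivity (x ^+ 2 * y + x ^+ 2 * (v2 - v1) -
    x * ((b - 1%:R) * (x * v1 + v0) - (a - 1%:R) * (x * v2 - v0))).
    by rewrite /y; ring.
  by rewrite H; ring.
rewrite !exprS; set y := x * v12 in H; set z := x ^+ l.
transitivity (x ^+ 3 * z * y + x ^+ 3 * z * l.+2%:R * (v2 - v1) - l.+2%:R * l.+1%:R * x ^+ 2 * z * v0 -
    x * ((b - l.+2%:R) * (x ^+ 2 * z * v1 + l.+2%:R * x * z * v0) - (a - l.+2%:R) * (x ^+ 2 * z * v2 - l.+2%:R * x * z * v0))).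
  by rewrite /y; ring.
by rewrite H -!natr1; ring.
Qed.

End TwoVariables.

(** * Integrals with Jacobi weights *)
Section Improper.
Context {R : realType}.
Notation mu := (@lebesgue_measure R).
Implicit Types (f g F : R -> cplx R) (a b s : cplx R).

Let I11 : set (measurableTypeR R) := `]-1, 1[.
(** The cut-off starts at 1/2, so that every segment [In n] is nonempty. *)
Let dn (n : nat) : R := n.+2%:R^-1.
Let In (n : nat) : set (measurableTypeR R) := `[-1 + dn n, 1 - dn n].

Let dn_gt0 n : 0 < dn n. Proof. by rewrite invr_gt0. Qed.

Let dn_le n : dn n <= 1 / 2.
Proof. by rewrite div1r lef_pV2 ?posrE// ler_nat. Qed.

Let In_sub n : In n `<=` I11.
Proof.
move=> x; rewrite /In /I11 /= !in_itv/= => /andP[h1 h2].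
by have h0 := dn_gt0 n; apply/andP; split; lra.
Qed.

Let dn_small (e : R) : 0 < e -> exists N, forall n, (N <= n)%N -> dn n < e.
Proof.
move=> e0; exists (Num.truncn e^-1) => n hn.
rewrite /dn invf_plt ?posrE//.
apply: lt_le_trans (truncnS_gt _) _.
by rewrite ler_nat ltnS (leq_trans hn).
Qed.

Let In_cover x : I11 x -> exists N, forall n, (N <= n)%N -> In n x.
Proof.
rewrite /I11/= in_itv/= => /andP[h1 h2].
have e0 : 0 < Num.min (x + 1) (1 - x) by rewrite lt_min; apply/andP; split; lra.
have [N HN] := dn_small e0; exists N => n hn; rewrite /In/= in_itv/=.
by have := HN n hn; rewrite lt_min => /andP[a1 a2]; apply/andP; split; lra.
Qed.

Let mI : measurable I11. Proof. exact: measurable_itv. Qed.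
Let mIn n : measurable (In n). Proof. exact: measurable_itv. Qed.

(** On [In n] the integral of [f] is a difference of two values of [F], hence at most 2 K; monotone
    convergence carries this bound to the open interval. *)
Lemma integrable_improper (f F : R -> R) (K : R) :
  (forall x, I11 x -> 0 <= f x) ->
  (forall x, I11 x -> {for x, continuous f}) ->
  (forall x, I11 x -> is_derive x 1 F (f x)) ->
  (forall x, I11 x -> `|F x| <= K) ->
  mu.-integrable I11 (EFin \o f).
Proof.
move=> f0 cf dF FK.
have mf : measurable_fun I11 f.
  by apply: open_continuous_measurable_fun => // x /set_mem; exact: cf.
apply/integrableP; split; first exact/measurable_EFinP.
have -> : (\int[mu]_(x in I11) `|(EFin \o f) x| = \int[mu]_(x in I11) (EFin \o f) x)%E.
  by apply: eq_integral => x /set_mem Ix /=; rewrite ger0_norm// f0.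
have U : I11 = \bigcup_n In n.
  apply/seteqP; split => [x /In_cover[N HN]|x [n _ /In_sub//]].
  by exists N => //; exact: HN.
have ndI : nondecreasing_seq In.
  move=> n m nm; rewrite subsetEset => x; rewrite /In/= !in_itv/= => /andP[h1 h2].
  have : dn m <= dn n by rewrite lef_pV2 ?posrE// ler_nat ltnS.
  by move=> h; apply/andP; split; lra.
have cv := @ge0_nondecreasing_set_cvg_integral _ _ _ In (EFin \o f) mu ndI mIn _ _.
have {}cv : (\int[mu]_(x in In i) (EFin \o f) x @[i --> \oo] -->
    \int[mu]_(x in \bigcup_i In i) (EFin \o f) x)%E.
  apply: cv => [n|n x /In_sub/f0]; last by rewrite lee_fin.
  by apply/measurable_EFinP; apply: measurable_funS mf => //; exact: In_sub.
rewrite U; apply: (@le_lt_trans _ _ (2 * K)%:E); last exact: ltry.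
rewrite -(cvg_lim _ cv)//; apply: lime_le; first by apply/cvg_ex; eexists; exact: cv.
near=> n.
have ab : -1 + dn n <= 1 - dn n by have := dn_le n; lra.
have din x : x \in `[-1 + dn n, 1 - dn n] -> I11 x by move=> h; apply: (@In_sub n).
have H := @integralC_FTC _ (-1 + dn n) (1 - dn n) (fun x => ofR (F x)) (fun x => ofR (f x)) ab.
have {H} : integralC (In n) (fun x => ofR (f x)) = ofR (F (1 - dn n)) - ofR (F (-1 + dn n)).
  apply: H => x /din xI; first exact/cder_ofR/dF.
  by apply: continuous_comp; [exact: cf|exact: continuous_ofR].
move=> /(congr1 reC); rewrite reC_integralC !reimE => E.
have fi : mu.-integrable (In n) (EFin \o f).
  apply: continuous_compact_integrable; first exact: segment_compact.
  by apply: continuous_in_subspaceT => x /set_mem/In_sub/cf.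
rewrite -[leLHS]fineK; last exact: integrable_fin_num.
rewrite lee_fin -/(Rintegral _ _ _) (le_trans (_ : _ <= F (1 - dn n) - F (-1 + dn n)))//.
  by rewrite -E; apply: lexx.
have h1 := FK _ (din (1 - dn n) _); have h2 := FK _ (din (-1 + dn n) _).
have {}h1 : `|F (1 - dn n)| <= K by apply: h1; rewrite in_itv/= ab lexx.
have {}h2 : `|F (-1 + dn n)| <= K by apply: h2; rewrite in_itv/= ab lexx.
by move: h1 h2; rewrite !ler_norml; lra.
Unshelve. all: by end_near. Qed.

Lemma integralC_mkcond (D E : set (measurableTypeR R)) f : E `<=` D ->
  integralC D (f \_ E) = integralC E f.
Proof.
move=> ED.
have H (h : cplx R -> R) : h 0 = 0 -> (fun x => h ((f \_ E) x)) = (fun x => h (f x)) \_ E.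
  by move=> h0; apply/funext => x; rewrite !patchE; case: ifP.
apply: cplx_eq; rewrite ?reC_integralC ?imC_integralC H//.
  by rewrite -Rintegral_mkcondr setIidr.
by rewrite -Rintegral_mkcondr setIidr.
Qed.

(** By dominated convergence the integral is the limit of those over [In n], which are differences
    of values of [F] tending to 0. *)
Lemma integralC_improper (F f : R -> cplx R) :
  cintegrable I11 f ->
  (forall x, I11 x -> {for x, continuous f}) ->
  (forall x, I11 x -> cder F x (f x)) ->
  (fun n => F (-1 + n.+2%:R^-1)) @ \oo --> (0 : cplx R) ->
  (fun n => F (1 - n.+2%:R^-1)) @ \oo --> (0 : cplx R) ->
  integralC I11 f = 0.
Proof.
move=> fi cf dF Fa Fb.
have [mf1 mf2] := cintegrable_measurable fi.
have C : (fun n => integralC I11 (f \_ (In n))) @ \oo --> integralC I11 f.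
  have [||||_ C'] := @integralC_dominated_cvg _ I11 (fun n => f \_ (In n)) f
    (fun x => `|reC (f x)| + `|imC (f x)|) mI; last exact: C'.
  - move=> n; split.
      have -> : (fun x => reC ((f \_ (In n)) x)) = (fun x => reC (f x)) \_ (In n).
        by apply/funext => x; rewrite !patchE; case: ifP.
      apply/(measurable_restrict _ (mIn n) mI); apply: measurable_funS mf1 => //.
    have -> : (fun x => imC ((f \_ (In n)) x)) = (fun x => imC (f x)) \_ (In n).
      by apply/funext => x; rewrite !patchE; case: ifP.
    apply/(measurable_restrict _ (mIn n) mI); apply: measurable_funS mf2 => //.
  - move=> x /In_cover[N HN]; apply: cvg_near_cst; exists N => // n /= hn.
    by rewrite patchE mem_set//; exact: HN.
  - have [i1 i2] := fi.
    exact: (integrableD mI (integrable_abse i1) (integrable_abse i2)).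
  move=> n x _; rewrite patchE; case: ifP => _; first exact: nrm_le_reim.
  by rewrite nrm0 addr_ge0.
apply: (cvg_nrm_unique C).
have -> : (fun n => integralC I11 (f \_ (In n))) =
    (fun n => F (1 - dn n) - F (-1 + dn n)).
  apply/funext => n; rewrite integralC_mkcond; last exact: In_sub.
  apply: integralC_FTC; first by have := dn_le n; lra.
    by move=> x xI; apply: dF; exact: (@In_sub n).
  by move=> x xI; apply: cf; exact: (@In_sub n).
by rewrite -(subrr (0 : cplx R)); exact: (cvgB Fb Fa).
Qed.

End Improper.

Section Weights.
Context {R : realType}.
Notation mu := (@lebesgue_measure R).
Implicit Types (a b s : cplx R) (v x : R).

Definition I11 : set (measurableTypeR R) := `]-1, 1[.

Lemma measurable_I11 : measurable I11. Proof. exact: measurable_itv. Qed.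

Lemma I11P v : I11 v -> 0 < 1 - v /\ 0 < 1 + v.
Proof. by rewrite /I11/= in_itv/= => /andP[h1 h2]; split; lra. Qed.

(** The arguments are the exponents themselves, while [rwgt] and [wgt_int] take Beta parameters,
    which exceed the exponents by one. *)
Definition wgt a b v : cplx R := powC (ofR (1 - v)) a * powC (ofR (1 + v)) b.

Definition rwgt (s t : R) v : R := (1 - v) `^ (s - 1) * (1 + v) `^ (t - 1).

Lemma nrm_wgt a b v : I11 v -> nrm (wgt (a - 1) (b - 1) v) = rwgt (reC a) (reC b) v.
Proof.
move=> /I11P[h1 h2]; rewrite /wgt nrmM (nrm_powC _ h1) (nrm_powC _ h2).
by rewrite /rwgt !reC_B !reC1.
Qed.

Lemma is_derive_lin (c k x : R) : is_derive x 1 (fun v => c + k * v) k.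
Proof.
apply/is_deriveR_eps => e e0; exists 1 => // h _.
by rewrite (_ : _ - _ = 0) ?normr0 ?mulr_ge0 ?(ltW e0)//; ring.
Qed.

Lemma is_derive_powR_lin (c k s x : R) : 0 < c + k * x ->
  is_derive x 1 (fun v => (c + k * v) `^ s) (k * s * (c + k * x) `^ (s - 1)).
Proof.
move=> h; have := @is_derive1_comp R (fun y => y `^ s) (fun v => c + k * v) x _ _
  (is_derive1_powR s h) (is_derive_lin c k x).
by move=> H; apply: is_derive_eq H _; ring.
Qed.

(** Each factor alone is integrable, being the derivative of a bounded function. On each half of the
    interval only one factor can be singular, and the other is bounded by a power of 2. *)
Lemma rwgt_integrable (s t : R) : 0 < s -> 0 < t -> mu.-integrable I11 (EFin \o rwgt s t).
Proof.
move=> s0 t0.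
have one (c k r : R) : k != 0 -> 0 < r ->
    (forall v, I11 v -> 0 < c + k * v <= 2) ->
    mu.-integrable I11 (EFin \o (fun v => (c + k * v) `^ (r - 1))).
  move=> k0 r0 H.
  apply: (@integrable_improper _ _ (fun v => (k * r)^-1 * (c + k * v) `^ r) (`|(k * r)^-1| * 2 `^ r)).
  - by move=> v _; exact: powR_ge0.
  - move=> v /H/andP[h _]; apply/differentiable_continuous/derivable1_diffP.
    by have [] := is_derive_powR_lin (r - 1) h.
  - move=> v /H/andP[h _].
    have := is_deriveZ (k * r)^-1 (is_derive_powR_lin r h).
    move=> D; apply: is_derive_eq D _; rewrite /GRing.scale/=; field.
    by rewrite k0 gt_eqF.
  - move=> v /H/andP[h h2]; rewrite normrM (ger0_norm (powR_ge0 _ _)) ler_wpM2l//.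
    by apply: ge0_ler_powR; rewrite ?nnegrE ?(ltW h) ?(ltW r0).
pose K : R := 2 `^ `|s - 1| + 2 `^ `|t - 1|.
have i1 : mu.-integrable I11 (EFin \o (fun v => (1 + -1 * v) `^ (s - 1))).
  by apply: one; rewrite ?oppr_eq0 ?oner_eq0// => v /I11P[h1 h2]; apply/andP; split; lra.
have i2 : mu.-integrable I11 (EFin \o (fun v => (1 + 1 * v) `^ (t - 1))).
  by apply: one; rewrite ?oner_eq0// => v /I11P[h1 h2]; apply/andP; split; lra.
have i3 := integrableD measurable_I11 (integrable_mull K measurable_I11 i1)
  (integrable_mull K measurable_I11 i2).
apply: (le_integrable measurable_I11 _ _ i3).
  apply/measurable_EFinP; apply: open_continuous_measurable_fun; first exact: interval_open.
  move=> v /set_mem/I11P[h1 h2].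
  have c1 : {for v, continuous (fun v => (1 - v) `^ (s - 1))}.
    apply: (@eq_continuous _ _ (fun v => (1 + -1 * v) `^ (s - 1))) => [y|].
      by rewrite mulN1r.
    apply/differentiable_continuous/derivable1_diffP.
    by have [] := @is_derive_powR_lin 1 (-1) (s - 1) v; rewrite mulN1r.
  have c2 : {for v, continuous (fun v => (1 + v) `^ (t - 1))}.
    apply: (@eq_continuous _ _ (fun v => (1 + 1 * v) `^ (t - 1))) => [y|].
      by rewrite mul1r.
    apply/differentiable_continuous/derivable1_diffP.
    by have [] := @is_derive_powR_lin 1 1 (t - 1) v; rewrite mul1r.
  exact: (continuousM c1 c2).
move=> v /I11P[h1 h2] /=; rewrite lee_fin /rwgt mulN1r mul1r.
set A := (1 - v) `^ (s - 1); set B := (1 + v) `^ (t - 1).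
have A0 : 0 <= A by exact: powR_ge0.
have B0 : 0 <= B by exact: powR_ge0.
have K0 : 0 <= K by rewrite addr_ge0// powR_ge0.
rewrite ger0_norm ?mulr_ge0// ger0_norm; last by rewrite addr_ge0// mulr_ge0.
have pw (y r : R) : 1 <= y -> y <= 2 -> y `^ r <= 2 `^ `|r|.
  move=> y1 y2; apply: le_trans (_ : y `^ `|r| <= _).
    by apply: ler_powR => //; exact: ler_norm.
  by apply: ge0_ler_powR; rewrite ?nnegrE//; lra.
have [v0|v0] := leP 0 v.
  have BK : B <= K.
    apply: le_trans (_ : 2 `^ `|t - 1| <= _); first by apply: pw; lra.
    by rewrite /K lerDr powR_ge0.
  apply: le_trans (_ : K * A <= _); first by rewrite mulrC ler_wpM2r.
  by rewrite lerDl mulr_ge0.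
have AK : A <= K.
  apply: le_trans (_ : 2 `^ `|s - 1| <= _); first by apply: pw; lra.
  by rewrite /K lerDl powR_ge0.
apply: le_trans (_ : K * B <= _); first by rewrite ler_wpM2r.
by rewrite lerDr mulr_ge0.
Qed.

Lemma powC_pred (x : R) a : 0 < x -> powC (ofR x) a = ofR x * powC (ofR x) (a - 1).
Proof. by move=> x0; rewrite -{2}(powC_ofR1 x0) -powCD [1 + _]addrC subrK. Qed.

Lemma cder_wgt a b v : I11 v ->
  cder (wgt a b) v ((- a * ofR (1 + v) + b * ofR (1 - v)) * wgt (a - 1) (b - 1) v).
Proof.
move=> /I11P[h1 h2].
have d1 : is_derive v 1 (fun v => 1 - v) (-1).
  have := is_derive_lin 1 (-1) v; congr (is_derive _ _ _ _).
  by apply/funext => y; rewrite mulN1r.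
have d2 : is_derive v 1 (fun v => 1 + v) 1.
  have := is_derive_lin 1 1 v; congr (is_derive _ _ _ _).
  by apply/funext => y; rewrite mul1r.
have H := cderM (@cder_powC _ (fun v => 1 - v) v _ a h1 d1)
  (@cder_powC _ (fun v => 1 + v) v _ b h2 d2).
apply: cder_eq H _; rewrite /wgt.
have E1 : powC (ofR (1 - v)) a = ofR (1 - v) * powC (ofR (1 - v)) (a - 1).
  exact: powC_pred.
have E2 : powC (ofR (1 + v)) b = ofR (1 + v) * powC (ofR (1 + v)) (b - 1).
  exact: powC_pred.
rewrite E1 E2 /= !ofRM !ofRV ofRN ofR1.
have z1 : ofR (1 - v) != 0 :> cplx R by rewrite ofR_eq0 gt_eqF.
have z2 : ofR (1 + v) != 0 :> cplx R by rewrite ofR_eq0 gt_eqF.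
move: (ofR (1 - v)) (ofR (1 + v)) (powC _ _) (powC _ _) z1 z2 => x y p q x0 y0.
by field; rewrite x0 y0.
Qed.

Lemma wgtSl a b v : I11 v -> wgt a b v = ofR (1 - v) * wgt (a - 1) b v.
Proof.
by move=> /I11P[h1 h2]; rewrite /wgt (powC_pred a h1); exact: esym (mulrA _ _ _).
Qed.

Lemma wgtSr a b v : I11 v -> wgt a b v = ofR (1 + v) * wgt a (b - 1) v.
Proof.
by move=> /I11P[h1 h2]; rewrite /wgt (powC_pred b h2); exact: mulrCA.
Qed.

Lemma wgt_continuous a b v : I11 v -> {for v, continuous (wgt a b)}.
Proof. by move=> /cder_wgt h; exact: cder_continuous (h a b). Qed.

Lemma wgt_integrable a b : 0 < reC a -> 0 < reC b ->
  cintegrable I11 (wgt (a - 1) (b - 1)).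
Proof.
move=> a0 b0; apply: (cintegrable_dominated measurable_I11 _ (rwgt_integrable a0 b0)).
  apply: continuous_cmeasurable; first exact: interval_open.
  by move=> v; exact: wgt_continuous.
by move=> v /nrm_wgt ->.
Qed.

Lemma powR_small (s : R) : 0 < s -> forall e : R, 0 < e ->
  exists2 d : R, 0 < d & forall x, 0 < x -> x < d -> x `^ s < e.
Proof.
move=> s0 e e0; exists (e `^ s^-1); first exact: powR_gt0.
move=> x x0 xd; have -> : e = (e `^ s^-1) `^ s.
  by rewrite -powRrM mulVf ?gt_eqF// powRr1// ltW.
by apply: gt0_ltr_powR; rewrite ?nnegrE ?powR_ge0 ?(ltW x0).
Qed.

Lemma wgt_end (H : R -> cplx R) (M : R) a b : 0 < reC a -> 0 < reC b ->
  (forall v, I11 v -> nrm (H v) <= M) ->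
  (fun n => H (-1 + n.+2%:R^-1) * wgt a b (-1 + n.+2%:R^-1)) @ \oo --> (0 : cplx R) /\
  (fun n => H (1 - n.+2%:R^-1) * wgt a b (1 - n.+2%:R^-1)) @ \oo --> (0 : cplx R).
Proof.
move=> a0 b0 HM.
have main (s t : R) (f : nat -> cplx R) : 0 < s -> 0 < t ->
    (forall n, nrm (f n) <= M * (n.+2%:R^-1 `^ s * (2 - n.+2%:R^-1) `^ t)) ->
    f @ \oo --> (0 : cplx R).
  move=> s0 t0 fM; apply: cvg_nrm_le => e e0.
  pose K : R := (`|M| + 1) * 2 `^ t.
  have K0 : 0 < K by rewrite mulr_gt0 ?powR_gt0// ltr_wpDl.
  have [d d0 Hd] := powR_small s0 (divr_gt0 e0 K0).
  have [N HN] := @ex_small_inv _ 1 (d / 2) ler01 (divr_gt0 d0 (ltr0Sn R 1)).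
  exists N => // n /= hn; rewrite subr0 (le_trans (fM n))//.
  have x0 : 0 < n.+2%:R^-1 :> R by rewrite invr_gt0.
  have x1 : n.+2%:R^-1 <= 1 :> R by rewrite invf_le1// ler1n.
  have xd : n.+2%:R^-1 < d.
    have := HN n.+1 (leq_trans hn (leqnSn n)); rewrite div1r => /le_lt_trans; apply.
    by rewrite ltr_pdivrMr// ltr_pMr// ltr1n.
  move: x0 x1 xd; move: (n.+2%:R^-1 : R) => x x0 x1 xd.
  have h1 := Hd _ x0 xd.
  have h2 : (2 - x) `^ t <= 2 `^ t.
    by apply: ge0_ler_powR; rewrite ?nnegrE; clear -x0 x1 t0; lra.
  move: h1 h2; set X := _ `^ s; set Y := _ `^ t => h1 h2.
  have X0 : 0 <= X by exact: powR_ge0.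
  have Y0 : 0 <= Y by exact: powR_ge0.
  apply: le_trans (_ : (`|M| + 1) * (X * 2 `^ t) <= _).
    apply: le_trans (_ : (`|M| + 1) * (X * Y) <= _).
      by rewrite ler_wpM2r ?mulr_ge0// (le_trans (ler_norm _))// lerDl.
    by rewrite ler_wpM2l ?addr_ge0// ler_wpM2l.
  rewrite (_ : _ * (X * _) = X * K); last by rewrite /K; ring.
  by rewrite -ler_pdivlMr// ltW.
have inI n : I11 (-1 + n.+2%:R^-1) /\ I11 (1 - n.+2%:R^-1).
  have x0 : 0 < n.+2%:R^-1 :> R by rewrite invr_gt0.
  have x1 : n.+2%:R^-1 < 1 :> R by rewrite invf_lt1// ltr1n.
  move: x0 x1; move: (n.+2%:R^-1 : R) => x x0 x1.
  by rewrite /I11/= !in_itv/=; split; apply/andP; split; lra.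
have nw v : I11 v -> nrm (wgt a b v) = (1 - v) `^ reC a * (1 + v) `^ reC b.
  by move=> /I11P[h1 h2]; rewrite /wgt nrmM (nrm_powC _ h1) (nrm_powC _ h2).
split.
  apply: (main (reC b) (reC a)) => // n; have [h _] := inI n.
  rewrite nrmM (nw _ h) ler_pM ?nrm_ge0 ?mulr_ge0 ?powR_ge0 ?HM//.
  rewrite mulrC; move: (n.+2%:R^-1 : R) => x.
  have E1 : 1 + (-1 + x) = x by ring.
  have E2 : 1 - (-1 + x) = 2 - x by ring.
  by rewrite E1 E2.
apply: (main (reC a) (reC b)) => // n; have [_ h] := inI n.
rewrite nrmM (nw _ h) ler_pM ?nrm_ge0 ?mulr_ge0 ?powR_ge0 ?HM//.
move: (n.+2%:R^-1 : R) => x.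
have E1 : 1 + (1 - x) = 2 - x by ring.
have E2 : 1 - (1 - x) = x by ring.
by rewrite E1 E2.
Qed.

(** The product of [H] with [wgt a b] tends to 0 at both ends, as [H] is bounded and both exponents
    have positive real part; so its derivative has integral 0. *)
Lemma wgt_by_parts (H H' : R -> cplx R) (M : R) a b : 0 < reC a -> 0 < reC b ->
  (forall v, I11 v -> cder H v (H' v)) ->
  (forall v, I11 v -> {for v, continuous H'}) ->
  (forall v, I11 v -> nrm (H v) <= M) -> (forall v, I11 v -> nrm (H' v) <= M) ->
  integralC I11 (fun v => H' v * wgt a b v) =
  a * integralC I11 (fun v => H v * wgt (a - 1) b v) -
  b * integralC I11 (fun v => H v * wgt a (b - 1) v).
Proof.
move=> a0 b0 dH cH' HM H'M.
have mI := measurable_I11.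
have cH v : I11 v -> {for v, continuous H} by move=> /dH; exact: cder_continuous.
have int (h : R -> cplx R) c d : 0 < reC c -> 0 < reC d ->
    (forall v, I11 v -> {for v, continuous h}) -> (forall v, I11 v -> nrm (h v) <= M) ->
    cintegrable I11 (fun v => h v * wgt (c - 1) (d - 1) v).
  move=> c0 d0 ch hM.
  apply: (cintegrable_dominated mI _ (integrable_mull M mI (rwgt_integrable c0 d0))).
    apply: continuous_cmeasurable; first exact: interval_open.
    by move=> v Iv; apply: continuous_mul; [exact: ch|exact: wgt_continuous].
  move=> v Iv; rewrite nrmM (nrm_wgt _ _ Iv) ler_wpM2r ?hM//.
  by rewrite mulr_ge0// powR_ge0.
have i1 : cintegrable I11 (fun v => H' v * wgt a b v).
  have := @int H' (a + 1) (b + 1); rewrite !addrK; apply=> //; rewrite !reimE; lra.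
have i2 : cintegrable I11 (fun v => H v * wgt (a - 1) b v).
  have := @int H a (b + 1); rewrite !addrK; apply=> //; rewrite !reimE; lra.
have i3 : cintegrable I11 (fun v => H v * wgt a (b - 1) v).
  have := @int H (a + 1) b; rewrite !addrK; apply=> //; rewrite !reimE; lra.
have [e1 e2] := wgt_end a0 b0 HM.
have i2' := cintegrableZ (- a) mI i2; have i3' := cintegrableZ b mI i3.
have i23 := cintegrableD mI i2' i3'.
have Z := @integralC_improper _ (fun v => H v * wgt a b v)
  (fun v => H' v * wgt a b v + (- a * (H v * wgt (a - 1) b v) + b * (H v * wgt a (b - 1) v)))
  (cintegrableD mI i1 i23).
have {Z} : integralC I11
  (fun v => H' v * wgt a b v + (- a * (H v * wgt (a - 1) b v) + b * (H v * wgt a (b - 1) v))) = 0.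
  apply: Z => [v Iv|v Iv||]; [| |exact: e1|exact: e2].
    have c0 (k : cplx R) : {for v, continuous (fun _ : R => k)} by exact: cvg_cst.
    have cw1 := continuous_mul (cH' v Iv) (@wgt_continuous a b v Iv).
    have cw2 := continuous_mul (c0 (- a)) (continuous_mul (cH v Iv) (@wgt_continuous (a - 1) b v Iv)).
    have cw3 := continuous_mul (c0 b) (continuous_mul (cH v Iv) (@wgt_continuous a (b - 1) v Iv)).
    exact: (cvgD cw1 (cvgD cw2 cw3)).
  apply: cder_eq (cderM (dH v Iv) (cder_wgt a b Iv)) _.
  rewrite (wgtSr (a - 1) b Iv) (wgtSl a (b - 1) Iv).
  move: (wgt (a - 1) (b - 1) v) (wgt a b v) (H v) (H' v) (ofR (1 + v)) (ofR (1 - v)).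
  by move=> *; ring.
rewrite integralCD// integralCD// !integralCZ//.
move: (integralC _ _) (integralC _ _) (integralC _ _) => x y z /eqP.
by rewrite addr_eq0 => /eqP ->; ring.
Qed.

End Weights.

(** * The Beta integral on ]-1, 1[ *)

Section Beta.
Context {R : realType}.
Notation mu := (@lebesgue_measure R).
Implicit Types (a b s : cplx R) (v x : R).
Notation I11 := (@I11 R).

Definition wgt_int a b : cplx R := integralC I11 (wgt (a - 1) (b - 1)).

(** This is (1 - v) + (1 + v) = 2 under the integral. *)
Lemma wgt_int_sum a b : 0 < reC a -> 0 < reC b ->
  wgt_int (a + 1) b + wgt_int a (b + 1) = 2 * wgt_int a b.
Proof.
move=> a0 b0; rewrite /wgt_int -(integralCZ _ measurable_I11 (wgt_integrable a0 b0)).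
rewrite -(integralCD measurable_I11) ?addrK; last 2 first.
- by have := @wgt_integrable _ (a + 1) b; rewrite addrK; apply=> //; rewrite !reimE; lra.
- by have := @wgt_integrable _ a (b + 1); rewrite addrK; apply=> //; rewrite !reimE; lra.
apply: eq_integralC => v Iv; rewrite (wgtSl a (b - 1) Iv) (wgtSr (a - 1) b Iv).
by rewrite -mulrDl -ofRD (_ : 1 - v + (1 + v) = 2%:R) ?ofR_nat//; ring.
Qed.

Lemma wgt_int_parts a b : 0 < reC a -> 0 < reC b ->
  a * wgt_int a (b + 1) = b * wgt_int (a + 1) b.
Proof.
move=> a0 b0.
have := @wgt_by_parts _ (fun=> 1) (fun=> 0) 1 a b a0 b0.
have c0 (k : cplx R) v : {for v, continuous (fun _ : R => k)} by exact: cvg_cst.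
move=> /(_ (fun v _ => cder_cst 1 v) (fun v _ => c0 0 v)).
have n1 v : I11 v -> nrm (1 : cplx R) <= 1 by rewrite nrm1.
have n0 v : I11 v -> nrm (0 : cplx R) <= 1 by rewrite nrm0 ler01.
move=> /(_ n1 n0) H.
rewrite /wgt_int !addrK.
have E0 : integralC I11 (fun v => 0 * wgt a b v) = 0.
  have i := @wgt_integrable R (1 : cplx R) (1 : cplx R); rewrite reC1 ltr01 in i.
  have -> : integralC I11 (fun v => 0 * wgt a b v) =
      integralC I11 (fun v => 0 * wgt (1 - 1) (1 - 1) v).
    by apply: eq_integralC => v _; rewrite !mul0r.
  by rewrite (integralCZ _ measurable_I11 (i isT isT)) mul0r.
rewrite E0 in H.
have E1 c d : integralC I11 (fun v => 1 * wgt c d v) = integralC I11 (wgt c d).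
  by apply: eq_integralC => v _; rewrite mul1r.
move: H; rewrite !E1 => /esym/eqP; rewrite subr_eq0 => /eqP.
exact.
Qed.

Lemma wgt_int_succ a b : 0 < reC a -> 0 < reC b ->
  (a + b) * wgt_int a (b + 1) = 2 * b * wgt_int a b.
Proof.
move=> a0 b0; rewrite mulrDl (wgt_int_parts a0 b0) -mulrDr (wgt_int_sum a0 b0).
by ring.
Qed.

Lemma Rintegral_I11 : \int[mu]_(x in I11) (1 : R) = 2.
Proof.
rewrite /Rintegral (eq_integral (cst 1%:E))// integral_cst; last exact: measurable_I11.
rewrite /= lebesgue_measure_itv/= lte_fin; case: ifPn => [_|].
  by rewrite -EFinB mul1e/=; ring.
by rewrite -leNgt => h; exfalso; lra.
Qed.

Lemma wgt_int_1r a : 0 < reC a -> a * wgt_int a 1 = powC (ofR 2) a.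
Proof.
move=> a0; have mI := @measurable_I11 R.
have r2 : 0 < (2 : R) by [].
have p2 : powC (ofR (2 : R)) a = 2 * powC (ofR (2 : R)) (a - 1).
  by rewrite (powC_pred a r2) ofR_nat.
pose c : cplx R := powC (ofR 2) (a - 1).
have i1 : cintegrable I11 (wgt (a - 1) (1 - 1)).
  by apply: wgt_integrable => //; rewrite reC1.
have i11 : cintegrable I11 (wgt ((1 : cplx R) - 1) (1 - 1)).
  by apply: wgt_integrable; rewrite reC1.
have i2 := cintegrableZ (- a) mI i1.
have i3 := cintegrableZ c mI i11.
(* An antiderivative vanishing at both ends is wanted: with c = 2^(a-1) the linear term cancels the
   value 2^a at v = -1. Its contribution 2 c to the integral is the right-hand side. *)
pose F v : cplx R := powC (ofR (1 - v)) a - c * ofR (1 - v).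
have d1 v : is_derive v 1 (fun v => 1 - v) (-1).
  have := is_derive_lin 1 (-1) v; congr (is_derive _ _ _ _).
  by apply/funext => y; rewrite mulN1r.
have dF v : 0 < 1 - v -> cder F v (a * ofR (- 1 / (1 - v)) * powC (ofR (1 - v)) a + c).
  move=> h1.
  have H := cderD (@cder_powC _ (fun v => 1 - v) v _ a h1 (d1 v))
     (cderM (cder_cst (- c) v) (cder_ofR (d1 v))).
  have -> : F = fun v => powC (ofR (1 - v)) a + - c * ofR (1 - v).
    by apply/funext => y; rewrite /F mulNr.
  by apply: cder_eq H _; rewrite ofRN ofR1; ring.
have cw k l v (Iv : I11 v) : {for v, continuous (fun v => (k : cplx R) * wgt l (1 - 1) v)}.
  have ck : {for v, continuous (fun _ : R => k)} by exact: cvg_cst.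
  exact: (continuous_mul ck (wgt_continuous Iv)).
have Z := @integralC_improper _ F
  (fun v => - a * wgt (a - 1) (1 - 1) v + c * wgt (1 - 1) (1 - 1) v) (cintegrableD mI i2 i3).
have {Z} : integralC I11 (fun v => - a * wgt (a - 1) (1 - 1) v + c * wgt (1 - 1) (1 - 1) v) = 0.
  have xn (n : nat) : 0 < n.+2%:R^-1 :> R by rewrite invr_gt0.
  apply: Z => [v Iv|v Iv||].
  - exact: (cvgD (cw _ _ _ Iv) (cw _ _ _ Iv)).
  - have [h1 h2] := I11P Iv.
    apply: cder_eq (dF v h1) _.
    rewrite /wgt !subrr !powC0r !mulr1 (powC_pred a h1) ofRM ofRV ofRN ofR1.
    have z1 : ofR (1 - v) != 0 :> cplx R by rewrite ofR_eq0 gt_eqF.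
    move: (ofR (1 - v)) (powC _ _) z1 => x p x0.
    by field.
  - have h1 : 0 < 1 - (-1 : R) by lra.
    have /cvg_nrm cF := cder_continuous (dF _ h1).
    have F1 : F (-1) = 0.
      rewrite /F opprK (_ : 1 + 1 = 2)//.
      by rewrite p2 -/c ofR_nat; move: (c) => k; ring.
    apply/cvg_nrm => e e0; have := cF e e0.
    rewrite F1 => /nbhs_ballP[d /= d0 H].
    have [N HN] := @ex_small_inv _ 1 (d / 2) ler01 (divr_gt0 d0 (ltr0Sn R 1)).
    exists N => // n /= hn; apply: H; rewrite /ball/= opprD addNKr normrN.
    rewrite gtr0_norm//.
    have := HN n.+1 (leq_trans hn (leqnSn n)); rewrite div1r => /le_lt_trans; apply.
    by rewrite ltr_pdivrMr// ltr_pMr// ltr1n.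
  - apply: cvg_nrm_le => e e0.
    have e2 : 0 < e / 2 by rewrite divr_gt0.
    have [d d0 Hd] := powR_small a0 e2.
    have cp : 0 < 2 * (nrm c + 1) by rewrite mulr_gt0// ltr_wpDl// nrm_ge0.
    pose d' : R := Num.min (d / 2) (e / (2 * (nrm c + 1))).
    have d'0 : 0 < d' by rewrite lt_min !divr_gt0.
    have [N HN] := @ex_small_inv _ 1 d' ler01 d'0.
    exists N => // n /= hn.
    have := HN n.+1 (leq_trans hn (leqnSn n)); rewrite div1r le_min => /andP[].
    rewrite subr0 /F; move: (xn n); move: (n.+2%:R^-1 : R) => x x0 xd xe.
    have E1 : 1 - (1 - x) = x by ring.
    rewrite E1; apply: le_trans (nrmB _ _) _.
    rewrite (nrm_powC _ x0) nrmM nrm_ofR gtr0_norm//.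
    have h1 : x `^ reC a < e / 2.
      by apply: Hd => //; apply: le_lt_trans xd _; rewrite ltr_pdivrMr// ltr_pMr// ltr1n.
    have h2 : nrm c * x <= e / 2.
      have : (nrm c + 1) * x <= e / 2.
        move: xe; rewrite ler_pdivlMr// mulrCA (mulrC x) => xe.
        rewrite ler_pdivlMr// mulrC; exact: xe.
      rewrite mulrDl mul1r; apply: le_trans.
      by rewrite lerDl ltW.
    have -> : e = e / 2 + e / 2 by field.
    exact: lerD (ltW h1) h2.
rewrite (integralCD mI i2 i3) (integralCZ _ mI i1) (integralCZ _ mI i11).
have -> : integralC I11 (wgt ((1 : cplx R) - 1) (1 - 1)) = 2.
  have -> : integralC I11 (wgt ((1 : cplx R) - 1) (1 - 1)) = integralC I11 (fun=> 1).
    by apply: eq_integralC => v _; rewrite /wgt !subrr !powC0r mulr1.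
  transitivity (ofR (2 : R) + iC * ofR (0 : R)); last by rewrite mulr0 addr0 ofR_nat.
  congr (ofR _ + iC * ofR _); first exact: Rintegral_I11.
  by rewrite /Rintegral integral0.
rewrite -/(wgt_int a 1) => /eqP; rewrite addrC mulNr subr_eq0 => /eqP <-.
by rewrite p2 mulrC.
Qed.

End Beta.

Section BetaC.
Context {R : realType}.
Notation mu := (@lebesgue_measure R).
Implicit Types (a b s : cplx R) (v x : R).
Notation I11 := (@I11 R).

(** Euler's Beta function, transported from ]0, 1[ to ]-1, 1[ by an affine substitution; the power
    of 2 is the resulting factor. *)
Definition betaC a b : cplx R := wgt_int a b / powC (ofR 2) (a + b - 1).

Lemma betaC_succ a b : 0 < reC a -> 0 < reC b ->
  (a + b) * betaC a (b + 1) = b * betaC a b.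
Proof.
move=> a0 b0; rewrite /betaC mulrA (wgt_int_succ a0 b0).
have -> : a + (b + 1) - 1 = (a + b - 1) + 1 by ring.
have r2 : 0 < (2 : R) by [].
rewrite powCD (powC_ofR1 r2).
have := powC_neq0 (ofR (2 : R)) (a + b - 1).
move: (powC _ _) (wgt_int a b) => p w p0.
by rewrite ofR_nat; field.
Qed.

Lemma betaC_1r a : 0 < reC a -> a * betaC a 1 = 1.
Proof.
move=> a0; rewrite /betaC mulrA (wgt_int_1r a0) addrK divff// powC_neq0//.
Qed.

Lemma pochhammerS a n : pochhammer a n.+1 = pochhammer a n * (a + n%:R).
Proof. by rewrite /pochhammer big_ord_recr. Qed.

Lemma pochhammerSl a n : pochhammer a n.+1 = a * pochhammer (a + 1) n.
Proof.
rewrite /pochhammer big_ord_recl addr0; congr (_ * _).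
by apply: eq_bigr => i _; rewrite /= -addrA -natr1 [1 + _]addrC.
Qed.

Lemma pochhammer0 a : pochhammer a 0 = 1.
Proof. by rewrite /pochhammer big_ord0. Qed.

Lemma pochhammer1 n : pochhammer 1 n = n`!%:R :> cplx R.
Proof.
elim: n => [|n IH]; first by rewrite pochhammer0.
by rewrite pochhammerS IH factS natrM mulrC -natr1 [1 + _]addrC.
Qed.

Lemma pochhammer_neq0 a n : 0 < reC a -> pochhammer a n != 0.
Proof.
move=> a0; apply/prodf_neq0 => i _; apply/eqP => /(congr1 (@reC R)).
have i0 : 0 <= (i%:R : R) by [].
by rewrite !reimE => h; clear -a0 i0 h; lra.
Qed.

Lemma betaC_pochhammer a b n : 0 < reC a -> 0 < reC b ->
  pochhammer (a + b) n * betaC a (b + n%:R) = pochhammer b n * betaC a b.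
Proof.
move=> a0 b0; elim: n => [|n IH]; first by rewrite !pochhammer0 addr0.
have b1 : 0 < reC (b + n%:R) by rewrite !reimE ltr_wpDr.
have := betaC_succ a0 b1; rewrite addrA => H.
rewrite !pochhammerS -natr1 [b + (_ + 1)]addrA -mulrA H mulrCA IH.
by ring.
Qed.

(** The difference is the integral of b y^(b-1) over [1 + v, 2]. As Re b >= 1, the modulus of the
    power is largest at y = 2; the factor 2 is that of the componentwise bound. *)
Lemma powC_mean_value b v : 1 <= reC b -> I11 v ->
  nrm (powC (ofR (1 + v)) b - powC (ofR 2) b) <=
  2 * (nrm b * 2 `^ (reC b - 1)) * (1 - v).
Proof.
move=> b1 /I11P[h1 h2].
have h3 : 1 + v <= 2 by lra.
pose f' (y : R) : cplx R := b * ofR (1 / y) * powC (ofR y) b.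
have pos (x : R) : x \in `[1 + v, 2] -> 0 < x /\ x <= 2.
  by rewrite in_itv/= => /andP[h4 h5]; split; lra.
have dp (x : R) : 0 < x -> cder (fun y => powC (ofR y) b) x (f' x).
  move=> x0; have d1 : is_derive x 1 (fun y : R => y) 1 by exact: is_derive_id.
  exact: (@cder_powC _ (fun y => y) x _ b x0 d1).
have cf' : ccont (1 + v) 2 f'.
  move=> x /pos[x0 _].
  have d1 : is_derive x 1 (fun y : R => y) 1 by exact: is_derive_id.
  have c1 := cder_continuous (dp x x0).
  have cb : {for x, continuous (fun _ : R => b)} by exact: cvg_cst.
  have ci : {for x, continuous (fun y : R => ofR (1 / y))}.
    have cy : {for x, continuous (fun y : R => 1 / y)}.
      apply: (@eq_continuous _ _ (fun y : R => y^-1)) => [y|]; first by rewrite div1r.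
      by apply: cvgV; [rewrite gt_eqF|exact: cvg_id].
    exact: (continuous_comp cy (@continuous_ofR R _)).
  exact: (continuous_mul (continuous_mul cb ci) c1).
rewrite nrmC -(integralC_FTC h3 (f := fun y => powC (ofR y) b) (f' := f')) //; last first.
  by move=> x /pos[x0 _]; exact: dp.
apply: le_trans (integralC_bound_itv (M := nrm b * 2 `^ (reC b - 1)) h3 (ccont_integrable cf') _) _.
  move=> x /pos[x0 x2]; rewrite /f' nrmM (nrmM b) nrm_ofR (nrm_powC _ x0) -mulrA ler_wpM2l ?nrm_ge0//.
  rewrite div1r gtr0_norm ?invr_gt0//.
  have -> : x^-1 * x `^ reC b = x `^ (reC b - 1).
    by rewrite powRB ?(lt0r_neq0 x0) ?implybT// powRr1 ?(ltW x0)// mulrC.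
  by apply: ge0_ler_powR; rewrite ?nnegrE ?subr_ge0// ltW.
have -> : 2 - (1 + v) = 1 - v by ring.
by rewrite mulrA.
Qed.

Lemma wgt_int_real (s t : R) : 0 < s -> 0 < t ->
  wgt_int (ofR s) (ofR t) = ofR (\int[mu]_(x in I11) rwgt s t x).
Proof.
move=> s0 t0.
have E v : I11 v -> wgt (ofR s - 1) (ofR t - 1) v = ofR (rwgt s t v).
  move=> /I11P[h1 h2]; rewrite /wgt -ofR1 -!ofRB (powC_ofR _ h1) (powC_ofR _ h2).
  by rewrite -!ofRM !expC_ofR -ofRM /rwgt /powR !gt_eqF.
rewrite /wgt_int (eq_integralC E) /integralC.
have -> : \int[mu]_(x in I11) imC (ofR (rwgt s t x)) = 0.
  by rewrite /Rintegral integral0.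
by rewrite mulr0 addr0.
Qed.

(** For large n the weight (1 + v)^n concentrates at v = 1, where (1 + v)^b equals 2^b. Replacing
    the one by the other costs a factor of order 1 - v, which raises the first parameter by 1. *)
Lemma betaC_shift_bound a b : 0 < reC a -> 1 <= reC b -> exists C : R, forall n : nat,
  nrm (betaC a (b + n.+1%:R) - betaC a n.+1%:R) <=
  C * nrm (betaC (ofR (reC a + 1)) n.+1%:R).
Proof.
move=> a0 b1; have mI := @measurable_I11 R.
have r2 : 0 < (2 : R) by [].
pose M : R := 2 * (nrm b * 2 `^ (reC b - 1)).
have M0 : 0 <= M by rewrite mulr_ge0// mulr_ge0 ?powR_ge0// nrm_ge0.
exists (2 * M * 2 `^ (1 - reC b)) => n.
have n0 : 0 < (n.+1%:R : R) by [].
have n0' : 0 < reC (n.+1%:R : cplx R) by rewrite reC_nat.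
have bn : 0 < reC (b + n.+1%:R) by rewrite !reimE addr_gt0//; lra.
have s1 : 0 < reC a + 1 by lra.
pose K : cplx R := powC (ofR 2) b.
have p2 : powC (ofR 2) (a + (b + n.+1%:R) - 1) = K * powC (ofR 2) (a + n.+1%:R - 1).
  by rewrite /K -powCD; congr powC; ring.
have W2 : betaC a (b + n.+1%:R) - betaC a n.+1%:R =
    (wgt_int a (b + n.+1%:R) - K * wgt_int a n.+1%:R) / powC (ofR 2) (a + (b + n.+1%:R) - 1).
  rewrite /betaC p2.
  have := powC_neq0 (ofR (2 : R)) (a + n.+1%:R - 1); have : K != 0 by exact: powC_neq0.
  move: (K) (powC _ _) (wgt_int _ _) (wgt_int _ _) => k p w1 w2 k0 p0.
  by field; rewrite p0 k0.
have i1 := wgt_integrable a0 bn.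
have i2 := wgt_integrable a0 n0'.
have i3 := cintegrableZ K mI i2.
have iB := cintegrableB mI i1 i3.
have ir := integrable_mull M mI (rwgt_integrable s1 n0).
have bound : nrm (wgt_int a (b + n.+1%:R) - K * wgt_int a n.+1%:R) <=
    2 * M * nrm (wgt_int (ofR (reC a + 1)) n.+1%:R).
  rewrite /wgt_int -(integralCZ _ mI i2) -(integralCB mI i1 i3).
  apply: le_trans (integralC_bound mI iB ir _) _.
    move=> v Iv; have [h1 h2] := I11P Iv.
    have -> : wgt (a - 1) (b + n.+1%:R - 1) v - K * wgt (a - 1) (n.+1%:R - 1) v =
        (powC (ofR (1 + v)) b - K) * wgt (a - 1) (n.+1%:R - 1) v.
      rewrite mulrBl; congr (_ - _); rewrite /wgt -(addrA b) (powCD (ofR (1 + v)) b).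
      exact: mulrCA.
    rewrite nrmM (nrm_wgt _ _ Iv).
    have E : rwgt (reC a + 1) n.+1%:R v = (1 - v) * rwgt (reC a) n.+1%:R v.
      rewrite /rwgt mulrA; congr (_ * _).
      have -> : reC a + 1 - 1 = 1 + (reC a - 1) by ring.
      by rewrite (@powRD _ (1 - v) 1) ?(lt0r_neq0 h1) ?implybT// powRr1 ?(ltW h1).
    rewrite E (mulrA M) reC_nat; apply: ler_wpM2r; first by rewrite mulr_ge0// powR_ge0.
    exact: powC_mean_value.
  have -> : \int[mu]_(x in I11) (M * rwgt (reC a + 1) n.+1%:R x) =
      M * \int[mu]_(x in I11) (rwgt (reC a + 1) n.+1%:R x).
    by rewrite RintegralZl//; exact: rwgt_integrable.
  rewrite -mulrA ler_wpM2l// ler_wpM2l//.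
  rewrite -/(wgt_int (ofR (reC a + 1)) n.+1%:R) -ofR_nat (wgt_int_real s1 n0) nrm_ofR.
  exact: ler_norm.
rewrite W2 nrmM nrmV (nrm_powC _ r2).
rewrite /betaC nrmM nrmV (nrm_powC _ r2).
pose T : R := reC (ofR (reC a + 1) + n.+1%:R - 1).
have -> : reC (a + (b + n.+1%:R) - 1) = T - (1 - reC b).
  by rewrite /T !reimE; ring.
rewrite -/T (@powRB _ 2 T) ?(lt0r_neq0 r2) ?implybT// invf_div.
have t0 := powR_gt0 T r2; have u0 := powR_gt0 (1 - reC b) r2.
move: bound M0 t0 u0; move: (nrm _) (nrm _) (2 `^ T) (2 `^ (1 - reC b)) (M).
move=> y x t u m h m0 t0 u0.
have -> : 2 * m * u * (y * t^-1) = (2 * m * y) * (u / t) by ring.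
by apply: ler_wpM2r => //; rewrite divr_ge0// ltW.
Qed.

End BetaC.

(** * The Gamma function *)
Section Gamma.
Context {R : realType}.
Implicit Types (z a b : cplx R).

(** The relative increments are dominated by those of the telescoping sequence C / (n + 1). From
    some index on, the total relative variation is thus at most 1/2: the sequence is Cauchy and
    stays away from 0. *)
Lemma ratio_cvg (y : nat -> cplx R) (C : R) (N0 : nat) : 0 <= C ->
  (forall n, y n != 0) ->
  (forall n, (N0 <= n)%N -> nrm (y n.+1 - y n) <=
     nrm (y n) * (C / n.+1%:R - C / n.+2%:R)) ->
  exists2 L : cplx R, L != 0 & y @ \oo --> L.
Proof.
move=> C0 y0 H.
pose c n : R := C / n.+1%:R.
have c0 n : 0 <= c n by rewrite divr_ge0.
have cS n : c n.+1 <= c n.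
  by rewrite ler_wpM2l// lef_pV2 ?posrE// ler_nat.
(* A tail of size at most 1/4 keeps |y (n + k)| below 2 |y n|; this factor 2 turns 1/4 into the
   relative variation 1/2. *)
have [N1 HN1] := @ex_small_inv _ C (1 / 4) C0 (divr_gt0 ltr01 (ltr0Sn R 3)).
pose N := maxn N0 N1.
have cN n : (N <= n)%N -> c n <= 1 / 4.
  by move=> hn; apply: HN1; apply: leq_trans hn; rewrite leq_maxr.
have key n k : (N <= n)%N ->
    nrm (y (n + k)%N - y n) <= 2 * nrm (y n) * (c n - c (n + k)%N) /\ c (n + k)%N <= c n.
  move=> hn; elim: k => [|k [IH1 IH2]]; first by rewrite addn0 !subrr nrm0 mulr0.
  rewrite addnS; split; last exact: le_trans (cS _) IH2.
  have h1 := H (n + k)%N (leq_trans (leq_trans (leq_maxl _ _) hn) (leq_addr _ _)).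
  have h2 := nrm_dist (y (n + k)%N) (y (n + k).+1) (y n).
  have h3 : nrm (y (n + k)%N) <= 2 * nrm (y n).
    have h4 := nrmD (y (n + k)%N - y n) (y n); rewrite subrK in h4.
    have h5 := cN n hn; have h6 := c0 (n + k)%N; have h7 := nrm_ge0 (y n).
    have h8 : nrm (y n) * (c n - c (n + k)%N) <= nrm (y n) * (1 / 4).
      by apply: ler_wpM2l => //; lra.
    by clear -h4 IH1 h8 h7; lra.
  have h4 := cS (n + k)%N.
  have h5 : nrm (y (n + k)%N) * (c (n + k)%N - c (n + k).+1) <=
      2 * nrm (y n) * (c (n + k)%N - c (n + k).+1).
    by apply: ler_wpM2r => //; rewrite subr_ge0.
  apply: le_trans h2 _; apply: le_trans (lerD (le_trans h1 h5) IH1) _.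
  by rewrite -mulrDr ler_wpM2l ?mulr_ge0 ?nrm_ge0//; lra.
have small n m : (N <= n)%N -> (n <= m)%N -> nrm (y m - y n) <= 4 * nrm (y N) * c n.
  move=> hn hm; rewrite -(subnKC hm).
  have [h1 _] := key n (m - n)%N hn.
  have [h2 h3] := key N (n - N)%N (leqnn N); rewrite (subnKC hn) in h2 h3.
  have h4 := nrmD (y n - y N) (y N); rewrite subrK in h4.
  have h5 := cN N (leqnn N); have h6 := c0 n; have h7 := nrm_ge0 (y N).
  have h8 : nrm (y N) * (c N - c n) <= nrm (y N) * (1 / 4).
    by apply: ler_wpM2l => //; lra.
  have h9 : nrm (y n) <= 2 * nrm (y N) by clear -h4 h2 h8 h7; lra.
  apply: le_trans h1 _; apply: le_trans (_ : 2 * nrm (y n) * c n <= _).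
    by rewrite ler_wpM2l ?mulr_ge0 ?nrm_ge0// lerBlDr lerDl c0.
  by apply: ler_wpM2r; [exact: c0|clear -h9; lra].
have [L yL] : exists L : cplx R, y @ \oo --> L.
  apply: cplx_complete => e e0.
  have K0 : 0 < 8 * (nrm (y N) + 1) by rewrite mulr_gt0// ltr_wpDl// nrm_ge0.
  have [N2 HN2] := @ex_small_inv _ C (e / (8 * (nrm (y N) + 1))) C0 (divr_gt0 e0 K0).
  exists (maxn N N2) => n m hn hm.
  have h1 := small _ _ (leq_maxl N N2) hn; have h2 := small _ _ (leq_maxl N N2) hm.
  have := HN2 _ (leq_maxr N N2); rewrite -/(c _) ler_pdivlMr// => h3.
  have h4 := nrm_dist (y (maxn N N2)) (y n) (y m).
  rewrite [X in _ <= _ + X]nrmC in h4.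
  apply: le_trans h4 _; apply: le_trans (lerD h1 h2) _.
  have h5 := c0 (maxn N N2); have h6 := nrm_ge0 (y N).
  move: h3 h5 h6; move: (c _) (nrm _) => u v h3 h5 h6.
  by clear -h3 h5 h6; nra.
exists L => //; apply/eqP => L0.
have h1 : nrm (L - y N) <= nrm (y N) * (1 / 2).
  apply: (@cvg_le_nrm _ (fun n => y n - y N)).
    have cy : (fun _ : nat => y N) @ \oo --> y N by exact: cvg_cst.
    exact: (cvgB yL cy).
  exists N => // n /= hn; have [h _] := key N (n - N)%N (leqnn N).
  rewrite (subnKC hn) in h; apply: le_trans h _.
  have h5 := cN N (leqnn N); have h6 := c0 n; have h7 := nrm_ge0 (y N).
  rewrite -mulrA mulrCA; apply: ler_wpM2l => //; clear -h5 h6; lra.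
move: h1; rewrite L0 sub0r nrmN.
have : 0 < nrm (y N) by rewrite nrm_gt0.
by move: (nrm _) => u; lra.
Qed.

Definition gamma_seq z (n : nat) : cplx R :=
  n`!%:R * powC n%:R z / pochhammer z n.+1.

Lemma gamma_seq_neq0 z n : 0 < reC z -> gamma_seq z n != 0.
Proof.
move=> z0; rewrite /gamma_seq mulf_neq0 ?invr_neq0 ?pochhammer_neq0//.
by rewrite mulf_neq0 ?powC_neq0// pnatr_eq0 -lt0n fact_gt0.
Qed.

Lemma expC_second_order z : nrm z <= 1 / 4 ->
  nrm (expC z - 1 - z) <= 16 * expR 1 * nrm z ^+ 2.
Proof.
move=> hz; have := @Taylor1 _ (@expC R) 1 (expR 1) z ltr01.
rewrite expC0 derive1_expC expC0 mulr1 divr1; apply=> // w w1.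
rewrite nrm_expC ler_expR.
exact: le_trans (ler_norm _) (le_trans (reC_le_nrm w) (ltW w1)).
Qed.

(** Both bounds are ln (1 + x) <= x, at x = - 1 / (n + 2) and at x = 1 / (n + 1). *)
Lemma ln_step n : let w : R := ln n.+2%:R - ln n.+1%:R in
  n.+2%:R^-1 <= w /\ w <= n.+1%:R^-1.
Proof.
have n1 : 0 < n.+1%:R :> R by [].
have n2 : 0 < n.+2%:R :> R by [].
have E : n.+2%:R = n.+1%:R + 1 :> R by rewrite natr1.
split.
  have h : - (n.+2%:R)^-1 > -1 :> R by rewrite ltrN2 invf_lt1// ltr1n.
  have := le_ln1Dx h.
  have -> : 1 + - n.+2%:R^-1 = n.+1%:R / n.+2%:R :> R 
    by rewrite E; move: (n.+1%:R : R) n1 => m m0; field; apply: lt0r_neq0; lra.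
  rewrite ln_div ?posrE//; clear.
  by move: (ln (n.+1%:R : R)) (ln (n.+2%:R : R)) (n.+2%:R^-1 : R) => p q r; lra.
have h : (n.+1%:R)^-1 > -1 :> R by rewrite (lt_trans _ (_ : 0 < _)) ?invr_gt0//; lra.
have := le_ln1Dx h.
have -> : 1 + n.+1%:R^-1 = n.+2%:R / n.+1%:R :> R 
  by rewrite E; move: (n.+1%:R : R) n1 => m m0; field; apply: lt0r_neq0.
by rewrite ln_div ?posrE.
Qed.

(** Consecutive terms have ratio exp(t) / w with t = z ln((n + 2) / (n + 1)) and w = 1 + z / (n +
    2), where |w| >= 1 because Re z > 0. Then exp(t) - w is the second-order error of exp at t plus
    t - z / (n + 2), and both are of the order of 1 / (n + 1) - 1 / (n + 2). *)
Lemma gamma_seq_cvg z : 0 < reC z -> exists2 L : cplx R, L != 0 & gamma_seq z @ \oo --> L.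
Proof.
move=> z0.
(* The quadratic estimate of exp gives 16 e, doubled because 1 / (n + 1)^2 <= 2 (1 / (n + 1) - 1 /
   (n + 2)); the summand |z| serves t - z / (n + 2). *)
pose K : R := 32 * expR 1 * nrm z ^+ 2 + nrm z.
have e1 : 0 < expR (1 : R) by exact: expR_gt0.
have nz := nrm_ge0 z.
have K0 : 0 <= K by rewrite addr_ge0// mulr_ge0 ?sqr_ge0// mulr_ge0// ltW.
have [N HN] := @ex_small_inv _ (nrm z) (1 / 4) nz (divr_gt0 ltr01 (ltr0Sn R 3)).
(* The shift of the index avoids n = 0, where [powC n%:R z] would be a power of 0. *)
suff [L L0 cL] : exists2 L : cplx R, L != 0 & (fun n => gamma_seq z n.+1) @ \oo --> L.
  by exists L => //; rewrite -cvg_shiftS.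
apply: (@ratio_cvg _ K N K0) => [n|n hn]; first exact: gamma_seq_neq0.
have [h1 h2] := ln_step n.
have n1 : 0 < n.+1%:R :> R by [].
have n2 : 0 < n.+2%:R :> R by [].
pose t : cplx R := z * ofR (ln n.+2%:R - ln n.+1%:R).
pose w : cplx R := 1 + z / n.+2%:R.
have w1 : 1 <= nrm w.
  apply: le_trans (le_trans (ler_norm _) (reC_le_nrm w)).
  have -> : w = 1 + z * ofR (n.+2%:R^-1) by rewrite ofRV ofR_nat.
  by rewrite !reimE mulr0 subr0 lerDl mulr_ge0// ?ltW// invr_gt0.
have w0 : w != 0 by rewrite -nrm_gt0 (lt_le_trans ltr01).
have E : gamma_seq z n.+2 - gamma_seq z n.+1 =
    gamma_seq z n.+1 * ((expC t - 1 - z / n.+2%:R) / w).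
  have pz : pochhammer z n.+2 != 0 by exact: pochhammer_neq0.
  have zn : z + n.+2%:R != 0.
    by apply/eqP => /(congr1 (@reC R)); rewrite !reimE => h; clear -z0 n2 h; lra.
  have pw : powC n.+2%:R z = powC n.+1%:R z * expC t :> cplx R.
    rewrite -!ofR_nat !powC_ofR// -expCD; congr expC; rewrite /t ofRB; ring.
  have nc : n.+2%:R != 0 :> cplx R by rewrite pnatr_eq0.
  rewrite /gamma_seq (factS n.+1) natrM (pochhammerS _ n.+2) pw.
  have wE : w = (z + n.+2%:R) / n.+2%:R by rewrite /w mulrDl divff// addrC.
  rewrite wE; move: pz zn nc; move: (pochhammer _ _) (powC _ _) (expC _) (n.+1)`!%:R.
  move: (n.+2%:R : cplx R) => m p q e f p0 zm m0.
  by field; rewrite ?m0 ?p0 ?zm.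
rewrite E nrmM; apply: ler_wpM2l; first exact: nrm_ge0.
have tn : nrm t <= nrm z / n.+1%:R.
  rewrite nrmM nrm_ofR ger0_norm ?ler_wpM2l//.
  by apply: le_trans h1; rewrite invr_ge0 ltW.
have t4 : nrm t <= 1 / 4 by apply: le_trans tn (HN n hn).
have := expC_second_order t4.
have tw : nrm (t - z / n.+2%:R) <= nrm z * (n.+1%:R^-1 - n.+2%:R^-1).
  have -> : t - z / n.+2%:R = z * ofR (ln n.+2%:R - ln n.+1%:R - n.+2%:R^-1).
    by rewrite /t !ofRB ofRV ofR_nat; ring.
  rewrite nrmM nrm_ofR ler_wpM2l// ger0_norm ?subr_ge0//; exact: lerB h2 (lexx _).
have T2 : nrm t ^+ 2 <= 2 * nrm z ^+ 2 * (n.+1%:R^-1 - n.+2%:R^-1).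
  apply: le_trans (_ : (nrm z / n.+1%:R) ^+ 2 <= _).
    by rewrite ler_sqr ?nnegrE ?nrm_ge0// divr_ge0// ltW.
  rewrite exprMn [2 * _]mulrC -(mulrA (nrm z ^+ 2)); apply: ler_wpM2l; first exact: sqr_ge0.
  have -> : n.+2%:R = n.+1%:R + 1 :> R by rewrite natr1.
  have m1 : 1 <= n.+1%:R :> R by rewrite ler1n.
  move: (n.+1%:R : R) n1 m1 => m m0 m1.
  have -> : m^-1 - (m + 1)^-1 = (m * (m + 1))^-1 by field; rewrite !gt_eqF//; lra.
  rewrite exprVn -[X in X <= _]mul1r ler_pdivrMr ?exprn_gt0//.
  rewrite mulrAC ler_pdivlMr ?mulr_gt0//; last lra.
  by rewrite expr2; nra.
move=> h3; rewrite nrmM nrmV.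
apply: le_trans (_ : nrm (expC t - 1 - z / n.+2%:R) <= _).
  by rewrite ler_pdivrMr ?nrm_gt0// ler_peMr ?nrm_ge0.
have -> : expC t - 1 - z / n.+2%:R = (expC t - 1 - t) + (t - z / n.+2%:R) by ring.
apply: le_trans (nrmD _ _) _; apply: le_trans (lerD h3 tw) _.
have -> : K / n.+1%:R - K / n.+2%:R = K * (n.+1%:R^-1 - n.+2%:R^-1) by ring.
have h4 : 16 * expR 1 * nrm t ^+ 2 <=
    16 * expR 1 * (2 * nrm z ^+ 2 * (n.+1%:R^-1 - n.+2%:R^-1)).
  by rewrite ler_wpM2l// mulr_ge0// ltW.
apply: le_trans (lerD h4 (lexx _)) _.
by rewrite /K le_eqVlt; apply/orP; left; apply/eqP; ring.
Qed.

End Gamma.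

(** * Euler's relation between Gamma and Beta *)

Section GammaBeta.
Context {R : realType}.
Implicit Types (z a b : cplx R).

Lemma GammaC_lim z (L : cplx R) : gamma_seq z @ \oo --> L -> GammaC z = L.
Proof. by move=> h; apply: cvg_lim => //; exact: norm_hausdorff. Qed.

Lemma GammaC_cvg z : 0 < reC z -> gamma_seq z @ \oo --> GammaC z.
Proof. by move=> /gamma_seq_cvg[L _ h]; rewrite (GammaC_lim h). Qed.

Lemma GammaC_neq0 z : 0 < reC z -> GammaC z != 0.
Proof. by move=> /gamma_seq_cvg[L L0 h]; rewrite (GammaC_lim h). Qed.

Lemma cvg_ext (u v : nat -> cplx R) (l m : cplx R) : u @ \oo --> l -> u =1 v ->
  l = m -> v @ \oo --> m.
Proof. by move=> ul /funext <- <-. Qed.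

Lemma cvg_mulC (u v : nat -> cplx R) (l m : cplx R) : u @ \oo --> l -> v @ \oo --> m ->
  (fun n => u n * v n) @ \oo --> (l * m : cplx R).
Proof. exact: cvgM. Qed.

Lemma cvg_addC (u v : nat -> cplx R) (l m : cplx R) : u @ \oo --> l -> v @ \oo --> m ->
  (fun n => u n + v n) @ \oo --> (l + m : cplx R).
Proof. exact: cvgD. Qed.

Lemma cvg_inv_shiftC (c : cplx R) : (fun n => c / n.+1%:R) @ \oo --> (0 : cplx R).
Proof.
apply: cvg_nrm_le => e e0.
have [N H] := @ex_small_inv _ (nrm c) e (nrm_ge0 c) e0.
by exists N => // n /= hn; rewrite subr0 nrmM nrmV nrm_nat; exact: H.
Qed.

(** Only [z + 1] is assumed to have positive real part: Euler's sequence at [z] is the one at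
    [z + 1] divided by [z], times 1 + (z + 1) / n, and so converges as well. The argument l1 + l2 +
    l - 1 of the constant needs this range. *)
Lemma GammaC_succ z : z != 0 -> 0 < reC (z + 1) -> GammaC (z + 1) = z * GammaC z.
Proof.
move=> z0 z1.
suff H : gamma_seq z @ \oo --> GammaC (z + 1) / z.
  by rewrite (GammaC_lim H) mulrCA divff// mulr1.
have c1 : (fun n => gamma_seq (z + 1) n.+1) @ \oo --> GammaC (z + 1).
  by rewrite cvg_shiftS; exact: GammaC_cvg.
have ck (k : cplx R) : (fun _ : nat => k) @ \oo --> k by exact: cvg_cst.
have c2 := cvg_mulC (cvg_mulC c1 (ck z^-1)) (cvg_addC (ck 1) (cvg_inv_shiftC (z + 1))).
rewrite -cvg_shiftS; apply: cvg_ext c2 _ _; last by rewrite addr0 mulr1.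
move=> n; rewrite /= /gamma_seq.
have n1 : 0 < n.+1%:R :> R by [].
have pE : powC n.+1%:R (z + 1) = powC n.+1%:R z * n.+1%:R :> cplx R.
  by rewrite powCD -ofR_nat (powC_ofR1 n1).
have p0 : pochhammer (z + 1) n.+1 != 0 by exact: pochhammer_neq0.
have q0 : z + 1 + n.+1%:R != 0.
  apply/eqP => /(congr1 (@reC R)); move: z1; rewrite !reimE => h1 h2.
  by clear -h1 h2 n1; lra.
rewrite pE (pochhammerSl z) (pochhammerS _ n.+1).
have m0 : n.+1%:R != 0 :> cplx R by rewrite pnatr_eq0.
move: p0 q0 m0; move: (pochhammer _ _) (powC _ _) (_`!%:R).
move: (n.+1%:R : cplx R) => m p q f p0 q0 m0.
by field; rewrite ?m0 ?p0 ?q0 ?z0.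
Qed.

Lemma GammaC_pochhammer z n : 0 < reC z -> GammaC (z + n%:R) = pochhammer z n * GammaC z.
Proof.
move=> z0; elim: n => [|n IH]; first by rewrite addr0 pochhammer0 mul1r.
have zn : 0 < reC (z + n%:R) by rewrite !reimE ltr_wpDr.
rewrite -natr1 addrA GammaC_succ.
- by rewrite IH pochhammerS; ring.
- by apply/eqP => h; rewrite h reC0 ltxx in zn.
- by move: zn; rewrite !reimE => h; clear -h; lra.
Qed.

(** The recursion started at b = 1 gives B(a, n + 1) = n! / (a (a + 1) ... (a + n)). *)
Lemma gamma_seq_beta a n : 0 < reC a ->
  powC n%:R a * betaC a n.+1%:R = gamma_seq a n.
Proof.
move=> a0; have r1 : 0 < reC (1 : cplx R) by rewrite reC1.
have := betaC_pochhammer n a0 r1; rewrite pochhammer1.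
have -> : 1 + n%:R = n.+1%:R :> cplx R by rewrite -natr1 addrC.
have a1 : 0 < reC (a + 1) by rewrite !reimE addr_gt0.
have a00 : a != 0 by apply/eqP => h; rewrite h reC0 ltxx in a0.
have p0 := pochhammer_neq0 n a1.
have b1 := betaC_1r a0.
rewrite /gamma_seq pochhammerSl; move: p0 b1.
move: (pochhammer _ _) (powC _ _) (betaC a 1) (betaC a n.+1%:R) (_`!%:R) => p q u v f p0 b1 h.
have -> : f = a * (p * v) by rewrite h mulrCA b1 mulr1.
by field; rewrite ?p0 ?a00.
Qed.

(* The sequences n^a B(a, n + 1) and n^a B(a, b + n + 1) have the same limit,
   and the recursion of the Beta integral in b expresses both by Euler's
   sequence for Gamma. *)
Lemma GammaC_beta_ge1 a b : 0 < reC a -> 1 <= reC b ->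
  GammaC a * GammaC b = betaC a b * GammaC (a + b).
Proof.
move=> a0 b1; have b0 : 0 < reC b by apply: lt_le_trans b1.
have ab0 : 0 < reC (a + b) by rewrite !reimE addr_gt0.
pose v n : cplx R := powC n%:R a * betaC a (b + n.+1%:R).
have vE n : gamma_seq b n * v n = betaC a b * gamma_seq (a + b) n.
  rewrite /v /gamma_seq.
  have := betaC_pochhammer n.+1 a0 b0.
  have pb := pochhammer_neq0 n.+1 b0; have pab := pochhammer_neq0 n.+1 ab0.
  rewrite (powCD _ a b); move: pb pab.
  move: (pochhammer b _) (pochhammer (a + b) _) (powC _ a) (powC _ b) (betaC a b).
  move: (betaC _ _) (n`!%:R).
  move=> x f p q u w y p0 q0 h.
  have -> : y = q * x / p by rewrite h mulrAC divff ?mul1r.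
  by field; rewrite ?p0 ?q0.
have cva : v @ \oo --> GammaC a.
  have [C HC] := betaC_shift_bound a0 b1.
  have s1 : 0 < reC (ofR (reC a + 1)) by rewrite reC_ofR addr_gt0.
  have c1 := GammaC_cvg a0.
  rewrite -cvg_shiftS.
  (* With m = n + 1, [betaC_shift_bound] bounds the difference by a constant times m^(Re a) B(Re a +
     1, m + 1), which is Euler's sequence at Re a + 1 divided by m; a convergent sequence over m
     tends to 0. *)
  have c2 : (fun n => v n.+1 - gamma_seq a n.+1) @ \oo --> (0 : cplx R).
    apply: cvg_nrm_le => e e0.
    pose g := GammaC (ofR (reC a + 1)).
    have /cvg_nrm/(_ _ ltr01) [N1 _ H1] := GammaC_cvg s1.
    pose K : R := `|C| * (nrm g + 1).
    have K0 : 0 <= K by rewrite mulr_ge0// addr_ge0// nrm_ge0.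
    have [N2 H2] := @ex_small_inv _ K e K0 e0.
    exists (maxn N1 N2) => // n /= hn.
    rewrite subr0 -gamma_seq_beta// /v -mulrBr nrmM.
    have n1 : 0 < n.+1%:R :> R by [].
    have E1 (s : cplx R) : nrm (powC n.+1%:R s : cplx R) = n.+1%:R `^ reC s.
      by rewrite -ofR_nat (nrm_powC _ n1).
    have E2 : n.+1%:R `^ reC a = n.+1%:R^-1 * nrm (powC n.+1%:R (ofR (reC a + 1)) : cplx R).
      rewrite E1 reC_ofR powRD ?(lt0r_neq0 n1) ?implybT// powRr1 ?(ltW n1)//.
      by field; apply: lt0r_neq0.
    rewrite E1 E2 -mulrA.
    have h1 : nrm (gamma_seq (ofR (reC a + 1)) n.+1) <= nrm g + 1.
      have hn1 : (N1 <= n.+1)%N by rewrite (leq_trans (leq_maxl _ _) (leqW hn)).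
      have h := H1 _ hn1; have h' := nrmD (gamma_seq (ofR (reC a + 1)) n.+1 - g) g.
      by rewrite subrK in h'; apply: le_trans h' _; rewrite addrC lerD2l ltW.
    apply: le_trans (H2 n (leq_trans (leq_maxr _ _) hn)).
    rewrite [K / _]mulrC ler_wpM2l ?invr_ge0 ?(ltW n1)//.
    apply: le_trans (ler_wpM2l (nrm_ge0 _) (HC n.+1)) _.
    rewrite mulrCA -nrmM gamma_seq_beta//.
    apply: le_trans (ler_wpM2r (nrm_ge0 _) (ler_norm C)) _.
    exact: ler_wpM2l.
  have c3 : (fun n => gamma_seq a n.+1) @ \oo --> GammaC a.
    by rewrite cvg_shiftS; exact: c1.
  apply: cvg_ext (cvg_addC c2 c3) _ _; last by rewrite add0r.
  by move=> n; rewrite subrK.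
have cl := cvg_mulC (GammaC_cvg b0) cva.
have ck : (fun _ : nat => betaC a b) @ \oo --> betaC a b by exact: cvg_cst.
have cr := cvg_mulC ck (GammaC_cvg ab0).
rewrite mulrC; apply: cvg_nrm_unique cl _.
by apply: cvg_ext cr _ _ => // n; rewrite -vE.
Qed.

(** Both sides obey the same recursion in [b], so the case of [b + 1] suffices. *)
Lemma GammaC_beta a b : 0 < reC a -> 0 < reC b ->
  GammaC a * GammaC b = betaC a b * GammaC (a + b).
Proof.
move=> a0 b0.
have b1 : 1 <= reC (b + 1) by rewrite !reimE lerDr ltW.
have ab0 : 0 < reC (a + b) by rewrite !reimE addr_gt0.
have bn : b != 0 by apply/eqP => h; rewrite h reC0 ltxx in b0.
have abn : a + b != 0 by apply/eqP => h; rewrite h reC0 ltxx in ab0.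
have := GammaC_beta_ge1 a0 b1; have := betaC_succ a0 b0.
rewrite addrA !GammaC_succ//; last 2 first.
- by rewrite reC_D reC1 addr_gt0.
- by rewrite reC_D reC1 addr_gt0.
move: (GammaC a) (GammaC b) (GammaC (a + b)) (betaC a b) (betaC _ _) => ga gb gab u v h1 h2.
apply: (mulfI bn); rewrite mulrCA h2 mulrCA [RHS]mulrA -h1.
by ring.
Qed.

(** For complex parameters the integrand has no sign; that Gamma has no zeros on Re > 0 replaces
    positivity. *)
Lemma betaC_neq0 a b : 0 < reC a -> 0 < reC b -> betaC a b != 0.
Proof.
move=> a0 b0; apply/eqP => h; have := GammaC_beta a0 b0; rewrite h mul0r.
by apply/eqP; rewrite mulf_neq0 ?GammaC_neq0.
Qed.

End GammaBeta.

(** * The constant c_l and its removable singularities *)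

Section CConst.
Context {R : realType}.
Notation mu := (@lebesgue_measure R).
Notation C2 := (cplx R * cplx R)%type.
Notation I11 := (@I11 R).
Implicit Types (z a b : cplx R).

Lemma dif_expC (V : normedModType R[i]) (f : V -> cplx R) (p : V) :
  differentiable f p -> differentiable (fun q => expC (f q)) p.
Proof. by move=> df; exact: (differentiable_comp df (differentiable_expC (f p))). Qed.

Lemma dif_powC_exponent (f : C2 -> cplx R) (p : C2) z : differentiable f p ->
  differentiable (fun q => powC z (f q)) p.
Proof.
move=> df; apply: dif_expC; apply: (dif_mul df); exact: dif_cst.
Qed.

Lemma powR_between (x s t r : R) : 0 < x -> s <= r -> r <= t ->
  x `^ (r - 1) <= x `^ (s - 1) + x `^ (t - 1).
Proof.
move=> x0 sr rt; have [x1|x1] := leP x 1.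
  apply: le_trans (_ : x `^ (s - 1) <= _); last by rewrite lerDl powR_ge0.
  by apply: ger_powR; rewrite ?x0 ?x1// lerD2r.
apply: le_trans (_ : x `^ (t - 1) <= _); last by rewrite lerDr powR_ge0.
by apply: ler_powR; rewrite ?(ltW x1)// lerD2r.
Qed.

(** For parameters within [r] of [(a, b)], each real power is at most the sum of the two extreme
    ones. Multiplied out, this dominates the integrand by four weights at the corners, all
    integrable since [r] is below both real parts. *)
Lemma wgt_int_diff a b : 0 < reC a -> 0 < reC b ->
  differentiable (fun q : C2 => wgt_int q.1 q.2) (a, b).
Proof.
move=> a0 b0; have mI := @measurable_I11 R.
pose r : R := Num.min (reC a / 2) (reC b / 2).
have r0 : 0 < r by rewrite lt_min !divr_gt0.
have ra : r < reC a by rewrite gt_min; apply/orP; left; rewrite ltr_pdivrMr// ltr_pMr// ltr1n.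
have rb : r < reC b by rewrite gt_min; apply/orP; right; rewrite ltr_pdivrMr// ltr_pMr// ltr1n.
pose m v : R := rwgt (reC a - r) (reC b - r) v + rwgt (reC a - r) (reC b + r) v +
  (rwgt (reC a + r) (reC b - r) v + rwgt (reC a + r) (reC b + r) v).
have im : mu.-integrable I11 (EFin \o m).
  have h1 : 0 < reC a - r by rewrite subr_gt0.
  have h2 : 0 < reC b - r by rewrite subr_gt0.
  have h3 : 0 < reC a + r by rewrite addr_gt0.
  have h4 : 0 < reC b + r by rewrite addr_gt0.
  have i1 := integrableD mI (rwgt_integrable h1 h2) (rwgt_integrable h1 h4).
  have i2 := integrableD mI (rwgt_integrable h3 h2) (rwgt_integrable h3 h4).
  exact: (integrableD mI i1 i2).
have [|||dW _ _] := @param_integral_diff _ _ (fun (q : C2) v => wgt (q.1 - 1) (q.2 - 1) v) I11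
  (a, b) r m r0 mI im; last exact: dW.
- move=> q _; apply: continuous_cmeasurable; first exact: interval_open.
  by move=> v; exact: wgt_continuous.
- move=> v q _ _.
  have d1 := dif_powC_exponent (ofR (1 - v)) (dif_sub (dif_fst q) (dif_cst (1 : cplx R) q)).
  have d2 := dif_powC_exponent (ofR (1 + v)) (dif_sub (dif_snd q) (dif_cst (1 : cplx R) q)).
  exact: (dif_mul d1 d2).
move=> v q Iv; rewrite (nrm_pair (q.1 - a) (q.2 - b)) gt_max => /andP[qa qb].
have [h1 h2] := I11P Iv.
have ka := le_lt_trans (reC_le_nrm _) qa; have kb := le_lt_trans (reC_le_nrm _) qb.
rewrite reC_B ltr_norml in ka; rewrite reC_B ltr_norml in kb.
move/andP: ka => [ka1 ka2]; move/andP: kb => [kb1 kb2].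
rewrite (nrm_wgt _ _ Iv) {1}/rwgt.
have p1 : (1 - v) `^ (reC q.1 - 1) <=
    (1 - v) `^ (reC a - r - 1) + (1 - v) `^ (reC a + r - 1).
  by apply: powR_between => //; clear -ka1 ka2; lra.
have p2 : (1 + v) `^ (reC q.2 - 1) <=
    (1 + v) `^ (reC b - r - 1) + (1 + v) `^ (reC b + r - 1).
  by apply: powR_between => //; clear -kb1 kb2; lra.
apply: le_trans (ler_pM (powR_ge0 _ _) (powR_ge0 _ _) p1 p2) _.
by rewrite /m /rwgt le_eqVlt; apply/orP; left; apply/eqP; ring.
Qed.

Lemma betaC_continuous a b : 0 < reC a -> 0 < reC b ->
  {for ((a, b) : C2), continuous (fun q : C2 => betaC q.1 q.2)}.
Proof.
move=> a0 b0; apply: differentiable_continuous.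
apply: (dif_mul (wgt_int_diff a0 b0)).
apply: dif_inv; last exact: powC_neq0.
apply: dif_powC_exponent.
exact: (dif_sub (dif_add (dif_fst _) (dif_snd _)) (dif_cst _ _)).
Qed.

Lemma Gamma_poleN z : 0 < reC z -> ~ Gamma_pole z.
Proof.
move=> z0 [n h]; have n0 : 0 <= (n%:R : R) by [].
by move: z0; rewrite h !reimE => z0; clear -z0 n0; lra.
Qed.

(** With z = p.1 + p.2 + l - 1, the sum of the two Gamma arguments in the numerator is z + l + 1.
    The functional equation leads from there to Gamma z: its factor z + l cancels the one in the
    denominator, and the others form the Pochhammer symbol. *)
Lemma c_formulaE (l : nat) (p : C2) : 0 < reC p.1 -> 0 < reC p.2 -> c_regular l p ->
  c_formula l p =
  pochhammer (p.1 + p.2 + l%:R - 1) l / l`!%:R * betaC (p.1 + l%:R) (p.2 + l%:R).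
Proof.
move=> p1 p2 [_ _ h3 h4].
have l0 : 0 <= (l%:R : R) by [].
have a0 : 0 < reC (p.1 + l%:R) by rewrite !reimE ltr_wpDr.
have b0 : 0 < reC (p.2 + l%:R) by rewrite !reimE ltr_wpDr.
pose z : cplx R := p.1 + p.2 + l%:R - 1.
have z0 : z != 0 by apply/eqP => h; apply: h4; exists 0%N; rewrite oppr0.
have z1 : 0 < reC (z + 1) by rewrite /z subrK !reimE ltr_wpDr// addr_gt0.
have E1 : p.1 + p.2 + 2 * l%:R - 1 = z + l%:R by rewrite /z; ring.
have G1 : GammaC (p.1 + l%:R + (p.2 + l%:R)) = pochhammer z l * (z + l%:R) * GammaC z.
  (* The factor [z] is split off first, as only [z + 1] is known to have positive real part. *)
  rewrite -pochhammerS pochhammerSl mulrAC -GammaC_succ// mulrC -GammaC_pochhammer//.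
  by congr GammaC; rewrite /z; ring.
have Gz : GammaC z != 0.
  have := GammaC_neq0 z1; rewrite GammaC_succ//.
  by apply: contraNneq => ->; rewrite mulr0.
rewrite /c_formula E1 -/z (GammaC_beta a0 b0) G1.
have f0 : l`!%:R != 0 :> cplx R by rewrite pnatr_eq0 -lt0n fact_gt0.
rewrite E1 in h3.
move: Gz f0 h3; move: (GammaC z) (l`!%:R) (pochhammer z l) (betaC _ _) (z + l%:R).
move=> g f q u y g0 f0 y0.
by field; rewrite ?g0 ?f0 ?y0.
Qed.

(* The formula is regular except for l = 0 and l1 + l2 = 1, where the value is
   obtained from the continuity of the Beta integral. *)
Lemma c_constE (l : nat) (l1 l2 : cplx R) : 0 < reC l1 -> 0 < reC l2 ->
  c_const l l1 l2 =
  pochhammer (l1 + l2 + l%:R - 1) l / l`!%:R * betaC (l1 + l%:R) (l2 + l%:R).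
Proof.
move=> h1 h2; rewrite /c_const; case: ifPn => [/asboolP h|/asboolPn h].
  by rewrite (c_formulaE _ _ h).
have pole_eq (p : C2) : 0 < reC p.1 -> 0 < reC p.2 ->
    l = 0%N -> p.1 + p.2 != 1 -> c_regular l p.
  move=> p1 p2 -> p3; split; rewrite /= ?addr0.
  - exact: Gamma_poleN.
  - exact: Gamma_poleN.
  - by rewrite mulr0 addr0 subr_eq0.
  - move=> [[|n] E].
      by move: p3; rewrite -subr_eq0 E oppr0 eqxx.
    have n0 : 0 <= (n%:R : R) by [].
    move/(congr1 (@reC R)): E; rewrite -natr1 !reimE => E.
    by clear -E p1 p2 n0; lra.
have l0 : l = 0%N.
  case: l h {pole_eq} => // l h; exfalso; apply: h.
  have n0 : 0 <= (l%:R : R) by [].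
  have r1 : 0 < reC (l1 + l2 + l.+1%:R - 1) by rewrite -natr1 !reimE; lra.
  split; rewrite /=.
  - by apply: Gamma_poleN; rewrite -natr1 !reimE; lra.
  - by apply: Gamma_poleN; rewrite -natr1 !reimE; lra.
  - apply/eqP => /(congr1 (@reC R)); rewrite -natr1 !reimE => E.
    by clear -E h1 h2 n0; lra.
  - exact: Gamma_poleN.
subst l; rewrite pochhammer0 fact0 !addr0 mul1r invr1 mul1r.
have h12 : l1 + l2 = 1.
  by apply/eqP; apply: contra_notT h => h; exact: pole_eq.
(* Moving [l1] off the line l1 + l2 = 1 reaches regular points arbitrarily near, so the limit is
   taken along a proper filter. *)
have PF : ProperFilter (within (c_regular 0) (nbhs ((l1, l2) : C2))).
  apply: within_nbhs_proper => B /nbhs_nrm[d d0 HB].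
  have d2 : 0 < d / 2 by rewrite divr_gt0.
  exists (l1 + ofR (d / 2), l2); split.
    apply: pole_eq => //=; first by rewrite !reimE addr_gt0.
    by rewrite addrAC h12 addrC -subr_eq0 addrK ofR_eq0 gt_eqF.
  apply: HB; rewrite (nrm_pair (l1 + ofR (d / 2) - l1) (l2 - l2)) subrr nrm0.
  rewrite addrC addKr nrm_ofR gtr0_norm// gt_max d0 andbT.
  by rewrite ltr_pdivrMr// ltr_pMr// ltr1n.
apply: cvg_lim; first exact: norm_hausdorff.
have cb : (fun q : C2 => betaC q.1 q.2) @ within (c_regular 0) (nbhs ((l1, l2) : C2)) -->
    betaC l1 l2.
  exact: cvg_within_filter (betaC_continuous h1 h2).
apply: cvg_trans cb; apply: near_eq_cvg; rewrite near_withinE.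
apply/nbhs_nrm; exists (Num.min (reC l1) (reC l2)); first by rewrite lt_min h1.
move=> q; rewrite (nrm_pair (q.1 - l1) (q.2 - l2)) gt_max !lt_min => /andP[/andP[qa _] /andP[_ qb]] rq.
have ka := le_lt_trans (reC_le_nrm _) qa; have kb := le_lt_trans (reC_le_nrm _) qb.
rewrite reC_B ltr_norml in ka; rewrite reC_B ltr_norml in kb.
move/andP: ka => [ka _]; move/andP: kb => [kb _].
have q1 : 0 < reC q.1 by clear -ka; lra.
have q2 : 0 < reC q.2 by clear -kb; lra.
by rewrite (c_formulaE q1 q2 rq) pochhammer0 fact0 !addr0 invr1 !mul1r.
Qed.

End CConst.

(** * The Euler-Poisson-Darboux transform *)
Section Segment.
Context {R : realType}.
Notation mu := (@lebesgue_measure R).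
Notation C2 := (cplx R * cplx R)%type.
Notation Pi2 := (@halfplane2 R).
Notation I11 := (@I11 R).
Implicit Types (z w a b : cplx R) (p q : C2) (v : R) (g : cplx R -> cplx R).

(** A convex combination for v in [-1, 1], which therefore stays in the half-plane; [segE] is the
    form occurring in [Psi]. *)
Definition seg p v : cplx R := p.1 * ofR ((1 - v) / 2) + p.2 * ofR ((1 + v) / 2).

Lemma segE p v : seg p v = ((p.2 - p.1) * ofR v + (p.1 + p.2)) / 2.
Proof.
have E2 : ofR (2 : R) = 2 := ofR_nat 2.
by rewrite /seg !ofRM !ofRV E2 ofRB (ofRD 1 v) ofR1; ring.
Qed.

Lemma halfplane_derive1 g : (forall z, halfplane z -> differentiable g z) ->
  forall z, halfplane z -> differentiable (derive1 g) z.
Proof.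
move=> dg z z0; apply: (@disc_derive1 _ g z (imC z)); last by rewrite /disc/= subrr nrm0.
move=> w; rewrite /disc/= => wz; apply: dg; rewrite /halfplane/=.
have := le_lt_trans (imC_le_nrm _) wz; rewrite imC_B ltr_norml => /andP[h _].
by clear -h; lra.
Qed.

Lemma seg_halfplane p v : Pi2 p -> -1 <= v <= 1 -> halfplane (seg p v).
Proof.
rewrite /halfplane2/halfplane/= => -[p1 p2] /andP[v1 v2]; rewrite /seg !reimE.
by move: (imC p.1) (imC p.2) (reC p.1) (reC p.2) p1 p2 => x y s t x0 y0; nra.
Qed.

Lemma seg_continuous2 p v : {for (v, p), continuous (fun t : R * C2 => seg t.2 t.1)}.
Proof.
pose T := (R * C2)%type; pose t0 : T := (v, p).
have cst (c : cplx R) : {for t0, continuous (fun _ : T => c)} by exact: cvg_cst.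
have c1 : {for t0, continuous (fun t : T => t.2.1)}.
  by apply: (@continuous_comp _ _ _ snd fst); [exact: cvg_snd|exact: cvg_fst].
have c2 : {for t0, continuous (fun t : T => t.2.2)}.
  by apply: (@continuous_comp _ _ _ snd snd); [exact: cvg_snd|exact: cvg_snd].
have cv : {for t0, continuous (fun t : T => ofR t.1)}.
  by apply: (@continuous_comp _ _ _ fst (@ofR R)); [exact: cvg_fst|exact: continuous_ofR].
have ca : {for t0, continuous (fun t : T => t.2.2 - t.2.1)} by exact: cvgB c2 c1.
have cb : {for t0, continuous (fun t : T => t.2.1 + t.2.2)} by exact: cvgD c1 c2.
have cc := continuous_mul ca cv.
have cd : {for t0, continuous (fun t : T => (t.2.2 - t.2.1) * ofR t.1 + (t.2.1 + t.2.2))}.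
  exact: cvgD cc cb.
apply: eq_continuous (continuous_mul cd (cst 2^-1)) => t.
by rewrite segE.
Qed.

Lemma cder_seg p v : cder (seg p) v ((p.2 - p.1) / 2).
Proof.
have d1 : is_derive v 1 (fun v : R => v) 1 by exact: is_derive_id.
pose c : cplx R := (p.2 - p.1) / 2.
have := cderD (cderM (cder_cst c v) (cder_ofR d1)) (cder_cst ((p.1 + p.2) / 2) v).
have -> : (fun x => c * ofR x + (p.1 + p.2) / 2) = seg p.
  by apply/funext => x; rewrite segE /c; ring.
by move=> H; apply: cder_eq H _; rewrite ofR1 /c; ring.
Qed.

(** Differentiation under the integral needs one bound for all [q] near [p]: the maximum along the
    segment of [p], plus 1 by uniform continuity. *)
Lemma seg_bound g p : (forall z, halfplane z -> differentiable g z) -> Pi2 p ->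
  exists M, exists2 rho : R, 0 < rho & forall q, nrm (q - p) < rho ->
    Pi2 q /\ forall v, I11 v -> nrm (g (seg q v)) <= M.
Proof.
move=> dg hp.
have cH t : t \in `[(-1), 1] -> {for (t, p), continuous (fun x : R * C2 => g (seg x.2 x.1))}.
  rewrite in_itv/= => ht.
  apply: (@continuous_comp _ _ _ (fun x : R * C2 => seg x.2 x.1) g); first exact: seg_continuous2.
  exact: differentiable_continuous (dg _ (seg_halfplane hp ht)).
have c : {within `[(-1), 1], continuous (fun t => nrm (g (seg p t)))}.
  apply: continuous_in_subspaceT => t; rewrite inE => ht; apply: continuous_nrm.
  apply: (@continuous_comp _ _ _ (seg p) g); first exact: cder_continuous (cder_seg p t).
  by move: ht; rewrite /= in_itv/= => ht; exact: differentiable_continuous (dg _ (seg_halfplane hp ht)).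
have m11 : -1 <= 1 :> R by lra.
have [t0 _ tM] := EVT_max m11 c.
have := @unif_near _ (C2 : topologicalType) p (fun q t => g (seg q t)) (-1) 1 cH 1 ltr01.
move=> /nbhs_nrm[d d0 Hd].
have [d' d'0 Hd'] := halfplane2_ball hp.
exists (nrm (g (seg p t0)) + 1); exists (Num.min d d'); first by rewrite lt_min d0.
move=> q; rewrite lt_min => /andP[h1 h2]; split; first exact: Hd'.
move=> v; rewrite /I11/= => hv.
have hv' : v \in `[(-1), 1] by move: hv; rewrite !in_itv/= => /andP[? ?]; apply/andP; split; apply: ltW.
have h3 := Hd _ h1 _ hv'; have h4 := tM _ hv'.
have h5 := nrmD (g (seg q v) - g (seg p v)) (g (seg p v)); rewrite subrK in h5.
by apply: le_trans h5 _; rewrite addrC; apply: lerD => //; exact: ltW.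
Qed.

Lemma I11_itv v : I11 v -> -1 <= v <= 1.
Proof. by move=> /I11P[h1 h2]; apply/andP; split; lra. Qed.

Lemma dif_seg g v q : (forall z, halfplane z -> differentiable g z) -> Pi2 q -> I11 v ->
  [/\ differentiable (fun q => g (seg q v)) q,
      partial1 (fun q => g (seg q v)) q = ofR ((1 - v) / 2) * derive1 g (seg q v) &
      partial2 (fun q => g (seg q v)) q = ofR ((1 + v) / 2) * derive1 g (seg q v)].
Proof.
move=> dg hq /I11_itv hv; have dgs := dg _ (seg_halfplane hq hv).
have ds : differentiable (fun q => seg q v) q.
  exact: (dif_add (dif_mul (dif_fst q) (dif_cst _ q)) (dif_mul (dif_snd q) (dif_cst _ q))).
split; first exact: (differentiable_comp ds dgs).
  pose k : cplx R := q.2 * ofR ((1 + v) / 2); pose h : cplx R := ofR ((1 - v) / 2).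
  have E z : seg (z, q.2) v = k + z *: h by rewrite /seg addrC.
  have E0 : seg q v = k + q.1 *: h by rewrite -E; case: (q).
  rewrite E0 in dgs; have [_ H] := derive1_line dgs.
  rewrite /partial1; have -> : (fun z => g (seg (z, q.2) v)) = (fun z : cplx R => g (k + z *: h)).
    by apply/funext => z; rewrite E.
  by rewrite E0; refine (etrans H _); exact: diffE1.
pose k : cplx R := q.1 * ofR ((1 - v) / 2); pose h : cplx R := ofR ((1 + v) / 2).
have E z : seg (q.1, z) v = k + z *: h by [].
have E0 : seg q v = k + q.2 *: h by [].
rewrite E0 in dgs; have [_ H] := derive1_line dgs.
rewrite E0; refine (etrans H _); exact: diffE1.
Qed.

Definition seg_int g a b p : cplx R :=
  integralC I11 (fun v => wgt (a - 1) (b - 1) v * g (seg p v)).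

Lemma g_seg_continuous g p v : (forall z, halfplane z -> differentiable g z) -> Pi2 p ->
  I11 v -> {for v, continuous (fun v => g (seg p v))}.
Proof.
move=> dg hp /I11_itv hv.
apply: (@continuous_comp _ _ _ (seg p) g v (cder_continuous (cder_seg p v))).
exact: differentiable_continuous (dg _ (seg_halfplane hp hv)).
Qed.

Lemma seg_int_measurable g a b p : (forall z, halfplane z -> differentiable g z) -> Pi2 p ->
  cmeasurable I11 (fun v => wgt (a - 1) (b - 1) v * g (seg p v)).
Proof.
move=> dg hp; apply: continuous_cmeasurable; first exact: interval_open.
move=> v Iv; apply: continuous_mul; first exact: wgt_continuous.
exact: g_seg_continuous.
Qed.

Lemma seg_int_integrable g a b p : (forall z, halfplane z -> differentiable g z) -> Pi2 p ->
  0 < reC a -> 0 < reC b ->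
  cintegrable I11 (fun v => wgt (a - 1) (b - 1) v * g (seg p v)).
Proof.
move=> dg hp a0 b0; have mI := @measurable_I11 R.
have [M [rho r0 HM]] := seg_bound dg hp.
apply: (cintegrable_dominated mI (seg_int_measurable a b dg hp)
  (integrable_mull M mI (rwgt_integrable a0 b0))).
move=> v Iv; rewrite nrmM (nrm_wgt _ _ Iv) mulrC; apply: ler_wpM2r.
  by rewrite mulr_ge0// powR_ge0.
have pp : nrm (p - p) < rho by rewrite subrr nrm0.
by have [_ h] := HM _ pp; exact: h.
Qed.

(** The derivative in z1 brings the factor (1 - v) / 2, which raises the first exponent; the one in
    z2 brings (1 + v) / 2, which raises the second. *)
Lemma seg_int_diff g a b p : (forall z, halfplane z -> differentiable g z) -> Pi2 p ->
  0 < reC a -> 0 < reC b ->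
  [/\ differentiable (seg_int g a b) p,
      partial1 (seg_int g a b) p = 2^-1 * seg_int (derive1 g) (a + 1) b p &
      partial2 (seg_int g a b) p = 2^-1 * seg_int (derive1 g) a (b + 1) p].
Proof.
move=> dg hp a0 b0; have mI := @measurable_I11 R.
have [M [rho r0 HM]] := seg_bound dg hp.
pose F q v : cplx R := wgt (a - 1) (b - 1) v * g (seg q v).
have dF v q : I11 v -> nrm (q - p) < rho -> differentiable (F ^~ v) q.
  move=> Iv /HM[hq _]; have [d _ _] := dif_seg dg hq Iv.
  exact: (dif_mul (dif_cst _ q) d).
have [|||dW _ H] := @param_integral_diff _ _ F I11 p rho (fun v => M * rwgt (reC a) (reC b) v) r0 mI
  (integrable_mull M mI (rwgt_integrable a0 b0)).
- by move=> q /HM[hq _]; exact: seg_int_measurable.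
- exact: dF.
- move=> v q Iv /HM[_ h]; rewrite nrmM (nrm_wgt _ _ Iv) mulrC; apply: ler_wpM2r.
    by rewrite mulr_ge0// powR_ge0.
  exact: h.
have dg' := halfplane_derive1 dg.
have a1 : 0 < reC (a + 1) by rewrite reC_D reC1 addr_gt0.
have b1 : 0 < reC (b + 1) by rewrite reC_D reC1 addr_gt0.
have pp : nrm (p - p) < rho by rewrite subrr nrm0.
split; first exact: dW.
  refine (etrans (partial1E dW) _); refine (etrans (H _) _).
  rewrite /seg_int -(integralCZ _ mI (seg_int_integrable dg' hp a1 b0)) addrK.
  apply: eq_integralC => v Iv; refine (etrans (esym (partial1E (dF v p Iv pp))) _).
  have [d d1 _] := dif_seg dg hp Iv.
  refine (etrans (partial1_scale _ d) _).
  refine (etrans (congr1 _ d1) _).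
  rewrite (wgtSl a (b - 1) Iv) ofRM ofRV ofR_nat.
  move: (derive1 g _) (wgt _ _ _) (ofR _) => x y u; ring.
refine (etrans (partial2E dW) _); refine (etrans (H _) _).
rewrite /seg_int -(integralCZ _ mI (seg_int_integrable dg' hp a0 b1)) addrK.
apply: eq_integralC => v Iv; refine (etrans (esym (partial2E (dF v p Iv pp))) _).
have [d _ d2] := dif_seg dg hp Iv.
refine (etrans (partial2_scale _ d) _).
refine (etrans (congr1 _ d2) _).
rewrite (wgtSr (a - 1) b Iv) ofRM ofRV ofR_nat.
move: (derive1 g _) (wgt _ _ _) (ofR _) => x y u; ring.
Qed.

Lemma EPD_algebra (a b x y w z1 z2 : cplx R) : (z2 - z1) / 2 * x = a * y - b * w ->
  (z1 - z2) * (2^-1 * (2^-1 * x)) = b * (2^-1 * w) - a * (2^-1 * y).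
Proof.
move=> h; have -> : (z1 - z2) * (2^-1 * (2^-1 * x)) = - 2^-1 * ((z2 - z1) / 2 * x) by ring.
by rewrite h; ring.
Qed.

(** Along the segment g' has v-derivative g'' (z2 - z1) / 2. Its integral against the weight with
    exponents [a] and [b], taken by parts, gives the two integrals of g' that are the first partial
    derivatives up to the factor 1/2. *)
Lemma seg_int_EPD g a b : (forall z, halfplane z -> differentiable g z) ->
  0 < reC a -> 0 < reC b -> forall p, Pi2 p ->
  diagX p * partial1 (partial2 (seg_int g a b)) p =
  b * partial1 (seg_int g a b) p - a * partial2 (seg_int g a b) p.
Proof.
move=> dg a0 b0 p hp; have mI := @measurable_I11 R.
have dg' := halfplane_derive1 dg; have dg'' := halfplane_derive1 dg'.
have a1 : 0 < reC (a + 1) by rewrite reC_D reC1 addr_gt0.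
have b1 : 0 < reC (b + 1) by rewrite reC_D reC1 addr_gt0.
have [_ P1 P2] := seg_int_diff dg hp a0 b0.
have P12 : partial1 (partial2 (seg_int g a b)) p =
    2^-1 * (2^-1 * seg_int (derive1 (derive1 g)) (a + 1) (b + 1) p).
  have E : eq_on (partial2 (seg_int g a b)) (fun q => 2^-1 * seg_int (derive1 g) a (b + 1) q).
    by move=> q hq; have [_ _ h] := seg_int_diff dg hq a0 b0; exact: h.
  refine (etrans (eq_on_partial1 E hp) _).
  have [d h _] := seg_int_diff dg' hp a0 b1.
  refine (etrans (partial1_scale _ d) _).
  by refine (congr1 _ h).
refine (etrans (congr1 _ P12) _).
refine (etrans _ (esym (congr2 (fun x y => b * x - a * y) P1 P2))).
have [M1 [r1 r10 HM1]] := seg_bound dg' hp.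
have [M2 [r2 r20 HM2]] := seg_bound dg'' hp.
pose c : cplx R := (p.2 - p.1) / 2.
pose M : R := `|M1| + nrm c * `|M2|.
have pp : nrm (p - p) = 0 by rewrite subrr nrm0.
have cH v : I11 v -> cder (fun v => derive1 g (seg p v)) v (derive1 (derive1 g) (seg p v) * c).
  move=> Iv; apply: cder_comp; first exact: dg' _ (seg_halfplane hp (I11_itv Iv)).
  exact: cder_seg.
have := @wgt_by_parts _ (fun v => derive1 g (seg p v))
  (fun v => derive1 (derive1 g) (seg p v) * c) M a b a0 b0 cH.
have -> : integralC I11 (fun v => derive1 (derive1 g) (seg p v) * c * wgt a b v) =
    c * seg_int (derive1 (derive1 g)) (a + 1) (b + 1) p.
  rewrite /seg_int -(integralCZ _ mI (seg_int_integrable dg'' hp a1 b1)) !addrK.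
  apply: eq_integralC => v Iv; move: (derive1 _ _) (wgt _ _ _) (c) => x y u.
  by ring.
have -> : integralC I11 (fun v => derive1 g (seg p v) * wgt (a - 1) b v) =
    seg_int (derive1 g) a (b + 1) p.
  by rewrite /seg_int addrK; apply: eq_integralC => v Iv; rewrite mulrC.
have -> : integralC I11 (fun v => derive1 g (seg p v) * wgt a (b - 1) v) =
    seg_int (derive1 g) (a + 1) b p.
  by rewrite /seg_int addrK; apply: eq_integralC => v Iv; rewrite mulrC.
move=> H.
have {}H : c * seg_int (derive1 (derive1 g)) (a + 1) (b + 1) p =
    a * seg_int (derive1 g) a (b + 1) p - b * seg_int (derive1 g) (a + 1) b p.
  apply: H => v Iv.
  - have cc : {for v, continuous (fun _ : R => c)} by exact: cvg_cst.
    exact: (continuous_mul (g_seg_continuous dg'' hp Iv) cc).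
  - have [_ h] := HM1 p (eq_ind_r (fun x => x < r1) r10 pp).
    apply: le_trans (h v Iv) _; apply: le_trans (ler_norm _) _.
    by rewrite lerDl mulr_ge0// nrm_ge0.
  - have [_ h] := HM2 p (eq_ind_r (fun x => x < r2) r20 pp).
    rewrite nrmM mulrC; apply: le_trans (_ : nrm c * `|M2| <= _); last by rewrite lerDr.
    apply: ler_wpM2l; first exact: nrm_ge0.
    exact: le_trans (h v Iv) (ler_norm _).
exact: EPD_algebra H.
Qed.

Lemma seg_int_diag g a b w : 0 < reC a -> 0 < reC b ->
  seg_int g a b (w, w) = g w * wgt_int a b.
Proof.
move=> a0 b0; rewrite /seg_int /wgt_int -(integralCZ _ (@measurable_I11 R) (wgt_integrable a0 b0)).
apply: eq_integralC => v _; rewrite mulrC; congr (g _ * _).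
by rewrite segE/= subrr mul0r add0r; field.
Qed.

End Segment.

(** * Solutions of the eigenvalue equation *)
Section Solutions.
Context {R : realType}.
Notation C2 := (cplx R * cplx R)%type.
Notation Pi2 := (@halfplane2 R).
Implicit Types (z w a b : cplx R) (p q : C2) (f g V : C2 -> cplx R) (u : cplx R -> cplx R).

Lemma extend0_in T (D : set T) (h : T -> cplx R) x : D x -> extend0 D h x = h x.
Proof. by move=> Dx; rewrite /extend0 patchT// inE. Qed.

Lemma extend0_out T (D : set T) (h : T -> cplx R) x : ~ D x -> extend0 D h x = 0.
Proof. by move=> Dx; rewrite /extend0 patchN// notin_setE. Qed.

Lemma eq_on_extend0 f : eq_on f (extend0 Pi2 f).
Proof. by move=> p hp; rewrite extend0_in. Qed.

Lemma opP_congr (l1 l2 k m x x' y y' v v' : cplx R) : x = x' -> y = y' -> v = v' ->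
  m * v - k * (l2 * x - l1 * y) = m * v' - k * (l2 * x' - l1 * y').
Proof. by move=> -> -> ->. Qed.

Lemma opP_algebra (l1 l2 k m x x1 x2 y y1 y2 v v1 v2 : cplx R) :
  x = x1 - x2 -> y = y1 - y2 -> v = v1 - v2 ->
  m * v - k * (l2 * x - l1 * y) =
  (m * v1 - k * (l2 * x1 - l1 * y1)) - (m * v2 - k * (l2 * x2 - l1 * y2)).
Proof. by move=> -> -> ->; ring. Qed.

Lemma eq_on_opP (l1 l2 : cplx R) f g : eq_on f g -> eq_on (opP l1 l2 f) (opP l1 l2 g).
Proof.
move=> fg p hp; rewrite /opP.
have E12 := eq_on_partial1 (eq_on_partial2 fg) hp.
exact: opP_congr (eq_on_partial1 fg hp) (eq_on_partial2 fg hp) E12.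
Qed.

Lemma dif_scale V p (c : cplx R) : differentiable V p -> differentiable (fun q => c * V q) p.
Proof. by move=> dV; apply: (dif_mul _ dV); exact: dif_cst. Qed.

Lemma partial1_sub f g p : differentiable f p -> differentiable g p ->
  partial1 (fun q => f q - g q) p = partial1 f p - partial1 g p.
Proof.
move=> df dg; have -> : (fun q => f q - g q) = (fun q => f q + -1 * g q).
  by apply/funext => q; rewrite mulN1r.
refine (etrans (partial1_add df (dif_scale (-1) dg)) _).
by refine (etrans (congr1 _ (partial1_scale (-1) dg)) _); rewrite mulN1r.
Qed.

Lemma partial2_sub f g p : differentiable f p -> differentiable g p ->
  partial2 (fun q => f q - g q) p = partial2 f p - partial2 g p.
Proof.
move=> df dg; have -> : (fun q => f q - g q) = (fun q => f q + -1 * g q).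
  by apply/funext => q; rewrite mulN1r.
refine (etrans (partial2_add df (dif_scale (-1) dg)) _).
by refine (etrans (congr1 _ (partial2_scale (-1) dg)) _); rewrite mulN1r.
Qed.

Lemma hol2_sub f g : hol2 f -> hol2 g -> hol2 (fun q => f q - g q).
Proof. by move=> hf hg p hp; exact: (dif_sub (hf p hp) (hg p hp)). Qed.

Lemma opP_sub (l1 l2 : cplx R) f g : hol2 f -> hol2 g ->
  eq_on (opP l1 l2 (fun q => f q - g q)) (fun p => opP l1 l2 f p - opP l1 l2 g p).
Proof.
move=> hf hg p hp.
have E1 := partial1_sub (hf p hp) (hg p hp).
have E2 := partial2_sub (hf p hp) (hg p hp).
have E12 : partial1 (partial2 (fun q => f q - g q)) p =
    partial1 (partial2 f) p - partial1 (partial2 g) p.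
  have E : eq_on (partial2 (fun q => f q - g q)) (fun q => partial2 f q - partial2 g q).
    by move=> q hq; exact: partial2_sub (hf q hq) (hg q hq).
  refine (etrans (eq_on_partial1 E hp) _).
  exact: partial1_sub (hol2_partial2 hf hp) (hol2_partial2 hg hp).
rewrite /opP; exact: opP_algebra E1 E2 E12.
Qed.

Lemma iter_partial1_sub f g n : hol2 f -> hol2 g ->
  eq_on (iter n partial1 (fun q => f q - g q))
        (fun q => iter n partial1 f q - iter n partial1 g q).
Proof.
move=> hf hg; elim: n => [|n IH] // p hp.
refine (etrans (eq_on_partial1 IH hp) _).
exact: partial1_sub (hol2_iter1 n hf hp) (hol2_iter1 n hg hp).
Qed.

Lemma separated_partials (u w : cplx R -> cplx R) :
  (forall z, halfplane z -> differentiable u z) ->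
  (forall z, halfplane z -> differentiable w z) ->
  forall p, Pi2 p ->
  [/\ differentiable (fun q : C2 => u q.1 * w q.2) p,
      partial1 (fun q => u q.1 * w q.2) p = derive1 u p.1 * w p.2 &
      partial2 (fun q => u q.1 * w q.2) p = u p.1 * derive1 w p.2].
Proof.
move=> du dw p [p1 p2].
have d1 : differentiable (fun q : C2 => u q.1) p.
  exact: (differentiable_comp (dif_fst p) (du _ p1)).
have d2 : differentiable (fun q : C2 => w q.2) p.
  exact: (differentiable_comp (dif_snd p) (dw _ p2)).
split; first exact: (dif_mul d1 d2).
  refine (etrans (partial1_mul d1 d2) _).
  have -> : partial1 (fun q : C2 => w q.2) p = 0 by exact: derive1_const.
  have -> : partial1 (fun q : C2 => u q.1) p = derive1 u p.1 by [].
  by rewrite mulr0 add0r mulrC.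
refine (etrans (partial2_mul d1 d2) _).
have -> : partial2 (fun q : C2 => u q.1) p = 0 by exact: derive1_const.
have -> : partial2 (fun q : C2 => w q.2) p = derive1 w p.2 by [].
by rewrite mulr0 addr0.
Qed.

Lemma halfplane_shift z : halfplane z -> halfplane (z + iC).
Proof. by rewrite /halfplane/= !reimE => h; rewrite addr_gt0. Qed.

Lemma dif_shifted_pow s z : halfplane z -> differentiable (fun w : cplx R => powC (w + iC) s) z /\
  derive1 (fun w : cplx R => powC (w + iC) s) z = s / (z + iC) * powC (z + iC) s.
Proof.
move=> /halfplane_shift hz.
have H := is_diff_powC s hz.
have E : (fun w : cplx R => powC (w + iC) s) = (fun w => (fun x => powC x s) (iC + w)).
  by apply/funext => w; rewrite addrC.
rewrite E; split.
  have ds : differentiable (fun w : cplx R => iC + w) z.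
    exact: (dif_add (dif_cst iC z) (dif_id z)).
  have dp : differentiable (fun x : cplx R => powC x s) (iC + z).
    by rewrite [iC + z]addrC; exact: ex_diff.
  exact: (differentiable_comp ds dp).
refine (etrans (derive1_shift (fun x => powC x s) iC z) _).
by rewrite [iC + z]addrC; exact: is_diff_derive1.
Qed.

Lemma power_EPD_algebra (a b c s t x y : cplx R) : s + c != 0 -> t + c != 0 ->
  (s - t) * (- a / (s + c) * x * (- b / (t + c) * y)) =
  b * (- a / (s + c) * x * y) - a * (x * (- b / (t + c) * y)).
Proof. by move=> h1 h2; field; rewrite h1 h2. Qed.

Lemma power_EPD a b : let V := fun p : C2 => powC (p.1 + iC) (- a) * powC (p.2 + iC) (- b) in
  hol2 V /\ forall p, Pi2 p ->
  diagX p * partial1 (partial2 V) p = b * partial1 V p - a * partial2 V p.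
Proof.
pose u s z : cplx R := powC (z + iC) s.
have du s z : halfplane z -> differentiable (u s) z by move=> /(dif_shifted_pow s)[].
have Du s z : halfplane z -> derive1 (u s) z = s / (z + iC) * u s z.
  by move=> /(dif_shifted_pow s)[].
have S := separated_partials (du (- a)) (du (- b)).
have S' := separated_partials (du (- a)) (halfplane_derive1 (du (- b))).
move=> V; split=> [p hp|p hp]; first by have [h _ _] := S p hp; exact: h.
have [_ P1 P2] := S p hp.
have P12 : partial1 (partial2 V) p = derive1 (u (- a)) p.1 * derive1 (u (- b)) p.2.
  have E : eq_on (partial2 V) (fun q => u (- a) q.1 * derive1 (u (- b)) q.2).
    by move=> q hq; have [_ _ h] := S q hq; exact: h.
  refine (etrans (eq_on_partial1 E hp) _).
  by have [_ h _] := S' p hp; exact: h.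
refine (etrans (congr1 _ P12) _).
refine (etrans _ (esym (congr2 (fun x y => b * x - a * y) P1 P2))).
have [p1 p2] := hp.
rewrite (Du _ _ p1) (Du _ _ p2) /diagX.
have z1 := halfplane_neq0 (halfplane_shift p1); have z2 := halfplane_neq0 (halfplane_shift p2).
exact: power_EPD_algebra.
Qed.

Lemma Sol_diagX (l1 l2 : cplx R) l V : hol2 V ->
  (forall p, Pi2 p -> diagX p * partial1 (partial2 V) p =
     (l2 + l%:R) * partial1 V p - (l1 + l%:R) * partial2 V p) ->
  Sol l1 l2 (- l%:R * (l1 + l2 + l%:R - 1)) (extend0 halfplane2 (fun p => diagX p ^+ l * V p)).
Proof.
move=> hV EPD; have E := @eq_on_extend0 (fun p => diagX p ^+ l * V p).
split.
  split; last by move=> p; exact: extend0_out.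
  exact: eq_on_hol2 E (hol2_diagX_exp l hV).
move=> p hp; rewrite -(eq_on_opP l1 l2 E hp) extend0_in//.
by have := diagX_exp_eigen l hV EPD hp; rewrite !addrK.
Qed.

Lemma Sol_powers (l1 l2 : cplx R) l :
  Sol l1 l2 (- l%:R * (l1 + l2 + l%:R - 1))
    (extend0 halfplane2 (fun p =>
       (p.1 - p.2) ^+ l * powC (p.1 + iC) (- l1 - l%:R) * powC (p.2 + iC) (- l2 - l%:R))).
Proof.
have [hV EPD] := power_EPD (l1 + l%:R) (l2 + l%:R).
have := Sol_diagX hV EPD; congr (Sol _ _ _ (extend0 _ _)).
by apply/funext => p; rewrite /diagX mulrA !opprD.
Qed.

Lemma Sol0 (l1 l2 mu : cplx R) : Sol l1 l2 mu (fun=> 0).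
Proof.
split; first by split=> // p _; exact: dif_cst.
move=> p hp; rewrite mulr0 /opP.
have E1 : partial1 (fun=> 0) p = 0 := partial1_cst 0 p.
have E2 : partial2 (fun=> 0) p = 0 := partial2_cst 0 p.
have -> : partial2 (fun=> 0) = (fun=> 0 : cplx R).
  by apply/funext => q; exact: partial2_cst.
by rewrite E1; rewrite !mulr0 subrr mulr0 subrr.
Qed.

Lemma Sol_order (l1 l2 mu : cplx R) f : Sol l1 l2 mu f -> f <> (fun=> 0) ->
  exists k, [/\ diag_flat f k, (exists2 w, halfplane w & iter k partial1 f (w, w) != 0) &
    mu = - k%:R * (l1 + l2 + k%:R - 1)].
Proof.
move=> [[hf f0] ef] fn.
have [k [fl ex]] : exists k, diag_flat f k /\
    exists2 w, halfplane w & iter k partial1 f (w, w) != 0.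
  apply: (diag_order hf); apply: contra_notP fn => H.
  apply/funext => p; have [hp|hp] := pselect (Pi2 p); last exact: f0.
  by apply/eqP; apply: contra_notT H => fp; exists p.
by exists k; split=> //; exact: (order_eigenvalue hf ef fl ex).
Qed.

Lemma Sol_neq0P (l1 l2 mu : cplx R) : Sol l1 l2 mu <> [set (fun=> 0)] <->
  exists l : nat, mu = - l%:R * (l1 + l2 + l%:R - 1).
Proof.
split=> [H|[l ->] E].
  have [f [Sf fn]] : exists f, Sol l1 l2 mu f /\ f <> (fun=> 0).
    apply: contra_notP H => H; apply/seteqP; split=> [f Sf|f ->]; last exact: Sol0.
    by apply: contra_notP H => fn; exists f.
  by have [k [_ _ h]] := Sol_order Sf fn; exists k.
(* The explicit eigenfunction is nonzero at (i, 2 i), where its first factor is (- i)^l. *)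
have := Sol_powers l1 l2 l; rewrite E => /(congr1 (fun f => f (iC, iC + iC))).
have hi1 : halfplane (iC : cplx R) by exact: (@ltr01 R).
have hi : Pi2 (iC, iC + iC) by split => //; exact: halfplane_shift.
have i0 : iC != 0 :> cplx R by rewrite -nrm_gt0 nrm_iC.
rewrite extend0_in//= opprD addrA subrr sub0r => /eqP.
apply/negP; apply: mulf_neq0; [apply: mulf_neq0|]; try exact: powC_neq0.
by apply: expf_neq0; rewrite oppr_eq0.
Qed.

End Solutions.

(** * Vandermonde convolution and the Rankin-Cohen operator *)

Section Vandermonde.
Context {F : comPzRingType}.
Implicit Types (x y : F).

Definition ffactR x (n : nat) : F := \prod_(i < n) (x - i%:R).

Lemma ffactRS x n : ffactR x n.+1 = ffactR x n * (x - n%:R).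
Proof. by rewrite /ffactR big_ord_recr. Qed.

(** Pascal's rule in the shape of the Leibniz rule: a higher degree increments either the index of
    [A] or that of [B]. *)
Lemma binomial_convolution (A B : nat -> F) n :
  \sum_(j < n.+2) (A j * B (n.+1 - j)%N) *+ 'C(n.+1, j) =
  \sum_(j < n.+1) (A j.+1 * B (n - j)%N + A j * B (n - j).+1) *+ 'C(n, j).
Proof.
rewrite big_ord_recl /= bin0 subn0.
under eq_bigr => i _ do rewrite /= /bump /= add1n subSS binS mulrnDr.
rewrite big_split /= [X in _ + (X + _)]big_ord_recr /= bin_small// mulr0n addr0.
rewrite addrA [RHS](_ : _ = \sum_(j < n.+1) (A j.+1 * B (n - j)%N) *+ 'C(n, j) +
  \sum_(j < n.+1) (A j * B (n - j).+1) *+ 'C(n, j)); last first.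
  by rewrite -big_split; apply: eq_bigr => i _; rewrite mulrnDl.
rewrite addrC; congr (_ + _).
rewrite [RHS]big_ord_recl /= bin0 subn0; congr (_ + _).
apply: eq_bigr => i _; rewrite /= /bump /= add1n subnSK//.
Qed.

(** The two new factors x - j and y - (n - j) add up to x + y - n, which does not depend on j. *)
Lemma Vandermonde_ffact x y n :
  \sum_(j < n.+1) (ffactR x j * ffactR y (n - j)) *+ 'C(n, j) = ffactR (x + y) n.
Proof.
elim: n => [|n IH]; first by rewrite big_ord1 /ffactR !big_ord0 mulr1.
rewrite binomial_convolution ffactRS -IH mulr_suml.
apply: eq_bigr => j _; rewrite !ffactRS.
have jn : (j <= n)%N by rewrite -ltnS.
rewrite -[LHS]mulr_natr -[X in _ = X * _]mulr_natr natrB//.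
move: (ffactR _ _) (ffactR _ _) ('C(n, j)%:R : F) (n%:R : F) (j%:R : F) => p q c k i.
by ring.
Qed.

End Vandermonde.

Section RankinCohen.
Context {R : realType}.
Notation C2 := (cplx R * cplx R)%type.
Notation Pi2 := (@halfplane2 R).
Implicit Types (z w : cplx R) (f : C2 -> cplx R).

Lemma pochhammer_ffact z n : pochhammer (z - n%:R) n = ffactR (z - 1) n.
Proof.
rewrite /pochhammer /ffactR (reindex_inj rev_ord_inj) /=.
apply: eq_bigr => i _; rewrite natrB// -natr1; ring.
Qed.

Definition rc_const (l1 l2 : cplx R) (l : nat) : cplx R := pochhammer (l1 + l2 + l%:R - 1) l / l`!%:R.

(** Read backwards, the two Pochhammer symbols are falling factorials of l1 + l - 1 and l2 + l - 1,
    bases that do not depend on j; so the sum is a Vandermonde convolution divided by l!. *)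
Lemma rc_const_sum (l1 l2 : cplx R) (l : nat) :
  \sum_(j < l.+1) (pochhammer (l1 + l%:R - j%:R) j * pochhammer (l2 + j%:R) (l - j)) /
      (j`!%:R * (l - j)`!%:R) = rc_const l1 l2 l.
Proof.
have f0 n : n`!%:R != 0 :> cplx R by rewrite pnatr_eq0 -lt0n fact_gt0.
have := Vandermonde_ffact (l1 + l%:R - 1) (l2 + l%:R - 1) l.
have -> : l1 + l%:R - 1 + (l2 + l%:R - 1) = (l1 + l2 + l%:R - 1 + l%:R) - 1 by ring.
rewrite -pochhammer_ffact addrK /rc_const => <-.
rewrite mulr_suml; apply: eq_bigr => j _.
have jl : (j <= l)%N by rewrite -ltnS.
rewrite (pochhammer_ffact (l1 + l%:R)).
have -> : l2 + j%:R = l2 + l%:R - (l - j)%:R by rewrite natrB//; ring.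
rewrite (pochhammer_ffact (l2 + l%:R)) -[_ *+ 'C(l, j)]mulr_natr -(bin_fact jl) !natrM.
have c0 : 'C(l, j)%:R != 0 :> cplx R by rewrite pnatr_eq0 -lt0n bin_gt0.
move: (f0 j) (f0 (l - j)%N) c0; move: (ffactR _ _) (ffactR _ _) => x y.
move: (j`!%:R) ((l - j)`!%:R) ('C(l, j)%:R) => p q r p0 q0 r0.
by field; rewrite p0 q0 r0.
Qed.

Lemma rc_const_neq0 (l1 l2 : cplx R) (l : nat) : 0 < reC l1 -> 0 < reC l2 -> rc_const l1 l2 l != 0.
Proof.
move=> h1 h2; apply: mulf_neq0; last by rewrite invr_eq0 pnatr_eq0 -lt0n fact_gt0.
case: l => [|l]; first by rewrite pochhammer0 oner_eq0.
apply: pochhammer_neq0; have l0 : 0 <= (l%:R : R) by [].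
by rewrite -natr1 !reimE; lra.
Qed.

(** Exchanging j derivatives d2 for d1 on the diagonal produces a sign that cancels the one in the
    operator, so all terms are multiples of the same derivative. *)
Lemma RankinCohen_flat (l1 l2 : cplx R) (l : nat) f w : hol2 f -> diag_flat f l -> halfplane w ->
  RankinCohen l1 l2 l f w = rc_const l1 l2 l * iter l partial1 f (w, w).
Proof.
move=> hf fl hw; rewrite /RankinCohen extend0_in// -rc_const_sum mulr_suml.
apply: eq_bigr => j _.
have jl : (j <= l)%N by rewrite -ltnS.
have le : (l - j + j <= l)%N by rewrite subnK.
have H := mixed_diag hf fl le hw; rewrite subnK// in H.
refine (etrans (congr1 _ H) _).
have ss : (-1) ^+ j * (-1) ^+ j = 1 :> cplx R by rewrite -expr2 sqrr_sign.
have alg (s u d x : cplx R) : s * s = 1 -> s * u / d * (s * x) = u / d * x.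
  by move=> h; rewrite -[RHS]mul1r -h; ring.
exact: alg.
Qed.

End RankinCohen.

(** Applied to the real parts of [l1] and [l2] and to two distinct orders of vanishing, whose sum is
    at least 1. *)
Lemma eigenvalue_gap (R : realType) (x y u v : R) :
  0 < x -> 0 < y -> 1 <= u + v -> x + y + u + v - 1 <> 0.
Proof. by lra. Qed.

(** * Bijectivity of Psi and its inverse *)

Section PsiBijection.
Context {R : realType}.
Notation C2 := (cplx R * cplx R)%type.
Notation Pi2 := (@halfplane2 R).
Context (l1 l2 : cplx R) (l : nat) (l1_gt0 : 0 < reC l1) (l2_gt0 : 0 < reC l2).
Implicit Types (g : cplx R -> cplx R) (f : C2 -> cplx R).

Let a : cplx R := l1 + l%:R.
Let b : cplx R := l2 + l%:R.
Let a0 : 0 < reC a. Proof. by rewrite /a !reimE ltr_wpDr. Qed.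
Let b0 : 0 < reC b. Proof. by rewrite /b !reimE ltr_wpDr. Qed.
Let ev : cplx R := - l%:R * (l1 + l2 + l%:R - 1).
Let K : cplx R := powC 2 (l1 + l2 + 2 * l%:R - 1) * l`!%:R.
(** The factor between [g] and d1^l of its transform on the diagonal: l! from the power x^l, 1 / K
    from the normalization, and the weight integral because the segment shrinks to a point. *)
Let diag_const : cplx R := l`!%:R * (K^-1 * wgt_int a b).

(** The normalization 1 / K is absorbed into [g], which puts the transform in the form x^l V of the
    eigenfunction lemmas. *)
Let PsiE g : (forall z, halfplane z -> differentiable g z) ->
  Psi l1 l2 l g = extend0 Pi2 (fun p => diagX p ^+ l * seg_int (fun z => K^-1 * g z) a b p).
Proof.
move=> dg; apply/funext => p; have [hp|hp] := pselect (Pi2 p); last first.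
  by rewrite /Psi !extend0_out.
rewrite /Psi !extend0_in// -/K -mulrA; congr (_ * _).
rewrite -(integralCZ _ (@measurable_I11 R)).
  apply: eq_integralC => v _; rewrite -segE /wgt -/a -/b.
  by move: (g _) (powC _ _) (powC _ _) => x y t; ring.
have := seg_int_integrable dg hp a0 b0; congr (cintegrable _ _).
by apply/funext => v; rewrite -segE /wgt mulrC mulrA.
Qed.

Let dif_Kg g : (forall z, halfplane z -> differentiable g z) ->
  forall z, halfplane z -> differentiable (fun z => K^-1 * g z) z.
Proof. by move=> dg z hz; apply: (dif_mul _ (dg z hz)); exact: dif_cst. Qed.

Let hol2_seg_int g : (forall z, halfplane z -> differentiable g z) -> hol2 (seg_int g a b).
Proof. by move=> dg p hp; have [h _ _] := seg_int_diff dg hp a0 b0; exact: h. Qed.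

Let Sol_Psi g : holomorphic halfplane g -> Sol l1 l2 ev (Psi l1 l2 l g).
Proof.
move=> [dg _]; rewrite (PsiE dg); apply: Sol_diagX.
  exact: hol2_seg_int (dif_Kg dg).
exact: seg_int_EPD (dif_Kg dg) a0 b0.
Qed.

Let Psi_flat g : holomorphic halfplane g -> diag_flat (Psi l1 l2 l g) l /\
  forall w, halfplane w -> iter l partial1 (Psi l1 l2 l g) (w, w) = diag_const * g w.
Proof.
move=> [dg _]; rewrite (PsiE dg); have dKg := dif_Kg dg.
have E := eq_on_sym (@eq_on_extend0 _ (fun p => diagX p ^+ l * seg_int (fun z => K^-1 * g z) a b p)).
have hV := hol2_seg_int dKg.
split=> [j jl w hw|w hw].
  refine (etrans (eq_on_iter1 j E (p := (w, w)) (conj hw hw)) _).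
  exact: diagX_exp_low hV hw jl.
refine (etrans (eq_on_iter1 l E (p := (w, w)) (conj hw hw)) _).
refine (etrans (diagX_exp_order l hV hw) _).
rewrite (seg_int_diag _ _ a0 b0) /diag_const.
by ring.
Qed.

(** The l! of the leading coefficient cancels the one in [K]; what remains is the weight integral
    over 2^(a + b - 1), the Beta function. *)
Let diag_constE : rc_const l1 l2 l * diag_const = c_const l l1 l2.
Proof.
rewrite (c_constE l l1_gt0 l2_gt0) -/(rc_const l1 l2 l) -/a -/b; congr (_ * _).
rewrite /diag_const /K /betaC.
have -> : l1 + l2 + 2 * l%:R - 1 = a + b - 1 by rewrite /a /b; ring.
have -> : powC (ofR 2) (a + b - 1) = powC 2 (a + b - 1) :> cplx R by rewrite ofR_nat.
have p0 := powC_neq0 (2 : cplx R) (a + b - 1).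
have f0 : l`!%:R != 0 :> cplx R by rewrite pnatr_eq0 -lt0n fact_gt0.
move: (powC _ _) (wgt_int _ _) (l`!%:R) p0 f0 => p w f p0 f0.
by field; rewrite p0 f0.
Qed.

Let diag_const_neq0 : diag_const != 0.
Proof.
have f0 : l`!%:R != 0 :> cplx R by rewrite pnatr_eq0 -lt0n fact_gt0.
have := betaC_neq0 a0 b0; rewrite /betaC mulf_eq0 negb_or => /andP[w0 _].
rewrite /diag_const /K mulf_neq0// mulf_neq0// invr_neq0// mulf_neq0//.
exact: powC_neq0.
Qed.

Lemma RankinCohen_Psi g : holomorphic halfplane g ->
  RankinCohen l1 l2 l (Psi l1 l2 l g) = (fun z => c_const l l1 l2 * g z).
Proof.
move=> hg; apply/funext => z; have [hz|hz] := pselect (halfplane z); last first.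
  by rewrite /RankinCohen extend0_out// (proj2 hg _ hz) mulr0.
have [fl H] := Psi_flat hg; have [[hP _] _] := Sol_Psi hg.
rewrite (RankinCohen_flat l1 l2 hP fl hz).
refine (etrans (congr1 _ (H z hz)) _).
by rewrite mulrA diag_constE.
Qed.

(** The eigenvalues for the orders k and l differ by (k - l) (l1 + l2 + k + l - 1), whose second
    factor has nonzero real part for k distinct from l. *)
Let Sol_flat f : Sol l1 l2 ev f -> f <> (fun=> 0) ->
  diag_flat f l /\ exists2 w, halfplane w & iter l partial1 f (w, w) != 0.
Proof.
move=> Sf fn; have [k [fl ex E]] := Sol_order Sf fn.
suff <- : k = l by [].
apply/eqP; apply: contraT => kl; exfalso.
have : (k%:R - l%:R) * (l1 + l2 + k%:R + l%:R - 1) = 0 :> cplx R.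
  have -> : (k%:R - l%:R) * (l1 + l2 + k%:R + l%:R - 1) =
      (- l%:R * (l1 + l2 + l%:R - 1)) - (- k%:R * (l1 + l2 + k%:R - 1)) :> cplx R by ring.
  by rewrite -E subrr.
move/eqP; rewrite mulf_eq0 => /orP[|].
  by rewrite subr_eq0 eqr_nat (negbTE kl).
move/eqP/(congr1 (@reC R)); rewrite !reimE => H.
have kl1 : (1 <= k + l)%N by rewrite addn_gt0; case: (k) (l) kl => [|k'] [|l'].
have : 1 <= k%:R + l%:R :> R by rewrite -natrD ler1n.
by move=> h; exact: eigenvalue_gap l1_gt0 l2_gt0 h H.
Qed.

Lemma Psi_bij : set_bij (holomorphic halfplane) (Sol l1 l2 ev) (Psi l1 l2 l).
Proof.
split.
- by move=> g hg; exact: Sol_Psi.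
- move=> g1 g2; rewrite !inE => h1 h2 E.
  have := RankinCohen_Psi h1; rewrite E (RankinCohen_Psi h2) => E'.
  apply/funext => z; have := congr1 (fun k => k z) E' => /=.
  have c0 : c_const l l1 l2 != 0.
    by rewrite -diag_constE mulf_neq0// rc_const_neq0.
  by move/(mulfI c0).
move=> f Sf.
have flat : diag_flat f l.
  have [->|/eqP fn] := eqVneq f (fun=> 0); last by have [] := Sol_flat Sf fn.
  move=> j _ w hw.
  have -> : iter j partial1 (fun=> 0 : cplx R) = (fun=> 0 : cplx R).
    by elim: j => // j IH; rewrite iterS IH; apply/funext => p; exact: partial1_cst.
  by [].
(* The only possible preimage, read off from d1^l f on the diagonal. *)
pose g := extend0 halfplane (fun w => diag_const^-1 * iter l partial1 f (w, w)).
have hf : hol2 f by case: Sf => -[].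
have hg : holomorphic halfplane g.
  split; last by move=> z; exact: extend0_out.
  move=> z hz.
  have dF : differentiable (fun w : cplx R => iter l partial1 f (w, w)) z.
    have dd : differentiable (fun w : cplx R => (w, w)) z.
      exact: (differentiable_pair (dif_id z) (dif_id z)).
    exact: (differentiable_comp dd (hol2_iter1 l hf (conj hz hz : Pi2 (z, z)))).
  apply: near_differentiable (dif_mul (dif_cst diag_const^-1 z) dF).
  have : \forall w \near z, halfplane w.
    apply/nbhs_nrm; exists (imC z) => // w wz.
    have := le_lt_trans (imC_le_nrm _) wz; rewrite imC_B ltr_norml => /andP[k _].
    by rewrite /halfplane/=; move: k; rewrite ltrBDr addNr.
  by apply: filterS => w hw; rewrite /g extend0_in.
have [fg Hg] := Psi_flat hg; have SP := Sol_Psi hg.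
exists g => //.
(* [h] is an eigenfunction for the same eigenvalue, and d1^l h vanishes on the diagonal by the
   choice of [g]; for nonzero [h] this would contradict [Sol_flat]. *)
pose h p : cplx R := f p - Psi l1 l2 l g p.
have hP : hol2 (Psi l1 l2 l g) by case: SP => -[].
have Sh : Sol l1 l2 ev h.
  case: Sf SP => [[_ f0] ef] [[_ P0] eP]; split; first split.
  - exact: hol2_sub hf hP.
  - by move=> p hp; rewrite /h f0// P0// subrr.
  - move=> p hp; refine (etrans (opP_sub l1 l2 hf hP hp) _).
    by rewrite /h mulrBr; congr (_ - _); [exact: ef|exact: eP].
have [h0|/eqP hn] := eqVneq h (fun=> 0).
  by apply/funext => p; apply/esym/eqP; rewrite -subr_eq0 -/(h p) h0.
exfalso; have [_ [w hw]] := Sol_flat Sh hn; apply/negP; rewrite negbK; apply/eqP.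
refine (etrans (iter_partial1_sub l hf hP (p := (w, w)) (conj hw hw)) _).
refine (etrans (congr1 _ (congr1 _ (Hg w hw))) _).
rewrite /g extend0_in// mulrA (divff diag_const_neq0) mul1r.
exact: subrr.
Qed.

End PsiBijection.

Theorem theorem2p30 (R : realType) (l1 l2 : cplx R) :
  [/\ forall mu : cplx R,
        Sol l1 l2 mu <> [set (fun=> 0)] <->
        exists l : nat, mu = - l%:R * (l1 + l2 + l%:R - 1),
      forall l : nat,
        Sol l1 l2 (- l%:R * (l1 + l2 + l%:R - 1))
          (extend0 halfplane2 (fun p =>
             (p.1 - p.2) ^+ l * powC (p.1 + iC) (- l1 - l%:R) *
             powC (p.2 + iC) (- l2 - l%:R))) &
      0 < reC l1 -> 0 < reC l2 -> forall l : nat,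
        set_bij (holomorphic halfplane)
          (Sol l1 l2 (- l%:R * (l1 + l2 + l%:R - 1))) (Psi l1 l2 l) /\
        forall g, holomorphic halfplane g ->
          RankinCohen l1 l2 l (Psi l1 l2 l g) =
          (fun z => c_const l l1 l2 * g z)].
Proof.
split=> [mu|l|h1 h2 l]; first exact: Sol_neq0P.
  exact: Sol_powers.
split; first exact: Psi_bij.
by move=> g; exact: RankinCohen_Psi.
Qed.
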